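(* There exists a shaved set of finite perimeter $S\subset Q=(-1,1)\times(-1,1)\times(-1,1)\subset\mathbb{R}^3$ with the following properties: (i) $S$ is connected and $S^c=\mathbb{R}^3\setminus S$ is connected; hence $S$ is an indecomposable saturated set. (ii) $|\bar{S}\setminus S|>\frac{3999}{4000}$. (iii) $H^{2}(\partial^M S\setminus \phi(S^2))>0$ for every Lipschitz map $\phi:S^2\to\mathbb{R}^3$, where in this item $S^2$ denotes the unit sphere in $\mathbb{R}^3$.
   Context: $|A|$ denotes Lebesgue measure, $H^2$ two-dimensional Hausdorff measure, $B_r(x)$ the ball of radius $r$ centred at $x$. A measurable set $E\subset\mathbb{R}^n$ is of finite perimeter if $\mathrm{Per}(E):=\sup\{\int_E \mathrm{div}\,\phi : \phi\in [C^1_c(\mathbb{R}^n)]^n,\ \|\phi\|_\infty\le 1\}<\infty$. A set $F$ is shaved if there is no $x\in F$ with $|B_r(x)\cap F|=0$ for some $r>0$. The measure theoretic boundary is $$\partial^M E:=\left\{x:\limsup_{r\to 0}\frac{|E\cap B_r(x)|}{|B_r(x)|}>0 \text{ and } \limsup_{r\to 0}\frac{|E^c\cap B_r(x)|}{|B_r(x)|}>0\right\}.$$ A set $E$ of finite perimeter is indecomposable if whenever $E=A\cup B$ with $A,B$ disjoint and $\mathrm{Per}(E)=\mathrm{Per}(A)+\mathrm{Per}(B)$, then $|A|=0$ or $|B|=0$. The indecomposable components of a set $E$ of finite perimeter are the members of the (unique up to null sets) at most countable family of pairwise disjoint indecomposable sets $E_i$ with $|E_i|>0$, $|E\,\triangle\,\bigcup_i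 E_i|=0$, $\mathrm{Per}(E)=\sum_i \mathrm{Per}(E_i)$, and such that every indecomposable subset of $E$ is contained, up to a null set, in some $E_i$. A hole of a set $S$ of finite perimeter is an indecomposable component of $S^c$ with finite measure; $S$ is saturated if it is (up to a null set) the union of itself and all its holes. *)

(* Defs.v *)
From HB Require Import structures.
From mathcomp Require Import all_boot all_order all_algebra.
From mathcomp Require Import all_classical all_reals all_analysis.

Set Implicit Arguments.
Unset Strict Implicit.
Unset Printing Implicit Defensive.

Import Order.TTheory GRing.Theory Num.Theory.
Import numFieldNormedType.Exports.

Local Open Scope classical_set_scope.
Local Open Scope ring_scope.

(* The point (x, y, z) of R^3 is the nested pair ((x, y), z).  The library norm
   on this product is the sup norm; it is used only for the topology and for
   derivatives.  Every metric notion below goes through [enorm]. *)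
Notation space3 R := (R * R * R)%type.

Section Euclidean.
Context {R : realType}.
Implicit Types (x : space3 R) (A : set (space3 R)).

Definition enorm x : R := Num.sqrt (x.1.1 ^+ 2 + x.1.2 ^+ 2 + x.2 ^+ 2).

Definition eball x (r : R) : set (space3 R) := [set y | enorm (y - x) < r].

Definition sphere2 : set (space3 R) := [set x | enorm x = 1].

Definition elipschitz_on A (f : space3 R -> space3 R) : Prop :=
  exists L : R, forall x y, A x -> A y -> enorm (f x - f y) <= L * enorm (x - y).

Definition open_cube : set (space3 R) :=
  [set x | [/\ -1 < x.1.1 < 1, -1 < x.1.2 < 1 & -1 < x.2 < 1]].

(* The value 0 is added so that the empty set has diameter 0 and not -oo. *)
Definition ediam A : \bar R :=
  ereal_sup (0%E |` [set (enorm (x - y))%:E | x in A & y in A]).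

(* pi / 4 * d ^ 2 is the area of the disc of diameter d, so the normalization
   makes H^2 agree with the area of planar sets. *)
Definition hausdorff2_delta (delta : R) A : \bar R :=
  ereal_inf [set (\sum_(k <oo) ((pi / 4)%:E * ediam (C k) ^+ 2))%E
            | C in [set C : nat -> set (space3 R) |
                 A `<=` \bigcup_k C k /\
                 forall k, (ediam (C k) <= delta%:E)%E]].

Definition hausdorff2 A : \bar R :=
  ereal_sup [set hausdorff2_delta delta A | delta in [set d : R | 0 < d]].

End Euclidean.

Section Lebesgue.
Context {R : realType}.

Definition borel_lebesgue3 :=
  ((@lebesgue_measure R \x @lebesgue_measure R) \x @lebesgue_measure R)%E.
HB.instance Definition _ := Measure.on borel_lebesgue3.

(* Lebesgue measure on the Lebesgue (not merely Borel) measurable subsets of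
   R^3.  As a function of arbitrary sets it is the Lebesgue outer measure. *)
Definition lebesgue3 : set _ -> \bar R :=
  @completed_measure_extension _ _ _ borel_lebesgue3.
HB.instance Definition _ := Measure.on lebesgue3.

Definition lebesgue_measurable3 (A : set (space3 R)) : Prop :=
  (borel_lebesgue3^*)%mu.-cara.-measurable A.

End Lebesgue.

Section FinitePerimeter.
Context {R : realType}.
Implicit Types (E : set (space3 R)) (f : space3 R -> R)
  (X : space3 R -> space3 R).

Definition e1 : space3 R := (1, 0, 0).
Definition e2 : space3 R := (0, 1, 0).
Definition e3 : space3 R := (0, 0, 1).

Definition C1 f : Prop := forall v, v \in [:: e1; e2; e3] ->
  (forall x, derivable f x v) /\ continuous ('D_v f).

Definition divergence X (x : space3 R) : R :=
  'D_e1 (fun y => (X y).1.1) x + 'D_e2 (fun y => (X y).1.2) x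
  + 'D_e3 (fun y => (X y).2) x.

Definition test_field X : Prop :=
  [/\ [/\ C1 (fun y => (X y).1.1), C1 (fun y => (X y).1.2)
        & C1 (fun y => (X y).2)],
      compact (closure [set x | X x != 0])
    & forall x, enorm (X x) <= 1].

Definition perimeter E : \bar R :=
  ereal_sup [set (\int[lebesgue3]_(x in E) (divergence X x)%:E)%E
            | X in test_field].

Definition finite_perimeter E : Prop :=
  lebesgue_measurable3 E /\ (perimeter E < +oo)%E.

Definition shaved E : Prop :=
  ~ exists x, E x /\
      exists r : R, 0 < r /\ lebesgue3 (eball x r `&` E) = 0%E.

Definition upper_density E (x : space3 R) : \bar R :=
  limf_esup (fun r : R => lebesgue3 (E `&` eball x r) / lebesgue3 (eball x r))%E
            0^'+.

Definition measure_theoretic_boundary E : set (space3 R) :=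
  [set x | (0 < upper_density E x)%E /\ (0 < upper_density (~` E) x)%E].

Definition indecomposable E : Prop :=
  finite_perimeter E /\
  forall A B, lebesgue_measurable3 A -> lebesgue_measurable3 B ->
    E = A `|` B -> A `&` B = set0 ->
    perimeter E = (perimeter A + perimeter B)%E ->
    lebesgue3 A = 0%E \/ lebesgue3 B = 0%E.

(* The family (F i)_{i in I}, I a set of naturals, is the decomposition of E
   into its indecomposable components.  A null set A is contained up to a null
   set in anything, so [0 < lebesgue3 A] matters only when I is empty, i.e. for
   null E, which has no component. *)
Definition indecomposable_components E (I : set nat)
    (F : nat -> set (space3 R)) : Prop :=
  [/\ forall i, I i -> indecomposable (F i) /\ (0 < lebesgue3 (F i))%E,
      trivIset I F,
      lebesgue3 (E `+` \bigcup_(i in I) F i) = 0%E,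
      perimeter E = (\esum_(i in I) perimeter (F i))%E
    & forall A, indecomposable A -> A `<=` E -> (0 < lebesgue3 A)%E ->
        exists2 i, I i & lebesgue3 (A `\` F i) = 0%E].

(* The decomposition is unique up to null sets, so the choice of the family
   (I, F) is immaterial; the holes of S are the F i of finite measure. *)
Definition saturated S : Prop :=
  finite_perimeter S /\
  exists (I : set nat) (F : nat -> set (space3 R)),
    indecomposable_components (~` S) I F /\
    lebesgue3 (S `+` (S `|` \bigcup_(i in [set i | I i /\
                                (lebesgue3 (F i) < +oo)%E]) F i)) = 0%E.

End FinitePerimeter.

(* Main.v *)
Require Import Defs.
From HB Require Import structures.
From mathcomp Require Import all_boot all_order all_algebra.
From mathcomp Require Import all_classical all_reals all_analysis.
From mathcomp Require Import measurable_realfun ring lra.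

Import Order.TTheory GRing.Theory Num.Theory.
Import numFieldNormedType.Exports.
Local Open Scope classical_set_scope.
Local Open Scope ring_scope.

(** The set is a comb: a slab (-1,1)^2 x (-1,0) carrying posts over pairwise
    disjoint squares.  The m-th square and the height of its post are chosen
    greedily so that the top of the post lies in the m-th rational box of
    (-1,1)^2 x (0,1), whenever some point of that box lies above no earlier
    closed square.  The squares are so small that most of (-1,1)^2 x (0,1) lies
    above none of them; these points are limits of tips of posts, which gives
    (ii).  The image of a Lipschitz map from the sphere is closed and null, so
    it misses one of these points together with a box around it, hence the whole
    top of some post; this gives (iii).

    For indecomposability, let E = A + B with Per E = Per A + Per B.  Fields that
    are nearly optimal for E are nearly optimal for A and for B.  Perturbing such
    a field by t psi e_i, where psi is a test function supported in E (or whose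
    flux through the boundary of E is small), shows that the integral over A of
    the i-th derivative of psi vanishes (or is small).  On a box inside E this
    makes A of constant density, hence null or conull.  Overlapping boxes then
    settle the comb and the part of its complement that lies outside the cube or
    above a post.  In the columns above no square, psi is cut off on the first N
    posts and the total size of the other posts bounds the error. *)

(** The perimeter enters only as a supremum over test fields; no reduced boundary, trace or coarea
    formula is used. Damping the i-th component of a nearly optimal field by the factor 1 - psi^2
    makes room for a perturbation t psi: the norm then grows only at order t^2, while the flux
    changes at order t.

    The obstacle is the set of columns over no square: every point there at a height in (0,1) is a
    limit of posts, so it lies in no box inside the complement, and the zero-one law for boxes is
    silent about it. In these columns only vertical derivatives are tested, with a cut-off in the
    horizontal coordinates alone. The vertical profile returns to 0 between heights 2 and 3, where
    the part in question is already known to be null.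

    The bound 2^-m / 4 on the half side of the m-th square serves twice: the fluxes through the
    posts have a geometric tail, and the squares, even when doubled, cover at most half of (-1,1)^2.
    Since the closed squares are disjoint, the column over each top is a box outside the comb that
    reaches the exterior. *)

Notation B3 R := (measurableTypeR R * measurableTypeR R * measurableTypeR R)%type.
Notation L3 R := (caratheodory_type (@borel_lebesgue3 R)^*%mu).
Notation leb R := (@lebesgue_measure R).

(** * Borel product measure and its completion *)

Section Measure.
Context {R : realType}.
Implicit Types (A B : set (space3 R)).

Lemma lebesgue_measurable3_borel (A : set (B3 R)) :
  measurable A -> lebesgue_measurable3 A.
Proof. exact: caratheodory_measurable_mu_ext. Qed.

Lemma lebesgue3_borel (A : set (B3 R)) :
  measurable A -> lebesgue3 A = borel_lebesgue3 A.
Proof. by move=> mA; exact: measurable_mu_extE. Qed.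

Lemma le_lebesgue3 A B : A `<=` B -> (lebesgue3 A <= lebesgue3 B)%E.
Proof.
move=> AB; apply: (le_mu_ext (@borel_lebesgue3 R)); exact: AB.
Qed.

Lemma borel_lebesgue3_box (X Y Z : set (measurableTypeR R)) :
  measurable X -> measurable Y -> measurable Z ->
  borel_lebesgue3 ((X `*` Y) `*` Z) = (leb R X * leb R Y * leb R Z)%E.
Proof.
move=> mX mY mZ; rewrite /borel_lebesgue3 product_measure1E//; last exact: measurableX.
by congr (_ * _)%E; exact: product_measure1E.
Qed.

(** This moves Borel integrands to the product measure, where Fubini applies. The identity from the
    completed sigma-algebra to the Borel one is measurable, and the change of variables along it
    compares the integrals of the positive and negative parts. *)
Lemma integral_lebesgue3_borel (D : set (B3 R)) (f : B3 R -> \bar R) :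
  measurable D -> measurable_fun setT f ->
  (\int[lebesgue3]_(x in D) f x = \int[borel_lebesgue3]_(x in D) f x)%E.
Proof.
move=> mD mf.
pose phi : L3 R -> B3 R := idfun.
have mphi : measurable_fun [set: L3 R] phi.
  by move=> _ Y mY; rewrite setTI; exact: lebesgue_measurable3_borel.
have H (g : B3 R -> \bar R) : measurable_fun setT g -> (forall x, 0 <= g x)%E ->
   (\int[lebesgue3]_(x in D) g x = \int[borel_lebesgue3]_(x in D) g x)%E.
  move=> mg g0.
  have := @ge0_integral_pushforward _ _ _ _ R phi mphi (@lebesgue3 R) D g mD (measurable_funS measurableT (@subsetT _ _) mg) (fun y _ => g0 y).
  move=> <-.
  apply: eq_measure_integral => A mA AD.
  exact: lebesgue3_borel.
rewrite integralE [RHS]integralE; congr (_ - _)%E; apply: H => //.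
- exact: measurable_funepos.
- exact: measurable_funeneg.
Qed.

End Measure.

(** * Lebesgue measure of boxes *)

Section Boxes.
Context {R : realType}.
Implicit Types (a b x : space3 R).

Definition obox a b : set (space3 R) :=
  [set x | [/\ a.1.1 < x.1.1 < b.1.1, a.1.2 < x.1.2 < b.1.2 & a.2 < x.2 < b.2]].

Lemma oboxE a b :
  obox a b = (`]a.1.1, b.1.1[ `*` `]a.1.2, b.1.2[) `*` `]a.2, b.2[.
Proof.
rewrite predeqE => -[[x1 x2] x3]; split => /=.
  by case=> ? ? ?; rewrite !in_itv.
by case=> -[]; rewrite /= !in_itv /=.
Qed.

Lemma measurable_obox a b : measurable (obox a b : set (B3 R)).
Proof.
by rewrite oboxE; apply: measurableX; [apply: measurableX|]; exact: measurable_itv.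
Qed.

Lemma lebesgue3_obox a b : a.1.1 <= b.1.1 -> a.1.2 <= b.1.2 -> a.2 <= b.2 ->
  lebesgue3 (obox a b) =
    ((b.1.1 - a.1.1) * (b.1.2 - a.1.2) * (b.2 - a.2))%:E.
Proof.
move=> h1 h2 h3; rewrite lebesgue3_borel ?oboxE; last by rewrite -oboxE; exact: measurable_obox.
rewrite borel_lebesgue3_box; try exact: measurable_itv.
rewrite !lebesgue_measure_itv/= !lte_fin.
have E (u v : R) : u <= v -> (if u < v then (v%:E - u%:E)%E else 0%E) = (v - u)%:E.
  by case: ltgtP => // ->; rewrite subrr.
by rewrite !E// -!EFinM.
Qed.

Lemma continuous_fst1 : continuous (fun x : space3 R => x.1.1).
Proof. by move=> x; apply: continuous_comp; exact: cvg_fst. Qed.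

Lemma continuous_fst2 : continuous (fun x : space3 R => x.1.2).
Proof. by move=> x; apply: continuous_comp; [exact: cvg_fst|exact: cvg_snd]. Qed.

Lemma open_obox a b : open (obox a b).
Proof.
have -> : obox a b = (fun x => x.1.1) @^-1` `]a.1.1, b.1.1[ `&`
    ((fun x => x.1.2) @^-1` `]a.1.2, b.1.2[ `&` (fun x => x.2) @^-1` `]a.2, b.2[).
  rewrite predeqE => x; split => [[]|[]]; rewrite /= !in_itv/=.
    by [].
  by move=> ? [? ?].
apply: openI; last apply: openI; apply: open_comp; try exact: interval_open.
- by move=> x _; exact: continuous_fst1.
- by move=> x _; exact: continuous_fst2.
- by move=> x _; exact: cvg_snd.
Qed.

(** A number that codes no pair of rational points gets the box with both corners at 0, which is
    empty; so every index is allowed. *)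
Definition rat_box (n : nat) : space3 R * space3 R :=
  if (unpickle n : option ((rat * rat * rat) * (rat * rat * rat))) is Some ((p, q, r), (p', q', r'))
  then ((ratr p, ratr q, ratr r), (ratr p', ratr q', ratr r')) else (0, 0).

Definition base_box n := obox (rat_box n).1 (rat_box n).2.

Lemma nbhs_obox x (U : set (space3 R)) : nbhs x U ->
  exists2 e : R, 0 < e &
    obox (x.1.1 - e, x.1.2 - e, x.2 - e) (x.1.1 + e, x.1.2 + e, x.2 + e) `<=` U.
Proof.
rewrite -nbhs_ballE => -[e/= e0 eU]; exists e => // y [h1 h2 h3]; apply: eU.
by do 2?[split]; rewrite /ball/= ltr_distlC.
Qed.

Lemma base_box_nbhs x (U : set (space3 R)) : nbhs x U ->
  exists2 n, base_box n x & base_box n `<=` U.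
Proof.
move=> /nbhs_obox[e e0 eU].
have L (z : R) : exists q : rat, z - e < ratr q < z.
  have : z - e < z by lra.
  by move=> /rat_in_itvoo[q]; rewrite in_itv/= => h; exists q.
have H (z : R) : exists q : rat, z < ratr q < z + e.
  have : z < z + e by lra.
  by move=> /rat_in_itvoo[q]; rewrite in_itv/= => h; exists q.
have [p hp] := L x.1.1; have [q hq] := L x.1.2; have [r hr] := L x.2.
have [p' hp'] := H x.1.1; have [q' hq'] := H x.1.2; have [r' hr'] := H x.2.
exists (pickle ((p, q, r), (p', q', r'))); rewrite /base_box /rat_box pickleK /=.
  by split => /=; lra.
move=> y [] /= h1 h2 h3; apply: eU; split => /=; lra.
Qed.

Lemma measurable_open3 (U : set (space3 R)) : open U -> measurable (U : set (B3 R)).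
Proof.
move=> oU.
have -> : U = \bigcup_(n in [set n | base_box n `<=` U]) base_box n.
  rewrite predeqE => x; split => [Ux|[n /= nU /nU//]].
  have /base_box_nbhs[n nx nU] : nbhs x U by exact: open_nbhs_nbhs.
  by exists n.
by apply: bigcup_measurable => n _; exact: measurable_obox.
Qed.

Lemma continuous_measurable3 (f : space3 R -> R) : continuous f ->
  measurable_fun setT (f : B3 R -> R).
Proof.
move=> cf; apply: (measurability _ (RGenOpens.measurableE R)).
move=> _ [_ [a [b ->] <-]]; rewrite setTI.
by apply: measurable_open3; move/continuousP: cf; apply; exact: interval_open.
Qed.

End Boxes.

(** * Bounding a double integral by its inner integrals *)

Section FubiniBound.
Context {d1 d2 : measure_display} {T1 : measurableType d1}
  {T2 : measurableType d2} {R : realType}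
  (m1 : {sigma_finite_measure set T1 -> \bar R})
  (m2 : {sigma_finite_measure set T2 -> \bar R}).

Lemma integral_bound_cst {d} {T : measurableType d} (m : {measure set T -> \bar R})
    (D : set T) (F : T -> \bar R) (c : R) : measurable D -> measurable_fun D F ->
  (forall x, D x -> `|F x| <= c%:E)%E ->
  (`|\int[m]_(x in D) F x| <= c%:E * m D)%E.
Proof.
move=> mD mF Fc; apply: (le_trans (le_abse_integral _ mD mF)).
rewrite -integral_cst//; apply: ge0_le_integral => //.
by apply: measurableT_comp.
Qed.

(** The form as an inequality, with the measure of the outer domain as a factor, allows iteration
    over three variables. *)
Lemma fubini_bound1 (D1 : set T1) (D2 : set T2) (f : T1 * T2 -> R) (c : R) :
  measurable D1 -> measurable D2 ->
  (m1 \x m2)%E.-integrable (D1 `*` D2) (EFin \o f) ->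
  (forall x, D1 x -> `|\int[m2]_(y in D2) (f (x, y))%:E| <= c%:E)%E ->
  (`|\int[m1 \x m2]_(z in D1 `*` D2) (f z)%:E| <= c%:E * m1 D1)%E.
Proof.
move=> mD1 mD2 intf fc.
have mD : measurable (D1 `*` D2) by exact: measurableX.
have := intf; rewrite (integrable_mkcond _ mD) => intf'.
rewrite integral_mkcond -(fubini1 intf').
(* Fubini is applied to the extension by 0; its inner integral is again an extension by 0, from
   [D1]. *)
have E x : fubini_F m2 ((EFin \o f) \_ (D1 `*` D2)) x =
    ((fun x => \int[m2]_(y in D2) (f (x, y))%:E) \_ D1)%E x.
  rewrite /fubini_F/= [RHS]patchE; case: ifPn => [xD|xD].
    rewrite [RHS]integral_mkcond; apply: eq_integral => y _.
    rewrite !patchE; congr (if _ then _ else _).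
    by rewrite in_setX xD.
  rewrite -[RHS](integral0 m2 setT); apply: eq_integral => y _.
  by rewrite patchE in_setX (negbTE xD).
under eq_integral do rewrite E.
rewrite -integral_mkcond; apply: integral_bound_cst => //.
have := measurable_fubini_F intf'; rewrite (funext E).
by move/(measurable_restrictT _ mD1).
Qed.

Lemma fubini_bound2 (D1 : set T1) (D2 : set T2) (f : T1 * T2 -> R) (c : R) :
  measurable D1 -> measurable D2 ->
  (m1 \x m2)%E.-integrable (D1 `*` D2) (EFin \o f) ->
  (forall y, D2 y -> `|\int[m1]_(x in D1) (f (x, y))%:E| <= c%:E)%E ->
  (`|\int[m1 \x m2]_(z in D1 `*` D2) (f z)%:E| <= c%:E * m2 D2)%E.
Proof.
move=> mD1 mD2 intf fc.
have mD : measurable (D1 `*` D2) by exact: measurableX.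
have := intf; rewrite (integrable_mkcond _ mD) => intf'.
rewrite integral_mkcond -(fubini2 intf').
have E x : fubini_G m1 ((EFin \o f) \_ (D1 `*` D2)) x =
    ((fun x => \int[m1]_(y in D1) (f (y, x))%:E) \_ D2)%E x.
  rewrite /fubini_G/= [RHS]patchE; case: ifPn => [xD|xD].
    rewrite [RHS]integral_mkcond; apply: eq_integral => y _.
    rewrite !patchE; congr (if _ then _ else _).
    by rewrite in_setX xD andbT.
  rewrite -[RHS](integral0 m1 setT); apply: eq_integral => y _.
  by rewrite patchE in_setX (negbTE xD) andbF.
under eq_integral do rewrite E.
rewrite -integral_mkcond; apply: integral_bound_cst => //.
have := measurable_fubini_G intf'; rewrite (funext E).
by move/(measurable_restrictT _ mD2).
Qed.

End FubiniBound.

Notation int3 A f := (Rintegral lebesgue3 A f).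

(** * Integrals of bounded functions with bounded support *)

Section Integral3.
Context {R : realType}.
Implicit Types (A B : set (space3 R)) (f g : space3 R -> R).

Definition cube (M : R) : set (space3 R) := obox (- M, - M, - M) (M, M, M).

Lemma sub_cube M N : M <= N -> cube M `<=` cube N.
Proof. by move=> MN x [/= h1 h2 h3]; split => /=; lra. Qed.

Lemma lebesgue3_cube M : 0 <= M -> lebesgue3 (cube M) = ((M + M) ^+ 3)%:E.
Proof.
by move=> M0; rewrite lebesgue3_obox/=; [congr (_%:E); ring|lra..].
Qed.

(** One constant bounds both the values and the support, so that sums, multiples and limits carry a
    single number. *)
Definition bounded_supp (M : R) f : Prop :=
  [/\ measurable_fun setT (f : B3 R -> R), forall x, `|f x| <= M
    & forall x, ~ cube M x -> f x = 0].

Lemma bounded_supp_ge0 {M f} : bounded_supp M f -> 0 <= M.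
Proof. by case=> _ /(_ 0) h _; apply: le_trans h. Qed.

Lemma bounded_supp_integrable {M f A} : bounded_supp M f -> lebesgue_measurable3 A ->
  lebesgue3.-integrable (A : set (L3 R)) (EFin \o f).
Proof.
move=> bf mA; have M0 := bounded_supp_ge0 bf; case: bf => mf fM fS.
have mf' : measurable_fun setT (f : L3 R -> R).
  move=> _ Y mY; rewrite setTI; apply: lebesgue_measurable3_borel.
  by rewrite -[X in measurable X]setTI; exact: mf.
have mC : measurable (cube M : set (L3 R)).
  by apply: lebesgue_measurable3_borel; exact: measurable_obox.
apply: (@integrableS _ (L3 R) R lebesgue3 setT) => //.
have -> : EFin \o f = (EFin \o f) \_ (cube M).
  apply/funext => x; rewrite patchE; case: ifPn => // /negP xM.
  by rewrite /= fS// => h; apply: xM; rewrite inE.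
rewrite -integrable_mkcond//; apply: measurable_bounded_integrable => //.
- suff: (@lebesgue3 R (cube M) < +oo)%E by [].
  by rewrite lebesgue3_cube// ltry.
- exact: measurable_funTS.
- exists M; split; first exact: num_real.
  by move=> N MN x _; apply: le_trans (ltW MN); exact: fM.
Qed.

Lemma bounded_suppD {M N f g} : bounded_supp M f -> bounded_supp N g ->
  bounded_supp (M + N) (fun x => f x + g x).
Proof.
move=> bf bg; have M0 := bounded_supp_ge0 bf; have N0 := bounded_supp_ge0 bg.
case: bf bg => mf fM fS [mg gN gS]; split.
- exact: measurable_funD.
- by move=> x; apply: (le_trans (ler_normD _ _)); apply: lerD.
- move=> x h; rewrite fS ?gS ?addr0//; apply: contra_not h; apply: sub_cube.
    by rewrite lerDr.
  by rewrite lerDl.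
Qed.

(** The summand 1 keeps the new constant at least [M] when [|c|] is small, since the support does
    not shrink with the values. *)
Lemma bounded_suppZ {M f} (c : R) : bounded_supp M f ->
  bounded_supp ((1 + `|c|) * M) (fun x => c * f x).
Proof.
move=> bf; have M0 := bounded_supp_ge0 bf; case: bf => mf fM fS; split.
- exact: measurable_funM.
- move=> x; rewrite normrM; apply: ler_pM => //.
  by rewrite lerDr.
- move=> x h; rewrite fS ?mulr0//; apply: contra_not h; apply: sub_cube.
  by rewrite mulrDl mul1r lerDl mulr_ge0.
Qed.

Lemma int3D {M N f g A} : lebesgue_measurable3 A -> bounded_supp M f ->
  bounded_supp N g -> int3 A (fun x => f x + g x) = int3 A f + int3 A g.
Proof.
move=> mA bf bg.
exact: (RintegralD mA (bounded_supp_integrable bf mA)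
  (bounded_supp_integrable bg mA)).
Qed.

Lemma int3Z {M f A} (c : R) : lebesgue_measurable3 A -> bounded_supp M f ->
  int3 A (fun x => c * f x) = c * int3 A f.
Proof.
move=> mA bf.
exact: (RintegralZl c mA (bounded_supp_integrable bf mA)).
Qed.

Lemma integral_int3 {M f A} : lebesgue_measurable3 A -> bounded_supp M f ->
  (\int[lebesgue3]_(x in A) (f x)%:E)%E = (int3 A f)%:E.
Proof.
move=> mA bf; rewrite /Rintegral fineK//.
exact: (integrable_fin_num mA (bounded_supp_integrable bf mA)).
Qed.

Lemma lebesgue_measurable3U {A B} : lebesgue_measurable3 A -> lebesgue_measurable3 B ->
  lebesgue_measurable3 (A `|` B).
Proof. exact: measurableU. Qed.

Lemma int3U {M f A B} : lebesgue_measurable3 A -> lebesgue_measurable3 B ->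
  A `&` B = set0 -> bounded_supp M f -> int3 (A `|` B) f = int3 A f + int3 B f.
Proof.
move=> mA mB AB bf.
apply: (Rintegral_setU mA mB); last exact/eqP.
exact: (bounded_supp_integrable bf (lebesgue_measurable3U mA mB)).
Qed.

Lemma int3_null {M f A N} : lebesgue_measurable3 A -> lebesgue_measurable3 N ->
  lebesgue3 N = 0%E -> bounded_supp M f -> int3 A f = int3 (A `\` N) f.
Proof.
move=> mA mN N0 bf; rewrite /Rintegral; congr (fine _).
apply: (negligible_integral mN mA) N0.
exact: (bounded_supp_integrable bf mA).
Qed.

Lemma int3_dominated {M} (f_ : nat -> space3 R -> R) {f A} : lebesgue_measurable3 A ->
  (forall n, bounded_supp M (f_ n)) -> bounded_supp M f ->
  (forall x, f_ n x @[n --> \oo] --> f x) ->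
  int3 A (f_ n) @[n --> \oo] --> int3 A f.
Proof.
move=> mA bfn bf cf; have M0 := bounded_supp_ge0 bf.
(* The integrable majorant for dominated convergence. *)
have bM : bounded_supp M (fun x => M * \1_(cube M) x).
  split.
  - apply: measurable_funM => //.
    by apply: (@measurable_indic _ (B3 R)); exact: measurable_obox.
  - move=> x; rewrite normrM ger0_norm// -[leRHS]mulr1 ler_wpM2l// indicE.
    by case: (_ \in _); rewrite ?normr1 ?normr0.
  - by move=> x xM; rewrite indicE memNset// mulr0.
have mL h N : bounded_supp N h -> measurable_fun (A : set (L3 R)) (EFin \o h).
  move=> bh; apply: (@measurable_int _ (L3 R) R lebesgue3 A).
  exact: (bounded_supp_integrable bh mA).
have [||_ _] := @dominated_convergence _ (L3 R) R lebesgue3 A mA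
  (fun n => EFin \o f_ n) (EFin \o f) (EFin \o (fun x => M * \1_(cube M) x))
  (fun n => mL _ _ (bfn n)) (mL _ _ bf) _ (bounded_supp_integrable bM mA).
- by apply: aeW => x _; apply: cvg_comp (cf x) _.
- apply: aeW => x n _; rewrite /= lee_fin.
  case: (bfn n) => _ fM fS; rewrite indicE.
  have [xM|xM] := pselect (cube M x); first by rewrite mem_set// mulr1.
  by rewrite fS// normr0 memNset// mulr0.
rewrite (integral_int3 mA bf).
under eq_fun do rewrite (integral_int3 mA (bfn _)).
by move/fine_cvgP => [_].
Qed.

End Integral3.

Section PlaneMeasure.
Context {R : realType}.

(* The library registers sigma-finiteness of [_ \x _] only for probabilities,
   hence this copy of the planar Lebesgue measure. *)
Definition plane_measure : set (measurableTypeR R * measurableTypeR R)%type -> \bar R :=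
  (leb R \x leb R)%E.
HB.instance Definition _ := Measure.on plane_measure.

Lemma plane_measureX (X Y : set (measurableTypeR R)) : measurable X -> measurable Y ->
  plane_measure (X `*` Y) = (leb R X * leb R Y)%E.
Proof. by move=> mX mY; exact: product_measure1E. Qed.

Lemma plane_measure_sigma_finite : sigma_finite setT plane_measure.
Proof.
have /sigma_finiteP[F [TF ndF Foo]] := sigma_finiteT (leb R).
exists (fun n => F n `*` F n).
  rewrite -setXTT TF predeqE => -[x y]; split.
    move=> [/= [n _ Fnx] [k _ Gky]]; exists (maxn n k) => //; split.
    - by move: x Fnx; exact/subsetPset/ndF/leq_maxl.
    - by move: y Gky; exact/subsetPset/ndF/leq_maxr.
  by move=> [n _ []/= ? ?]; split; exists n.
move=> k; have [? ?] := Foo k; split; first exact: measurableX.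
by rewrite plane_measureX// lte_mul_pinfty// ge0_fin_numE.
Qed.

HB.instance Definition _ :=
  Measure_isSigmaFinite.Build _ _ _ plane_measure plane_measure_sigma_finite.

End PlaneMeasure.

Section BoxBounds.
Context {R : realType}.
Implicit Types (A B : set (space3 R)) (f g : space3 R -> R).

Lemma lebesgue_measure_oo (u v : R) : u <= v -> leb R `]u, v[ = (v - u)%:E.
Proof.
move=> uv; rewrite lebesgue_measure_itv/= lte_fin.
by case: ltgtP uv => // ->; rewrite subrr.
Qed.

Lemma borel_integrable_obox {M f} a b : bounded_supp M f ->
  a.1.1 <= b.1.1 -> a.1.2 <= b.1.2 -> a.2 <= b.2 ->
  borel_lebesgue3.-integrable (obox a b : set (B3 R)) (EFin \o f).
Proof.
move=> bf h1 h2 h3; have mb := measurable_obox a b.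
apply: measurable_bounded_integrable => //.
- suff: (@borel_lebesgue3 R (obox a b) < +oo)%E by [].
  by rewrite -lebesgue3_borel// lebesgue3_obox// ltry.
- by case: bf => mf _ _; exact: measurable_funTS.
- case: bf => _ fM _; exists M; split; first exact: num_real.
  by move=> N MN x _; apply: le_trans (ltW MN); exact: fM.
Qed.

(** As the product is nested on the left, integrating first along the third axis takes one use of
    Fubini; for the other two axes a second use on horizontal sections follows. *)
Lemma box_bound3 {M f} a b (c : R) : bounded_supp M f ->
  a.1.1 <= b.1.1 -> a.1.2 <= b.1.2 -> a.2 <= b.2 ->
  (forall x y, a.1.1 < x < b.1.1 -> a.1.2 < y < b.1.2 ->
     (`|\int[leb R]_(z in `]a.2, b.2[) (f (x, y, z))%:E| <= c%:E)%E) ->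
  `|int3 (obox a b) f| <= c * ((b.1.1 - a.1.1) * (b.1.2 - a.1.2)).
Proof.
move=> bf h1 h2 h3 fc; have mb := measurable_obox a b.
have mf : measurable_fun setT (EFin \o f : B3 R -> \bar R).
  by case: bf => mf _ _; exact/measurable_EFinP.
rewrite -lee_fin -abse_EFin -(integral_int3 _ bf); last exact: lebesgue_measurable3_borel.
rewrite (integral_lebesgue3_borel _ _ mb mf).
have := borel_integrable_obox a b bf h1 h2 h3.
rewrite oboxE /borel_lebesgue3 => intf.
have := fubini_bound1 plane_measure (leb R) _ _ f c _ _ intf _.
rewrite [X in (_ * X)%E]plane_measureX; try exact: measurable_itv.
rewrite !lebesgue_measure_oo// -!EFinM; apply.
- by apply: measurableX; exact: measurable_itv.
- exact: measurable_itv.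
- by move=> [x y] [/=]; rewrite !in_itv/= => ? ?; exact: fc.
Qed.

Lemma section_integrable {M f} (a b : R * R) z : bounded_supp M f ->
  a.1 <= b.1 -> a.2 <= b.2 ->
  plane_measure.-integrable
    (`]a.1, b.1[ `*` `]a.2, b.2[ : set (measurableTypeR R * measurableTypeR R))
    (EFin \o (fun p => f (p, z))).
Proof.
move=> [mf fM _] h1 h2; apply: measurable_bounded_integrable => //.
- by apply: measurableX; exact: measurable_itv.
- rewrite [X in (X < _)%E]plane_measureX; try exact: measurable_itv.
  by rewrite !lebesgue_measure_oo// -EFinM ltry.
- apply: measurable_funTS.
  exact: (measurableT_comp mf (@pair2_measurable _ _ (measurableTypeR R * measurableTypeR R)%type (measurableTypeR R) z)).
- exists M; split; first exact: num_real.
  by move=> N MN x _; apply: le_trans (ltW MN); exact: fM.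
Qed.

Lemma box_bound1 {M f} a b (c : R) : bounded_supp M f ->
  a.1.1 <= b.1.1 -> a.1.2 <= b.1.2 -> a.2 <= b.2 ->
  (forall y z, a.1.2 < y < b.1.2 -> a.2 < z < b.2 ->
     (`|\int[leb R]_(x in `]a.1.1, b.1.1[) (f (x, y, z))%:E| <= c%:E)%E) ->
  `|int3 (obox a b) f| <= c * (b.1.2 - a.1.2) * (b.2 - a.2).
Proof.
move=> bf h1 h2 h3 fc; have mb := measurable_obox a b.
have mf : measurable_fun setT (EFin \o f : B3 R -> \bar R).
  by case: bf => mf _ _; exact/measurable_EFinP.
rewrite -lee_fin -abse_EFin -(integral_int3 _ bf); last exact: lebesgue_measurable3_borel.
rewrite (integral_lebesgue3_borel _ _ mb mf).
have := borel_integrable_obox a b bf h1 h2 h3.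
rewrite oboxE /borel_lebesgue3 => intf.
have := fubini_bound2 plane_measure (leb R) _ _ f (c * (b.1.2 - a.1.2)) _ _ intf _.
rewrite [X in (_ * X)%E]lebesgue_measure_oo// -!EFinM; apply.
- by apply: measurableX; exact: measurable_itv.
- exact: measurable_itv.
- move=> z /=; rewrite in_itv/= => hz.
  have := fubini_bound2 (leb R) (leb R) _ _ (fun p => f (p, z)) c _ _ (section_integrable a.1 b.1 z bf h1 h2) _.
  rewrite [X in (_ * X)%E]lebesgue_measure_oo// -!EFinM; apply; try exact: measurable_itv.
  by move=> y /=; rewrite in_itv/= => hy; exact: fc.
Qed.

Lemma box_bound2 {M f} a b (c : R) : bounded_supp M f ->
  a.1.1 <= b.1.1 -> a.1.2 <= b.1.2 -> a.2 <= b.2 ->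
  (forall x z, a.1.1 < x < b.1.1 -> a.2 < z < b.2 ->
     (`|\int[leb R]_(y in `]a.1.2, b.1.2[) (f (x, y, z))%:E| <= c%:E)%E) ->
  `|int3 (obox a b) f| <= c * (b.1.1 - a.1.1) * (b.2 - a.2).
Proof.
move=> bf h1 h2 h3 fc; have mb := measurable_obox a b.
have mf : measurable_fun setT (EFin \o f : B3 R -> \bar R).
  by case: bf => mf _ _; exact/measurable_EFinP.
rewrite -lee_fin -abse_EFin -(integral_int3 _ bf); last exact: lebesgue_measurable3_borel.
rewrite (integral_lebesgue3_borel _ _ mb mf).
have := borel_integrable_obox a b bf h1 h2 h3.
rewrite oboxE /borel_lebesgue3 => intf.
have := fubini_bound2 plane_measure (leb R) _ _ f (c * (b.1.1 - a.1.1)) _ _ intf _.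
rewrite [X in (_ * X)%E]lebesgue_measure_oo// -!EFinM; apply.
- by apply: measurableX; exact: measurable_itv.
- exact: measurable_itv.
- move=> z /=; rewrite in_itv/= => hz.
  have := fubini_bound1 (leb R) (leb R) _ _ (fun p => f (p, z)) c _ _ (section_integrable a.1 b.1 z bf h1 h2) _.
  rewrite [X in (_ * X)%E]lebesgue_measure_oo// -!EFinM; apply; try exact: measurable_itv.
  by move=> y /=; rewrite in_itv/= => hy; exact: fc.
Qed.

(** Indexed coordinates let the three axes be treated by one statement. *)
Definition crd (i : 'I_3) (x : space3 R) : R :=
  match val i with 0%N => x.1.1 | 1%N => x.1.2 | _ => x.2 end.

Lemma hyperplane_null (i : 'I_3) (c : R) :
  lebesgue3 [set x | crd i x = c] = 0%E /\
  measurable ([set x | crd i x = c] : set (B3 R)).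
Proof.
have mS (u : R) : measurable ([set u] : set (measurableTypeR R)) by exact: measurable_set1.
have mT : measurable ([set: measurableTypeR R]) by exact: measurableT.
have H (X Y Z : set (measurableTypeR R)) : measurable X -> measurable Y -> measurable Z ->
  (leb R X * leb R Y * leb R Z = 0)%E -> forall A : set (space3 R), A = (X `*` Y) `*` Z ->
  lebesgue3 A = 0%E /\ measurable (A : set (B3 R)).
  move=> mX mY mZ h A ->; split.
    rewrite lebesgue3_borel; last by apply: measurableX => //; exact: measurableX.
    by rewrite borel_lebesgue3_box.
  by apply: measurableX => //; exact: measurableX.
case: i => -[|[|[|//]]] /= ?; rewrite /crd/=.
- apply: (H [set c] setT setT) => //; first by rewrite lebesgue_measure_set1 !mul0e.
  by rewrite predeqE => -[[? ?] ?] /=; split => [->|[[]]].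
- apply: (H setT [set c] setT) => //; first by rewrite lebesgue_measure_set1 mule0 mul0e.
  by rewrite predeqE => -[[? ?] ?] /=; split => [->|[[]]].
- apply: (H setT setT [set c]) => //; first by rewrite lebesgue_measure_set1 mule0.
  by rewrite predeqE => -[[? ?] ?] /=; split => [->|[[]]].
Qed.

End BoxBounds.

Definition ax {R : realType} (i : 'I_3) : space3 R :=
  match val i with 0%N => e1 | 1%N => e2 | _ => e3 end.

Notation "'d_ i f" := ('D_(ax i) f) (at level 10, i at level 2, f at level 9).

(** * Calculus in coordinates *)

Section Calculus.
Context {R : realType}.
Implicit Types (x y : space3 R) (f g : space3 R -> R) (i j : 'I_3).

(** As [t] varies, this point runs through the line through [x] parallel to axis [i], which reduces
    partial derivatives to one-variable calculus. *)
Definition setc i x (t : R) : space3 R :=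
  match val i with
  | 0%N => (t, x.1.2, x.2) | 1%N => (x.1.1, t, x.2) | _ => (x.1.1, x.1.2, t) end.

Lemma ord3P (P : 'I_3 -> Prop) : P 0 -> P 1 -> P (inord 2) -> forall i, P i.
Proof.
move=> P0 P1 P2 [[|[|[|//]]] h].
- by rewrite (_ : Ordinal h = 0)//; exact/val_inj.
- by rewrite (_ : Ordinal h = 1)//; exact/val_inj.
- by rewrite (_ : Ordinal h = inord 2)//; apply/val_inj; rewrite /= inordK.
Qed.

Lemma space3_eq x y : (forall i, crd i x = crd i y) -> x = y.
Proof.
case: x y => [[a b] c] [[a' b'] c'] h.
have := h 0; have := h 1; have := h (inord 2).
by rewrite /crd/= inordK//= => -> -> ->.
Qed.

Lemma crd_setc i j x t : crd j (setc i x t) = if i == j then t else crd j x.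
Proof. by case: i => -[|[|[|//]]] ?; case: j => -[|[|[|//]]] ?. Qed.

Lemma setc_crd i x : setc i x (crd i x) = x.
Proof. by apply: space3_eq => j; rewrite crd_setc; case: eqP => // ->. Qed.

Lemma crd_ax i j : crd j (ax i) = (i == j)%:R :> R.
Proof. by case: i => -[|[|[|//]]] ?; case: j => -[|[|[|//]]] ?. Qed.

Lemma crdD i x y : crd i (x + y) = crd i x + crd i y.
Proof. by case: i => -[|[|[|//]]] ?. Qed.

Lemma crdZ i (c : R) x : crd i (c *: x) = c * crd i x.
Proof. by case: i => -[|[|[|//]]] ?. Qed.

Lemma continuous_crd i : continuous (crd i : space3 R -> R).
Proof.
case: i => -[|[|[|//]]] ? x; rewrite /crd/=.
- exact: continuous_fst1.
- exact: continuous_fst2.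
- exact: cvg_snd.
Qed.

Lemma line_setc i x t h : h *: ax i + setc i x t = setc i x (h + t).
Proof.
apply: space3_eq => j; rewrite crdD crdZ crd_ax !crd_setc.
by case: eqP => _; rewrite ?mulr1// mulr0 add0r.
Qed.

Lemma is_derive_line f i x t : derivable f (setc i x t) (ax i) ->
  is_derive t 1 (fun s : R => f (setc i x s)) ('d_i f (setc i x t)).
Proof.
have E : (fun h => h^-1 *: (((fun s : R => f (setc i x s)) \o shift t) (h *: (1 : R)) - f (setc i x t)))
  = (fun h => h^-1 *: ((f \o shift (setc i x t)) (h *: ax i) - f (setc i x t))).
  by apply/funext => h; rewrite /= line_setc [h *: 1]mulr1.
by move=> df; split; rewrite ?/derivable ?/derive E.
Qed.

Lemma C1P f : C1 f <-> forall i, (forall x, derivable f x (ax i)) /\ continuous ('d_i f).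
Proof.
split=> h i.
  by case: i => -[|[|[|//]]] ?; apply: h; rewrite !inE eqxx ?orbT.
rewrite !inE => /or3P[] /eqP ->.
- exact: (h 0).
- exact: (h 1).
- by have := h (inord 2); rewrite /ax/= inordK.
Qed.

(** The derivative is bounded on an interval symmetric about [u], which covers both orders of [u]
    and [v] in the mean value theorem. *)
Lemma lipschitz_line (g dg : R -> R) (M u v : R) :
  (forall t : R, is_derive t 1 g (dg t)) ->
  (forall t, `|t - u| <= `|v - u| -> `|dg t| <= M) ->
  `|g v - g u| <= M * `|v - u|.
Proof.
move=> dgE dgM.
have cg : continuous g.
  move=> t; apply: differentiable_continuous; apply/derivable1_diffP.
  by have [] := dgE t.
have cw (a b : R) : {within `[a, b], continuous g}.
  by apply: continuous_subspaceT => t; exact: cg.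
have [uv|vu] := leP u v.
  have [c] := MVT_segment uv (fun (t : R) _ => dgE t) (cw u v).
  rewrite in_itv/= => /andP[uc cv] ->; rewrite normrM ler_wpM2r// dgM//.
  by rewrite !ger0_norm ?subr_ge0// lerD2r.
have [c] := MVT_segment (ltW vu) (fun (t : R) _ => dgE t) (cw v u).
rewrite in_itv/= => /andP[vc cu]; rewrite distrC => ->.
rewrite normrM distrC ler_wpM2r// dgM//.
by rewrite -![`|_ - u|]normrN !opprB !ger0_norm ?subr_ge0 ?(ltW vu)// lerD2l lerN2.
Qed.

(** [C1] asks for continuous partial derivatives only. A nearby point is reached by three moves
    parallel to the axes, along each of which the mean value theorem bounds the change of [f] by
    [e / 3]. *)
Lemma C1_continuous f : C1 f -> continuous f.
Proof.
move=> /C1P fC x; apply/cvgrPdist_le => e e0.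
(* Near [x] all three partial derivatives are bounded by this number. *)
pose M := 1 + `|'d_0 f x| + `|'d_1 f x| + `|'d_(inord 2) f x|.
have M0 : 0 < M.
  have H (a b c : R) : 0 <= a -> 0 <= b -> 0 <= c -> 0 < 1 + a + b + c by move=> *; lra.
  by apply: H; exact: normr_ge0.
have nM : nbhs x [set y | forall i, `|'d_i f y| <= M].
  have nMi i : nbhs x [set y | `|'d_i f y| <= 1 + `|'d_i f x|].
    have [_ ci] := fC i.
    have /cvgrPdist_le/(_ _ ltr01) := ci x; apply: filterS => y /= h.
    rewrite -lerBlDr; apply: (le_trans (lerB_dist _ _)).
    by rewrite distrC.
  have nM i : 1 + `|'d_i f x| <= M.
    have H (a b c : R) : 0 <= a -> 0 <= b -> 0 <= c ->
        [/\ 1 + a <= 1 + a + b + c, 1 + b <= 1 + a + b + c & 1 + c <= 1 + a + b + c].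
      by move=> *; split; lra.
    have [H0 H1 H2] := H _ _ _ (normr_ge0 ('d_0 f x)) (normr_ge0 ('d_1 f x)) (normr_ge0 ('d_(inord 2) f x)).
    by move: i; apply: ord3P; [exact: H0|exact: H1|exact: H2].
  apply: filterS (filterI (nMi 0) (filterI (nMi 1) (nMi (inord 2)))).
  move=> y /= [h0 [h1 h2]]; apply: ord3P.
  - exact: le_trans h0 (nM 0).
  - exact: le_trans h1 (nM 1).
  - exact: le_trans h2 (nM (inord 2)).
have [d d0 dM] := nbhs_obox _ _ nM.
pose d' := Num.min (d / 2) (e / (3 * M)).
have d'0 : 0 < d' by rewrite lt_min !divr_gt0// mulr_gt0.
have [d'd d'e] : d' < d /\ M * d' <= e / 3.
  split; first by rewrite gt_min; apply/orP; left; lra.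
  have : d' <= e / (3 * M) by rewrite ge_min lexx orbT.
  move=> /(ler_wpM2l (ltW M0)) /le_trans; apply.
  by rewrite le_eqVlt; apply/orP; left; apply/eqP; field; rewrite gt_eqF.
have : nbhs x (obox (x.1.1 - d', x.1.2 - d', x.2 - d') (x.1.1 + d', x.1.2 + d', x.2 + d')).
  by apply: open_nbhs_nbhs; split; [exact: open_obox|split => /=; lra].
apply: filterS => y yd.
have {yd} yx i : `|crd i y - crd i x| <= d'.
  rewrite ler_distl; case: yd => /= ? ? ?; move: i.
  by apply: ord3P; rewrite /crd/= ?inordK//=; lra.
have L i (z : space3 R) : (forall j, `|crd j z - crd j x| <= d') -> crd i z = crd i x ->
    `|f (setc i z (crd i y)) - f z| <= e / 3.
  move=> hz zx; have [dfi _] := fC i.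
  have H : forall t, `|t - crd i z| <= `|crd i y - crd i z| -> `|'d_i f (setc i z t)| <= M.
    move=> t ht; apply: dM.
    have {}ht j : `|crd j (setc i z t) - crd j x| < d.
      rewrite crd_setc; apply: le_lt_trans d'd; case: eqP => [<-|_]; last exact: hz.
      by rewrite -zx; apply: (le_trans ht); rewrite zx.
    move: (ht 0) (ht 1) (ht (inord 2)); rewrite /crd/= inordK//= !ltr_distl => ? ? ?.
    by split => /=; lra.
  have := lipschitz_line _ _ _ _ _ (fun t => is_derive_line f i z t (dfi _)) H.
  rewrite setc_crd => /le_trans; apply; apply: le_trans d'e.
  by apply: ler_wpM2l; [exact: ltW|rewrite zx].
pose z1 := setc 0 x (crd 0 y); pose z2 := setc 1 z1 (crd 1 y).
have E : y = setc (inord 2) z2 (crd (inord 2) y).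
  by apply: space3_eq; apply: ord3P; rewrite /crd/setc/= ?inordK.
have z1x j : `|crd j z1 - crd j x| <= d'.
  by rewrite crd_setc; case: eqP => [<-//|_]; rewrite subrr normr0 ltW.
have z2x j : `|crd j z2 - crd j x| <= d'.
  by rewrite crd_setc; case: eqP => [<-//|_].
have x0 j : `|crd j x - crd j x| <= d' by rewrite subrr normr0 ltW.
have B1 := L 0 x x0 erefl.
have B2 := L 1 z1 z1x (crd_setc _ _ _ _).
have B3 : `|f y - f z2| <= e / 3.
  rewrite E; apply: L => //.
  by rewrite !crd_setc -!val_eqE/= inordK.
have e3 : e = e / 3 + (e / 3 + e / 3) by lra.
rewrite e3 distrC; apply: (le_trans (ler_distD (f z2) _ _)); apply: lerD => //.
by apply: (le_trans (ler_distD (f z1) _ _)); apply: lerD.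
Qed.

End Calculus.

Section C1Algebra.
Context {R : realType}.
Implicit Types (x y : space3 R) (f g : space3 R -> R) (i j : 'I_3).

Definition C1R (f f' : R -> R) := (forall t : R, is_derive t 1 f (f' t)) /\ continuous f'.

Lemma C1_cst (c : R) : C1 (fun _ : space3 R => c).
Proof.
apply/C1P => i; split=> [x|]; first exact: derivable_cst.
rewrite (_ : 'd_i _ = cst 0); first exact: cst_continuous.
by apply/funext => x; rewrite derive_cst.
Qed.

Lemma derive3D f g i x : C1 f -> C1 g ->
  'd_i (fun y => f y + g y) x = 'd_i f x + 'd_i g x.
Proof.
by move=> /C1P fC /C1P gC; apply: deriveD; [have [] := fC i|have [] := gC i].
Qed.

Lemma C1D f g : C1 f -> C1 g -> C1 (fun x => f x + g x).
Proof.
move=> fC gC; have [/C1P fC' /C1P gC'] := (fC, gC); apply/C1P => i.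
have [[df cf] [dg cg]] := (fC' i, gC' i); split=> [x|].
  exact: derivableD.
rewrite (_ : 'd_i _ = fun x => 'd_i f x + 'd_i g x).
  by move=> x; apply: cvgD; [exact: cf|exact: cg].
by apply/funext => x; exact: derive3D.
Qed.

Lemma derive3M f g i x : C1 f -> C1 g ->
  'd_i (fun y => f y * g y) x = f x * 'd_i g x + g x * 'd_i f x.
Proof.
by move=> /C1P fC /C1P gC; apply: deriveM; [have [] := fC i|have [] := gC i].
Qed.

Lemma C1M f g : C1 f -> C1 g -> C1 (fun x => f x * g x).
Proof.
move=> fC gC; have [/C1P fC' /C1P gC'] := (fC, gC); apply/C1P => i.
have [[df cf] [dg cg]] := (fC' i, gC' i); split=> [x|].
  exact: derivableM.
rewrite (_ : 'd_i _ = fun x => f x * 'd_i g x + g x * 'd_i f x).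
  move=> x; apply: cvgD; apply: cvgM.
  - exact: (C1_continuous _ fC).
  - exact: cg.
  - exact: (C1_continuous _ gC).
  - exact: cf.
by apply/funext => x; exact: derive3M.
Qed.

Lemma derive3Z (c : R) f i x : C1 f -> 'd_i (fun y => c * f y) x = c * 'd_i f x.
Proof.
move=> fC; apply: etrans (derive3M (fun=> c) f i x (C1_cst c) fC) _.
by rewrite derive_cst mulr0 addr0.
Qed.

Lemma C1Z (c : R) f : C1 f -> C1 (fun x => c * f x).
Proof. by move=> fC; apply: C1M => //; exact: C1_cst. Qed.

Lemma C1V f : (forall x, f x != 0) -> C1 f -> C1 (fun x => (f x)^-1).
Proof.
move=> f0 fC; have /C1P fC' := fC; apply/C1P => i.
have [df cf] := fC' i; split=> [x|].
  exact: derivableV.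
rewrite (_ : 'd_i _ = fun x => - (f x ^- 2) * 'd_i f x).
  move=> x; apply: cvgM; last exact: cf.
  apply: cvgN; apply: cvgV; first by rewrite sqrf_eq0.
  by rewrite expr2; apply: cvgM; exact: C1_continuous.
by apply/funext => x; exact: deriveV.
Qed.

Lemma derive_crd (p p' : R -> R) i j x : C1R p p' ->
  is_derive x (ax i) (fun y => p (crd j y)) ((i == j)%:R * p' (crd j x)).
Proof.
move=> [dp _]; have [<-|/eqP ij] := eqVneq i j.
  rewrite mul1r; have [h1 h2] := dp (crd i x).
  have E : (fun h => h^-1 *: (((fun y => p (crd i y)) \o shift x) (h *: ax i) - p (crd i x)))
    = (fun h => h^-1 *: ((p \o shift (crd i x)) (h *: (1 : R)) - p (crd i x))).
    by apply/funext => h; rewrite /= crdD crdZ crd_ax eqxx.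
  by split; rewrite ?/derivable ?/derive E.
rewrite mul0r.
have E : (fun h => h^-1 *: (((fun y => p (crd j y)) \o shift x) (h *: ax i) - p (crd j x)))
    = (fun h => h^-1 *: ((cst (0 : R) \o shift x) (h *: ax i) - cst (0 : R) x)).
  apply/funext => h; rewrite /= crdD crdZ crd_ax (introF eqP ij) mulr0 add0r.
  by rewrite !subrr.
have [h1 h2] := is_derive_cst (0 : R) x (ax i).
by split; rewrite ?/derivable ?/derive E.
Qed.

Lemma C1_crd (p p' : R -> R) j : C1R p p' -> C1 (fun y => p (crd j y)).
Proof.
move=> pC; apply/C1P => i; split=> [x|]; first by have [] := derive_crd _ _ i j x pC.
rewrite (_ : 'd_i _ = fun x => (i == j)%:R * p' (crd j x)).
  move=> x; apply: cvgM; first exact: cvg_cst.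
  by apply: continuous_comp; [exact: continuous_crd|case: pC => _; exact].
by apply/funext => x; have [_] := derive_crd _ _ i j x pC.
Qed.

Definition csupp (M : R) f := forall x, ~ cube M x -> f x = 0.

Lemma csuppW M N f : M <= N -> csupp M f -> csupp N f.
Proof. by move=> MN fM x h; apply: fM; apply: contra_not h; exact: sub_cube. Qed.

(** At a boundary point of the open cube [f] need not vanish nearby; the margin 1 leaves a
    neighbourhood on which it does. *)
Lemma derive_csupp M f i : csupp M f -> csupp (M + 1) ('d_i f).
Proof.
move=> fM x xM.
rewrite (@near_eq_derive _ _ _ f (cst 0) x); first by rewrite derive_cst.
have : nbhs x (obox (x.1.1 - 1, x.1.2 - 1, x.2 - 1) (x.1.1 + 1, x.1.2 + 1, x.2 + 1)).
  by apply: open_nbhs_nbhs; split; [exact: open_obox|split => /=; lra].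
apply: filterS => y [/= h1 h2 h3]; apply: fM; apply: contra_not xM => -[/= h4 h5 h6].
by split => /=; lra.
Qed.

Definition ccube (M : R) : set (space3 R) :=
  (`[- M, M] `*` `[- M, M]) `*` `[- M, M].

Lemma compact_ccube M : compact (ccube M).
Proof. by do 2?apply: compact_setX; exact: segment_compact. Qed.

Lemma cube_ccube M : cube M `<=` ccube M.
Proof.
by move=> x [/= h1 h2 h3]; do 2?split => /=; rewrite in_itv/= !ltW//; lra.
Qed.

(** The claim for all larger constants lets finitely many functions share one, namely a maximum. *)
Lemma csupp_bounded M f : continuous f -> csupp M f ->
  exists N, forall N', N <= N' -> bounded_supp N' f.
Proof.
move=> cf fM.
have : compact (f @` ccube M).
  apply: continuous_compact; last exact: compact_ccube.
  by apply: continuous_subspaceT => x; exact: cf.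
move=> /compact_bounded[K [Kr hK]].
pose N := Num.max M (Num.max 0 (K + 1)).
have N0 : 0 <= N by rewrite /N !le_max lexx orbT.
have MN : M <= N by rewrite /N le_max lexx.
exists N => N' NN'; split.
- exact: continuous_measurable3.
- move=> x; apply: le_trans NN'; have [xM|xM] := pselect (cube M x); last by rewrite fM// normr0.
  apply: hK; last by exists x => //; exact: cube_ccube.
  rewrite /N !lt_max; apply/orP; right; apply/orP; right; by rewrite ltrDl.
- apply: csuppW fM; exact: le_trans NN'.
Qed.

Lemma C1_bounded M f : C1 f -> csupp M f ->
  exists N, bounded_supp N f /\ forall i, bounded_supp N ('d_i f).
Proof.
move=> fC fM; have /C1P fC' := fC.
have [N hN] := csupp_bounded _ _ (C1_continuous _ fC) fM.
have K i : exists N, forall N', N <= N' -> bounded_supp N' ('d_i f).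
  by apply: (csupp_bounded (M + 1)); [have [] := fC' i|exact: derive_csupp].
have [[N0 h0] [[N1 h1] [N2 h2]]] := (K 0, (K 1, K (inord 2))).
exists (Num.max N (Num.max N0 (Num.max N1 N2))); split.
  by apply: hN; rewrite le_max lexx.
apply: ord3P; [apply: h0|apply: h1|apply: h2]; by rewrite !le_max lexx ?orbT.
Qed.

Lemma integral_line f i x (u v : R) : C1 f -> u <= v ->
  (\int[leb R]_(t in `]u, v[) ('d_i f (setc i x t))%:E)%E =
  (f (setc i x v) - f (setc i x u))%:E.
Proof.
move=> fC; have /C1P fC' := fC; have [df cf] := fC' i.
rewrite le_eqVlt => /predU1P[->|uv].
  by rewrite set_itvoo0// integral_set0 subrr.
have cline : continuous (fun t : R => setc i x t : space3 R).
  have -> : (fun t => setc i x t) = (fun t => t *: ax i + setc i x 0).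
    by apply/funext => t; rewrite line_setc addr0.
  by move=> t; apply: cvgD; [apply: cvgZr_tmp; exact: cvg_id|exact: cvg_cst].
have cg : continuous (fun t : R => 'd_i f (setc i x t)).
  by move=> t; exact: (@continuous_comp _ _ _ (setc i x) ('d_i f) t (cline t) (cf _)).
have cF : continuous (fun t : R => f (setc i x t)).
  by move=> t; exact: (@continuous_comp _ _ _ (setc i x) f t (cline t) (C1_continuous _ fC _)).
rewrite -(integral_itv_bndoo true false); last first.
  apply/measurable_EFinP/measurable_funTS.
  exact: continuous_measurable_fun.
rewrite (@continuous_FTC2 _ _ (fun t => f (setc i x t)))//.
- by apply: continuous_subspaceT => t; exact: cg.
- split.
  + by move=> t _; have [] := is_derive_line f i x t (df _).
  + by apply: cvg_at_right_filter; exact: cF.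
  + by apply: cvg_at_left_filter; exact: cF.
- by move=> t _; rewrite derive1E; have [_ ->] := is_derive_line f i x t (df _).
Qed.

End C1Algebra.

(** * Perimeter and calibration *)

Section Perimeter.
Context {R : realType}.
Implicit Types (x y : space3 R) (f g : space3 R -> R) (i j : 'I_3)
  (A B E : set (space3 R)) (X : space3 R -> space3 R).

Definition face_area i (a b : space3 R) : R :=
  match val i with
  | 0%N => (b.1.2 - a.1.2) * (b.2 - a.2)
  | 1%N => (b.1.1 - a.1.1) * (b.2 - a.2)
  | _ => (b.1.1 - a.1.1) * (b.1.2 - a.1.2) end.

(** By Fubini one integrates along axis [i] first; the fundamental theorem of calculus leaves on
    each line the difference of [f] at two opposite faces. *)
Lemma box_flux f i a b (M c : R) : C1 f -> csupp M f ->
  (forall x, `|f (setc i x (crd i b)) - f (setc i x (crd i a))| <= c) ->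
  (forall j, crd j a <= crd j b) ->
  `|int3 (obox a b) ('d_i f)| <= c * face_area i a b.
Proof.
move=> fC fM fc ab; have [N [_ /(_ i) bd]] := C1_bounded _ _ fC fM.
have h1 : a.1.1 <= b.1.1 by exact: (ab 0).
have h2 : a.1.2 <= b.1.2 by exact: (ab 1).
have h3 : a.2 <= b.2 by move: (ab (inord 2)); rewrite /crd/= inordK.
have F x : (`|\int[leb R]_(t in `]crd i a, crd i b[) ('d_i f (setc i x t))%:E| <= c%:E)%E.
  by rewrite integral_line// abse_EFin lee_fin.
case: i bd {fc} F => -[|[|[|//]]] p bd F; rewrite /face_area/= ?mulrA.
- by apply: (box_bound1 _ _ _ bd) => // y z _ _; exact: (F (0, y, z)).
- by apply: (box_bound2 _ _ _ bd) => // x z _ _; exact: (F (x, 0, z)).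
- by rewrite -mulrA; apply: (box_bound3 _ _ _ bd) => // x y _ _; exact: (F (x, y, 0)).
Qed.

Lemma int3_sub A B f : A `<=` B -> (forall x, B x -> ~ A x -> f x = 0) ->
  int3 A f = int3 B f.
Proof.
move=> AB f0; rewrite [LHS]Rintegral_mkcond [RHS]Rintegral_mkcond.
congr (Rintegral _ _ _); apply/funext => x; rewrite !patchE.
have [xA|xA] := pselect (A x); first by rewrite !mem_set//; exact: AB.
rewrite memNset//; have [xB|xB] := pselect (B x); last by rewrite memNset.
by rewrite mem_set// f0.
Qed.

(** The integral over [A] equals the one over the whole space, hence over a large cube, on whose
    faces [f] vanishes. *)
Lemma int3_derive0 f i (M : R) A : C1 f -> csupp M f -> (forall x, ~ A x -> 'd_i f x = 0) ->
  int3 A ('d_i f) = 0.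
Proof.
move=> fC fM f0; rewrite (@int3_sub A setT)//; last by move=> x _; exact: f0.
(* [csupp] allows a negative [M], but the cube used below needs ordered corners. *)
pose N := Num.max M 0.
have fN : csupp N f by apply: csuppW fM; rewrite le_max lexx.
have N0 : 0 <= N by rewrite le_max lexx orbT.
rewrite -(@int3_sub (cube (N + 1)))//; last by move=> x _; exact: derive_csupp.
apply/eqP; rewrite -normr_le0.
apply: (le_trans (box_flux _ _ _ _ N 0 fC fN _ _)); last by rewrite mul0r.
  move=> x; rewrite !fN ?subrr ?normr0//.
    by case: i {f0} => -[|[|[|//]]] p [/= h1 h2 h3]; move: h1 h2 h3; rewrite /crd/setc/=; lra.
  by case: i {f0} => -[|[|[|//]]] p [/= h1 h2 h3]; move: h1 h2 h3; rewrite /crd/setc/=; lra.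
by apply: ord3P; rewrite /crd/= ?inordK//=; lra.
Qed.

Definition fld (G : 'I_3 -> space3 R -> R) x : space3 R := (G 0 x, G 1 x, G (inord 2) x).

Lemma crd_fld G i x : crd i (fld G x) = G i x.
Proof. by move: i; apply: ord3P; rewrite /crd/= ?inordK. Qed.

Lemma enorm_sum x : enorm x = Num.sqrt (\sum_i crd i x ^+ 2).
Proof.
rewrite /enorm !big_ord_recr big_ord0/= add0r; congr (Num.sqrt (_ + _ + _)).
Qed.

Lemma test_fieldP X : test_field X <->
  [/\ forall i, C1 (crd i \o X), exists M, forall i, csupp M (crd i \o X)
    & forall x, \sum_i crd i (X x) ^+ 2 <= 1].
Proof.
have E x : (enorm (X x) <= 1) = (\sum_i crd i (X x) ^+ 2 <= 1).
  by rewrite enorm_sum -[X in _ <= X]sqrtr1 ler_sqrt.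
split=> [[[c1 c2 c3] cpt X1]|[XC [M XM] X1]].
  split; last by move=> x; rewrite -E.
    apply: ord3P; [exact: c1|exact: c2|].
    by rewrite /comp /crd/= inordK.
  have [K [Kr hK]] := compact_bounded cpt.
  pose M := Num.max 1 (K + 1).
  have KM : K < M by rewrite lt_max ltrDl ltr01 orbT.
  exists (M + 1) => i x xM; apply: contrapT => /eqP xi; apply: xM.
  have : `|x| <= M.
    apply: hK => //; apply: subset_closure => /=.
    by apply: contra_neq xi => /= ->; case: i => -[|[|[|//]]].
  move: x {xi} => [[x1 x2] x3]; rewrite prod_normE/= ge_max => /andP[]; rewrite prod_normE/= ge_max.
  move=> /andP[/ler_normlP[? ?] /ler_normlP[? ?]] /ler_normlP[? ?].
  by split => /=; lra.
split; last by move=> x; rewrite E.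
  split; first exact: (XC 0).
    exact: (XC 1).
  by have := XC (inord 2); rewrite /comp /crd/= inordK.
apply: (subclosed_compact _ (@compact_ccube _ M)); first exact: closed_closure.
have cc : closed (ccube M) by apply: compact_closed; [exact: norm_hausdorff|exact: compact_ccube].
rewrite [X in _ `<=` X](closure_id _).1//; apply: closure_subset => x /= xX.
apply: cube_ccube; apply: contrapT => xM; move: xX.
suff -> : X x = 0 by rewrite eqxx.
by apply: space3_eq => i; have /= -> := XM i x xM; case: i => -[|[|[|//]]].
Qed.

Lemma sum3E (F : 'I_3 -> R) : \sum_i F i = F 0 + F 1 + F (inord 2).
Proof.
rewrite !big_ord_recr big_ord0/= add0r.
by congr (F _ + F _ + F _); apply/val_inj => //=; rewrite inordK.
Qed.

Lemma divergenceE X : divergence X = fun x => 'd_0 (crd 0 \o X) x + 'd_1 (crd 1 \o X) x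
    + 'd_(inord 2) (crd (inord 2) \o X) x.
Proof.
apply/funext => x; rewrite /divergence; congr (_ + _).
by rewrite /ax /comp /crd/= inordK.
Qed.

Lemma test_field_bounded X : test_field X ->
  exists N, forall i, bounded_supp N ('d_i (crd i \o X)).
Proof.
move=> /test_fieldP[XC [M XM] _].
have h i : exists N, forall N', N <= N' -> bounded_supp N' ('d_i (crd i \o X)).
  apply: (csupp_bounded (M + 1)); last exact: derive_csupp.
  by have /C1P/(_ i)[] := XC i.
have [[N0 h0] [[N1 h1] [N2 h2]]] := (h 0, (h 1, h (inord 2))).
exists (Num.max N0 (Num.max N1 N2)).
apply: ord3P; [apply: h0|apply: h1|apply: h2]; by rewrite !le_max lexx ?orbT.
Qed.

Lemma divergence_bounded X : test_field X -> exists N, bounded_supp N (divergence X).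
Proof.
move=> /test_field_bounded[N hN]; exists (N + N + N); rewrite divergenceE.
exact: bounded_suppD (bounded_suppD (hN 0) (hN 1)) (hN (inord 2)).
Qed.

Lemma int3_divergence A X : lebesgue_measurable3 A -> test_field X ->
  int3 A (divergence X) = \sum_i int3 A ('d_i (crd i \o X)) /\
  (\int[lebesgue3]_(x in A) (divergence X x)%:E)%E = (int3 A (divergence X))%:E.
Proof.
move=> mA tX; have [N hN] := test_field_bounded _ tX.
split; last by have [K hK] := divergence_bounded _ tX; exact: (integral_int3 mA hK).
rewrite sum3E divergenceE (int3D mA (bounded_suppD (hN 0) (hN 1)) (hN (inord 2))).
by rewrite (int3D mA (hN 0) (hN 1)).
Qed.

Lemma perimeter_ge A X : lebesgue_measurable3 A -> test_field X ->
  ((int3 A (divergence X))%:E <= perimeter A)%E.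
Proof.
move=> mA tX; have [_ <-] := int3_divergence _ _ mA tX.
by apply: ereal_sup_ubound; exists X.
Qed.

Lemma perimeter_le A (c : R) : lebesgue_measurable3 A ->
  (forall X, test_field X -> int3 A (divergence X) <= c) -> (perimeter A <= c%:E)%E.
Proof.
move=> mA h; apply: ge_ereal_sup => _ [X tX <-].
by have [_ ->] := int3_divergence _ _ mA tX; rewrite lee_fin h.
Qed.

Lemma perimeter_approx A (p e : R) : lebesgue_measurable3 A -> perimeter A = p%:E ->
  0 < e -> exists2 X, test_field X & p - e < int3 A (divergence X).
Proof.
move=> mA Ap e0.
have : (perimeter A - e%:E < perimeter A)%E by rewrite Ap -EFinB lte_fin; lra.
move=> /ereal_sup_gt[_ [X tX <-]].
have [_ ->] := int3_divergence _ _ mA tX; rewrite Ap -EFinB lte_fin => ?.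
by exists X.
Qed.

Lemma test_field0 : test_field (fun _ : space3 R => 0).
Proof.
apply/test_fieldP; split.
- move=> i; rewrite (_ : _ \o _ = fun=> 0); first exact: C1_cst.
  by apply/funext => x; case: i => -[|[|[|//]]].
- by exists 1 => i x _; case: i => -[|[|[|//]]].
- by move=> x; rewrite big1 ?ler01// => -[[|[|[|//]]] p] _; rewrite /crd/= expr0n.
Qed.

Lemma perimeter_ge0 A : lebesgue_measurable3 A -> (0 <= perimeter A)%E.
Proof.
move=> mA; apply: le_trans (perimeter_ge _ _ mA test_field0).
rewrite lee_fin; have [-> _] := int3_divergence _ _ mA test_field0.
rewrite big1// => i _; rewrite (_ : 'd_i _ = fun=> 0).
  by rewrite /Rintegral integral0.
apply/funext => x; rewrite (_ : _ \o _ = cst 0) ?derive_cst//.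
by apply/funext => y; case: i => -[|[|[|//]]].
Qed.

(** Damping by [q ^+ 2 * Y] makes the norm exceed 1 only at second order in [u]. With k = sqrt(1 -
    q^2), Cauchy-Schwarz for the vectors (k, q) and (k Y, u) gives the bound; the identity [D]
    displays the deficit as a sum of nonnegative terms. *)
Lemma perturbed_norm (Y S q u : R) : Y ^+ 2 + S <= 1 -> `|q| <= 1 ->
  (Y + (u * q + (-1) * (q ^+ 2 * Y))) ^+ 2 + S <= 1 + u ^+ 2.
Proof.
move=> YS; rewrite ler_norml => /andP[q1 q2].
have H : 0 <= (1 - q ^+ 2) * (q * Y - u) ^+ 2.
  rewrite mulr_ge0 ?sqr_ge0//; have -> : 1 - q ^+ 2 = (1 - q) * (1 + q) by ring.
  by rewrite mulr_ge0; lra.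
have q0 : 0 <= q ^+ 2 * Y ^+ 2 by rewrite mulr_ge0// sqr_ge0.
have D : Y ^+ 2 + u ^+ 2 - (Y + (u * q + (-1) * (q ^+ 2 * Y))) ^+ 2
    = q ^+ 2 * Y ^+ 2 + (1 - q ^+ 2) * (q * Y - u) ^+ 2 by ring.
lra.
Qed.

Lemma sum_perturbed (G G' : 'I_3 -> R) i (s c : R) :
  (forall j, G' j = s * (G j + (if j == i then c else 0))) ->
  \sum_j G' j = s * (\sum_j G j + c).
Proof.
move=> GE; under eq_bigr do rewrite GE; rewrite -mulr_sumr big_split/=.
by congr (_ * (_ + _)); rewrite -big_mkcond/= big_pred1_eq.
Qed.

Lemma int3_deriveZ A f i (s K : R) : lebesgue_measurable3 A -> C1 f -> csupp K f ->
  int3 A ('d_i (fun x => s * f x)) = s * int3 A ('d_i f).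
Proof.
move=> mA fC fK; have [N [_ /(_ i) b]] := C1_bounded _ _ fC fK.
rewrite -(int3Z s mA b); congr (Rintegral _ _ _).
by apply/funext => x; exact: derive3Z.
Qed.

Lemma int3_deriveD A f g i (K : R) : lebesgue_measurable3 A -> C1 f -> csupp K f ->
  C1 g -> csupp K g ->
  int3 A ('d_i (fun x => f x + g x)) = int3 A ('d_i f) + int3 A ('d_i g).
Proof.
move=> mA fC fK gC gK; have [N [_ /(_ i) b]] := C1_bounded _ _ fC fK.
have [N' [_ /(_ i) b']] := C1_bounded _ _ gC gK.
rewrite -(int3D mA b b'); congr (Rintegral _ _ _).
by apply/funext => x; exact: derive3D.
Qed.

Lemma csuppD K f g : csupp K f -> csupp K g -> csupp K (fun x => f x + g x).
Proof. by move=> fK gK x xK; rewrite fK// gK// addr0. Qed.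

Lemma csuppZ K (c : R) f : csupp K f -> csupp K (fun x => c * f x).
Proof. by move=> fK x xK; rewrite fK// mulr0. Qed.

Lemma int3_derive_perturbed A f p g i (s u K : R) : lebesgue_measurable3 A ->
  C1 f -> C1 p -> C1 g -> csupp K f -> csupp K p -> csupp K g ->
  int3 A ('d_i (fun x => s * (f x + (u * p x + (-1) * g x)))) =
  s * (int3 A ('d_i f) + (u * int3 A ('d_i p) - int3 A ('d_i g))).
Proof.
move=> mA fC pC gC fK pK gK.
have upC := C1Z u _ pC; have gC' := C1Z (-1) _ gC.
have upK := csuppZ _ u _ pK; have gK' := csuppZ _ (-1) _ gK.
rewrite (int3_deriveZ _ _ _ _ K mA (C1D _ _ fC (C1D _ _ upC gC')) (csuppD _ _ _ fK (csuppD _ _ _ upK gK'))).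
rewrite (int3_deriveD _ _ _ _ K mA fC fK (C1D _ _ upC gC') (csuppD _ _ _ upK gK')).
rewrite (int3_deriveD _ _ _ _ K mA upC upK gC' gK').
by rewrite (int3_deriveZ _ _ _ _ K mA pC pK) (int3_deriveZ _ _ _ _ K mA gC gK) mulN1r.
Qed.

(** The bookkeeping of the calibration: [a] and [b] are the fluxes of a field within [e] of optimal,
    [ga] and [gb] what damping takes from them, and [k] the integral of the derivative of the
    perturbation over [A]. The first two hypotheses test [A] with amplitude [t] and [B] with
    amplitude 0. *)
Lemma perturbed_gain (a b k k' ga gb pA pB tau e t : R) :
  a + (t * k - ga) <= (1 + t ^+ 2) * pA -> 1 * (b + (0 * k' - gb)) <= pB ->
  ga + gb <= tau -> pA + pB - e < a + b -> t * k <= tau + t ^+ 2 * pA + e.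
Proof. lra. Qed.

(* E = A + B calibrates A and B by the same fields.  If a field X is almost
   optimal for E then X' := X - psi^2 X_i e_i is still almost optimal up to tau,
   hence almost optimal for A, and (X' + t psi e_i) / (1 + t^2) competes in
   Per(A); the quadratic gain in t forces the first-order term to vanish. *)
Lemma perimeter_calibration A B (psi : space3 R -> R) i (M tau t pA pB : R) :
  lebesgue_measurable3 A -> lebesgue_measurable3 B -> A `&` B = set0 ->
  perimeter A = pA%:E -> perimeter B = pB%:E ->
  perimeter (A `|` B) = (pA + pB)%:E ->
  C1 psi -> csupp M psi -> (forall x, `|psi x| <= 1) ->
  (forall X, test_field X ->
     int3 (A `|` B) ('d_i (fun x => psi x ^+ 2 * crd i (X x))) <= tau) ->
  t * int3 A ('d_i psi) <= tau + t ^+ 2 * pA.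
Proof.
move=> mA mB AB PA PB PE pC pM p1 ptau.
apply/ler_addgt0Pr => e e0.
have [X tX Xe] := perimeter_approx _ _ _ (lebesgue_measurable3U mA mB) PE e0.
have [XC [N XN] X1] := (test_fieldP X).1 tX.
pose g x := psi x ^+ 2 * crd i (X x).
have p2C : C1 (fun x => psi x ^+ 2).
  by rewrite (_ : (fun x => _) = fun x => psi x * psi x)//; exact: C1M.
have gC : C1 g by apply: C1M p2C (XC i).
pose K := Num.max M N.
have pK : csupp K psi by apply: csuppW pM; rewrite le_max lexx.
have gK : csupp K g by move=> x xK; rewrite /g pK// expr0n mul0r.
have pgC (u : R) : C1 (fun x => u * psi x + (-1) * g x).
  by apply: C1D; apply: C1Z.
pose h u j x := crd j (X x) + (if j == i then u * psi x + (-1) * g x else 0).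
have hC u j : C1 (h u j).
  rewrite /h; case: (j == i); first exact: C1D (XC j) (pgC u).
  exact: C1D (XC j) (C1_cst 0).
have hK u j : csupp K (h u j).
  move=> x xK; rewrite /h pK// gK// !mulr0 addr0 if_same addr0.
  by apply: (XN j); apply: contra_not xK; apply: sub_cube; rewrite le_max lexx orbT.
have shC s u j : C1 (fun x => s * h u j x) by exact: C1Z.
pose F s u := fld (fun j x => s * h u j x).
have FE s u j : crd j \o F s u = fun x => s * h u j x by apply/funext => x; rewrite /= crd_fld.
have tF s u : s ^+ 2 * (1 + u ^+ 2) <= 1 -> test_field (F s u).
  move=> su; apply/test_fieldP; split.
  - by move=> j; rewrite FE; exact: shC.
  - by exists K => j; rewrite FE => x xK; rewrite hK// mulr0.
  - move=> x; apply: le_trans su.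
    under eq_bigr do rewrite crd_fld exprMn.
    rewrite -mulr_sumr ler_wpM2l ?sqr_ge0//.
    have Xx := X1 x; rewrite (bigD1 i)//= in Xx; rewrite (bigD1 i)//=.
    rewrite [X in _ + X](eq_bigr (fun j => crd j (X x) ^+ 2)); last first.
      by move=> j ji; rewrite /h (negbTE ji) addr0.
    rewrite /h eqxx /g; have := p1 x; rewrite ler_norml => /andP[q1 q2].
    set Y := crd i (X x) in Xx *; set S := \sum_(_ < _ | _) _ in Xx *; set q := psi x in q1 q2 *.
    by apply: perturbed_norm => //; rewrite ler_norml q1.
have int3F C s u : lebesgue_measurable3 C -> s ^+ 2 * (1 + u ^+ 2) <= 1 ->
    int3 C (divergence (F s u)) = s * (int3 C (divergence X) + (u * int3 C ('d_i psi) - int3 C ('d_i g))).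
  move=> mC su; have [-> _] := int3_divergence _ _ mC (tF _ _ su).
  have [-> _] := int3_divergence _ _ mC tX.
  apply: (@sum_perturbed _ _ i) => j; rewrite FE /h.
  have NK : N <= K by rewrite le_max lexx orbT.
  case: eqP => [->|_].
    exact: (int3_derive_perturbed _ _ _ _ _ _ _ K mC (XC i) pC gC (csuppW _ _ _ NK (XN i)) pK gK).
  have -> : (fun x => s * (crd j (X x) + 0)) = (fun x => s * (crd j \o X) x).
    by apply/funext => x; rewrite addr0.
  rewrite addr0.
  exact: (int3_deriveZ _ _ _ _ K mC (XC j) (csuppW _ _ _ NK (XN j))).
have s10 : 1 ^+ 2 * (1 + 0 ^+ 2) <= 1 :> R by rewrite expr1n expr0n/= addr0 mulr1.
(* The factor 1 / sqrt(1 + t^2) would already restore the unit bound; its square costs only second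
   order in [t] and avoids a root. *)
pose s := (1 + t ^+ 2)^-1.
have t2 : 0 <= t ^+ 2 by exact: sqr_ge0.
have d0 : 0 < 1 + t ^+ 2 by rewrite ltr_pwDl.
have st : s ^+ 2 * (1 + t ^+ 2) <= 1.
  by rewrite expr2 -mulrA /s mulVf ?gt_eqF// mulr1 invf_le1// lerDl.
(* On [A] the field is damped and perturbed, on [B] it is only damped: the two parts are tested by
   different fields, though their union was tested by one. *)
have HA := perimeter_ge _ _ mA (tF _ _ st).
have HB := perimeter_ge _ _ mB (tF _ _ s10).
rewrite PA lee_fin int3F// in HA; rewrite PB lee_fin int3F// in HB.
have := ptau X tX; rewrite -/g.
have [Ng [_ /(_ i) bg]] := C1_bounded _ _ gC gK.
rewrite (int3U mA mB AB bg) => Hg.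
have XE : int3 (A `|` B) (divergence X) = int3 A (divergence X) + int3 B (divergence X).
  have [n bn] := divergence_bounded _ tX.
  exact: (int3U mA mB AB bn).
rewrite XE in Xe.
have {}HA : int3 A (divergence X) + (t * int3 A ('d_i psi) - int3 A ('d_i g)) <= (1 + t ^+ 2) * pA.
  by rewrite -ler_pdivrMl.
exact: perturbed_gain HA HB Hg Xe.
Qed.

End Perimeter.

(** * Piecewise polynomial test functions of one variable *)

Section TestFunctions.
Context {R : realType}.
Implicit Types (t c u v : R).

Definition pos t : R := Num.max t 0.

Lemma pos_ge0 t : 0 <= pos t. Proof. by rewrite le_max lexx orbT. Qed.

(** A quadratic remainder gives differentiability uniformly, also at the kink of a squared positive
    part. *)
Lemma is_derive_quad (f : R -> R) t d (C : R) :
  (forall h, `|f (h + t) - f t - h * d| <= C * h ^+ 2) -> is_derive t 1 f d.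
Proof.
move=> fC.
have H : (h^-1 *: ((f \o shift t) (h *: (1 : R)) - f t)) @[h --> 0^'] --> d.
  have C0 : 0 <= C by have := fC 1; rewrite expr1n mulr1; exact: le_trans.
  apply/cvgrPdist_le => e e0; near=> h.
  have h0 : h != 0 by near: h; exact: nbhs_dnbhs_neq.
  rewrite /= [h *: 1]mulr1 [_ *: _]mulrC -[d in d - _](mulfK h0) -mulrBl normrM normfV.
  rewrite ler_pdivrMr ?normr_gt0// distrC [d * h]mulrC.
  apply: (le_trans (fC h)); rewrite -[h ^+ 2]ger0_norm ?sqr_ge0// normrX expr2 mulrA.
  rewrite ler_wpM2r//.
  have : `|h| <= e / (C + 1).
    near: h; apply: dnbhs0_le; rewrite divr_gt0//; lra.
  rewrite ler_pdivlMr; last lra.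
  by move=> H; apply: le_trans H; rewrite mulrC ler_wpM2l//; lra.
split; first by apply/cvg_ex; exists d.
exact: cvg_lim H.
Unshelve. all: by end_near. Qed.

Lemma continuous_pos : continuous pos.
Proof. by move=> t; apply: continuous_max; [exact: cvg_id|exact: cvg_cst]. Qed.

Lemma pos_quad t h : `|pos (h + t) ^+ 2 - pos t ^+ 2 - h * (2 * pos t)| <= 1 * h ^+ 2.
Proof.
rewrite /pos /Order.max mul1r; case: ltP => ht; case: ltP => tt; rewrite ler_norml;
  apply/andP; split; nra.
Qed.

Lemma C1R_pos c : C1R (fun t => pos (t - c) ^+ 2) (fun t => 2 * pos (t - c)).
Proof.
split=> [t|].
  by apply: (is_derive_quad _ _ _ 1) => h; have := pos_quad (t - c) h; rewrite (addrA h t).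
move=> t; apply: cvgM; first exact: cvg_cst.
apply: (@continuous_comp _ _ _ (fun t => t - c) pos); last exact: continuous_pos.
by apply: cvgD; [exact: cvg_id|exact: cvg_cst].
Qed.

Lemma C1R_posN c : C1R (fun t => pos (c - t) ^+ 2) (fun t => - (2 * pos (c - t))).
Proof.
split=> [t|].
  apply: (is_derive_quad _ _ _ 1) => h.
  have -> : c - (h + t) = - h + (c - t) by ring.
  by rewrite mulrN -mulNr -(sqrrN h); exact: pos_quad.
move=> t; apply: cvgN; apply: cvgM; first exact: cvg_cst.
apply: (@continuous_comp _ _ _ (fun t => c - t) pos); last exact: continuous_pos.
by apply: cvgB; [exact: cvg_cst|exact: cvg_id].
Qed.

Lemma C1RD (f f' g g' : R -> R) : C1R f f' -> C1R g g' ->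
  C1R (fun t => f t + g t) (fun t => f' t + g' t).
Proof.
move=> [df cf] [dg cg]; split=> [t|t]; last by apply: cvgD; [exact: cf|exact: cg].
exact: is_deriveD.
Qed.

Lemma C1RZ (k : R) (f f' : R -> R) : C1R f f' -> C1R (fun t => k * f t) (fun t => k * f' t).
Proof.
move=> [df cf]; split=> [t|t]; last by apply: cvgM; [exact: cvg_cst|exact: cf].
exact: is_deriveZ.
Qed.

(* [trap u v n] is a trapezoid function with plateau 1 and two ramps of width
   (v - u) / (n + 2) inside ]u, v[; [ramp u v n] is its primitive. *)
Definition slope u v (n : nat) : R := (v - u) / n.+2%:R.

(** Applied to [pos] this is a trapezoid of height [slope u v n]; applied to the square of [pos] it
    is twice a primitive of that trapezoid. *)
Definition second_diff (f : R -> R) u v n t :=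
  f (t - u) + (-1) * f (t - (u + slope u v n)) + ((-1) * f (t - (v - slope u v n)) + f (t - v)).

Definition trap u v n t : R := (slope u v n)^-1 * second_diff pos u v n t.
Definition ramp u v n t : R := (2 * slope u v n)^-1 * second_diff (fun s => pos s ^+ 2) u v n t.

Lemma C1R_ramp u v n : C1R (ramp u v n) (trap u v n).
Proof.
have -> : trap u v n = fun t => (2 * slope u v n)^-1 * second_diff (fun s => 2 * pos s) u v n t.
  apply/funext => t; rewrite /trap /second_diff.
  rewrite [X in _ = X](_ : _ = (2 * slope u v n)^-1 * (2 * (pos (t - u) + (-1) * pos (t - (u + slope u v n)) + ((-1) * pos (t - (v - slope u v n)) + pos (t - v))))); last by ring.
  rewrite [RHS]mulrA; congr (_ * _).
  by move: (slope u v n) => s; rewrite invfM mulrAC mulVf ?mul1r// pnatr_eq0.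
apply: C1RZ; apply: C1RD; apply: C1RD.
- exact: C1R_pos.
- apply: C1RZ; exact: C1R_pos.
- apply: C1RZ; exact: C1R_pos.
- exact: C1R_pos.
Qed.

Lemma slope_gt0 u v n : u < v -> 0 < slope u v n.
Proof. by move=> uv; rewrite divr_gt0// subr_gt0. Qed.

Lemma slope_le u v n : u < v -> 2 * slope u v n <= v - u.
Proof.
move=> uv; rewrite /slope mulrCA ler_piMr//; first by rewrite subr_ge0 ltW.
by rewrite ler_pdivrMr// mul1r ler_nat.
Qed.

Lemma ramp_left u v n t : u < v -> t <= u -> ramp u v n t = 0.
Proof.
move=> uv tu; have s0 := slope_gt0 _ _ n uv; have s1 := slope_le _ _ n uv.
by rewrite /ramp /second_diff /pos !max_r; lra.
Qed.

(** The final value is the area of the trapezoid. Two ramps weighted by each other's area cancel to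
    the right of both, which makes their difference compactly supported. *)
Lemma ramp_right u v n t : u < v -> v <= t -> ramp u v n t = v - u - slope u v n.
Proof.
move=> uv tv; have s0 := slope_gt0 _ _ n uv; have s1 := slope_le _ _ n uv.
rewrite /ramp /second_diff /pos !max_l; try lra.
by field; rewrite gt_eqF.
Qed.

Lemma trap_bounds u v n t : u < v -> 0 <= trap u v n t <= 1.
Proof.
move=> uv; have s0 := slope_gt0 _ _ n uv; have s1 := slope_le _ _ n uv.
have : 0 <= second_diff pos u v n t <= slope u v n.
  rewrite /second_diff /pos /Order.max.
  by do 4 (case: ltP => ?); lra.
move=> /andP[h1 h2]; rewrite /trap; apply/andP; split.
  by rewrite mulr_ge0// invr_ge0 ltW.
by rewrite mulrC ler_pdivrMr// mul1r.
Qed.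

Lemma trap_off u v n t : u < v -> ~ (u < t < v) -> trap u v n t = 0.
Proof.
move=> uv tuv; have s0 := slope_gt0 _ _ n uv; have s1 := slope_le _ _ n uv.
rewrite /trap; suff -> : second_diff pos u v n t = 0 by rewrite mulr0.
have [tu|ut] := leP t u.
  by rewrite /second_diff /pos !max_r; lra.
have vt : v <= t by rewrite leNgt; apply/negP => ?; apply: tuv; rewrite ut.
by rewrite /second_diff /pos !max_l; lra.
Qed.

Lemma trap_eq1 u v n t : u < v -> u + slope u v n <= t <= v - slope u v n -> trap u v n t = 1.
Proof.
move=> uv /andP[t1 t2]; have s0 := slope_gt0 _ _ n uv; have s1 := slope_le _ _ n uv.
rewrite /trap; suff -> : second_diff pos u v n t = slope u v n by rewrite mulVf// gt_eqF.
rewrite /second_diff /pos (max_l (_ : 0 <= t - u)); last lra.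
rewrite (max_l (_ : 0 <= t - (u + _))); last lra.
rewrite (max_r (_ : t - (v - _) <= 0)); last lra.
rewrite (max_r (_ : t - v <= 0)); last lra.
lra.
Qed.

Lemma cvg_slope u v : slope u v n @[n --> \oo] --> (0 : R).
Proof.
rewrite -(mulr0 (v - u)); apply: cvgM; first exact: cvg_cst.
by have := @cvg_harmonic R; rewrite -(cvg_shiftn 1)/=; under eq_fun do rewrite addn1.
Qed.

Lemma cvg_trap u v t : u < v -> trap u v n t @[n --> \oo] --> (\1_`]u, v[%classic t : R).
Proof.
move=> uv; have [tuv|tuv] := pselect (u < t < v); last first.
  rewrite indicE memNset/=; last by rewrite in_itv.
  under eq_fun do rewrite trap_off//.
  exact: cvg_cst.
rewrite indicE mem_set/=; last by rewrite in_itv.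
have m0 : 0 < Num.min (t - u) (v - t) by rewrite lt_min; lra.
apply: cvg_near_cst; near=> n; apply: trap_eq1 => //.
suff : slope u v n <= Num.min (t - u) (v - t).
  by rewrite le_min => /andP[? ?]; lra.
near: n; have /cvgrPdist_le/(_ _ m0) := cvg_slope u v; apply: filterS => n.
by rewrite sub0r normrN => /(le_trans (ler_norm _)).
Unshelve. all: by end_near. Qed.

(* For c >= 0 this tends to the indicator of c > 0. *)
Definition sat (n : nat) c : R := n.+1%:R * c / (1 + n.+1%:R * c).

Lemma sat_den n c : 0 <= c -> 0 < 1 + n.+1%:R * c.
Proof. by move=> c0; rewrite ltr_pwDl// mulr_ge0. Qed.

Lemma sat_bounds n c : 0 <= c -> 0 <= sat n c <= 1.
Proof.
move=> c0; have d := sat_den n _ c0; rewrite /sat; apply/andP; split.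
  by rewrite divr_ge0 ?mulr_ge0// ltW.
by rewrite ler_pdivrMr// mul1r lerDr.
Qed.

Lemma sat0 n : sat n 0 = 0. Proof. by rewrite /sat mulr0 mul0r. Qed.

Lemma cvg_sat c : 0 <= c -> sat n c @[n --> \oo] --> ((0 < c)%R%:R : R).
Proof.
rewrite le_eqVlt => /predU1P[<-|c0].
  by rewrite ltxx; under eq_fun do rewrite sat0; exact: cvg_cst.
rewrite c0; have -> : (fun n => sat n c) = fun n => 1 - (1 + n.+1%:R * c)^-1.
  apply/funext => n; have := sat_den n _ (ltW c0); rewrite /sat.
  set y := n.+1%:R * c => y0.
  by rewrite -{1}(addrK 1 y) [y + 1]addrC mulrBl divff ?mul1r// gt_eqF.
rewrite -[X in _ --> X]subr0; apply: cvgB; first exact: cvg_cst.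
apply: (@squeeze_cvgr _ _ _ _ (cst 0) (fun n => c^-1 * harmonic n)).
- near=> n; have d := sat_den n _ (ltW c0); apply/andP; split.
    by rewrite invr_ge0 ltW.
  by rewrite /harmonic/= -invfM lef_pV2 ?posrE ?mulr_gt0// [c * _]mulrC lerDr.
- exact: cvg_cst.
- rewrite -[X in _ --> X](mulr0 c^-1); apply: cvgM; [exact: cvg_cst|exact: cvg_harmonic].
Unshelve. all: by end_near. Qed.

Lemma C1_sat n (f : space3 R -> R) : C1 f -> (forall x, 0 <= f x) -> C1 (fun x => sat n (f x)).
Proof.
move=> fC f0; apply: C1M; first exact: C1Z.
apply: C1V; first by move=> x; rewrite gt_eqF// sat_den.
by apply: C1D; [exact: C1_cst|exact: C1Z].
Qed.

End TestFunctions.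

(** * First-order conditions for a splitting without loss of perimeter *)

Section ZeroGradient.
Context {R : realType}.
Implicit Types (x y a b c d : space3 R) (f g : space3 R -> R) (i j : 'I_3)
  (A B E : set (space3 R)).

(** The perimeters are asked to be real, so that the calibration is an inequality in [R]. *)
Definition perimeter_splits A B : Prop :=
  [/\ lebesgue_measurable3 A, lebesgue_measurable3 B, A `&` B = set0 &
   exists pA pB : R, [/\ perimeter A = pA%:E, perimeter B = pB%:E
     & perimeter (A `|` B) = (pA + pB)%:E]].

Lemma perimeter_splitsC A B : perimeter_splits A B -> perimeter_splits B A.
Proof.
move=> [mA mB AB [pA [pB [hA hB hE]]]]; split => //; first by rewrite setIC.
by exists pB, pA; split => //; rewrite setUC addrC.
Qed.

Lemma calibration_scaled A B psi i (M N t tau p : R) : perimeter_splits A B ->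
  perimeter A = p%:E ->
  C1 psi -> csupp M psi -> 1 <= N -> (forall x, `|psi x| <= N) ->
  (forall X, test_field X ->
     int3 (A `|` B) ('d_i (fun x => (N^-1 * psi x) ^+ 2 * crd i (X x))) <= tau) ->
  t * int3 A ('d_i psi) <= N * (tau + t ^+ 2 * p).
Proof.
move=> [mA mB AB [pA [pB [hA hB hE]]]]; rewrite hA => -[<-] pC pM N1 pN ht.
have N0 : 0 < N by exact: lt_le_trans N1.
have := perimeter_calibration A B (fun x => N^-1 * psi x) i M tau t pA pB mA mB AB hA hB hE
   (C1Z _ _ pC) (csuppZ _ _ _ pM) _ ht.
rewrite (int3_deriveZ _ _ _ _ M mA pC pM) mulrCA ler_pdivrMl//; apply.
by move=> x; rewrite normrM gtr0_norm ?invr_gt0// ler_pdivrMl// mulr1.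
Qed.

(** A linear function dominated by a quadratic one has slope 0. The witness uses [|p| + 1], which is
    positive and larger than [p]. *)
Lemma quad_eq0 (k p : R) : (forall t, t * k <= t ^+ 2 * p) -> k = 0.
Proof.
move=> h; apply/eqP; apply: contrapT => /negP k0.
have P0 : 0 < `|p| + 1 by rewrite ltr_pwDr.
pose u := k / (`|p| + 1).
have ku : k = u * (`|p| + 1) by rewrite mulfVK// gt_eqF.
have u2 : 0 < u ^+ 2.
  by rewrite exprn_even_gt0//; apply: contra_neq k0 => u0; rewrite ku u0 mul0r.
have := h u; rewrite ku mulrA -expr2 ler_pM2l// => /le_trans/(_ (ler_norm _)).
by rewrite leNgt ltrDl ltr01.
Qed.

(** Where [psi] vanishes, so does the derivative of its square times any component. The damped flux
    is therefore supported in the union and integrates to 0, so the calibration holds with [tau]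
    equal to 0 for every [t]. *)
Lemma splits_int0 A B psi i (M : R) : perimeter_splits A B -> C1 psi -> csupp M psi ->
  (forall x, ~ (A `|` B) x -> psi x = 0) -> int3 A ('d_i psi) = 0.
Proof.
move=> sp pC pM p0; have [_ _ _ [pA [_ [hA _ _]]]] := sp.
have [N0 [[_ b0 _] _]] := C1_bounded _ _ pC pM.
pose N := Num.max N0 1.
have N1 : 1 <= N by rewrite le_max lexx orbT.
have Npos : 0 < N by exact: lt_le_trans N1.
apply: (@quad_eq0 _ (N * pA)) => t.
have -> : t ^+ 2 * (N * pA) = N * (0 + t ^+ 2 * pA) by rewrite add0r mulrCA.
apply: (calibration_scaled _ _ _ _ _ _ _ _ _ sp hA pC pM N1) => [x|X tX].
  by apply: le_trans (b0 x) _; rewrite le_max lexx.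
have [XC _ _] := (test_fieldP X).1 tX.
have qC : C1 (fun x => (N^-1 * psi x) ^+ 2) by exact: C1M (C1Z _ _ pC) (C1Z _ _ pC).
rewrite (int3_derive0 _ _ M)//.
- exact: C1M qC (XC i).
- by move=> x xM; rewrite pM// mulr0 expr0n mul0r.
- move=> x xE; apply: etrans (derive3M _ _ i x qC (XC i)) _.
  have -> : 'd_i (fun x => (N^-1 * psi x) ^+ 2) x = 0.
    apply: etrans (derive3M _ _ i x (C1Z _ _ pC) (C1Z _ _ pC)) _.
    by rewrite p0// mulr0 !mul0r addr0.
  by rewrite p0// mulr0 expr0n mul0r mulr0 addr0.
Qed.

Lemma derive_indep f i x : (forall t, f (setc i x t) = f x) -> 'd_i f x = 0.
Proof.
move=> fi.
have E : (fun h => h^-1 *: ((f \o shift x) (h *: ax i) - f x))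
    = (fun h => h^-1 *: ((cst (0 : R) \o shift x) (h *: ax i) - cst (0 : R) x)).
  by apply/funext => h; rewrite /= -[in h *: _ + x](setc_crd i x) line_setc fi !subrr.
by rewrite /derive E; exact: (derive_cst (0 : R) (ax i) x).
Qed.

Lemma C1_prod (s : seq 'I_3) (P : pred 'I_3) (F : 'I_3 -> space3 R -> R) :
  (forall j, C1 (F j)) -> C1 (fun x => \prod_(j <- s | P j) F j x).
Proof.
move=> FC; elim: s => [|j s ih].
  by under eq_fun do rewrite big_nil; exact: C1_cst.
under eq_fun do rewrite big_cons; case: (P j) => //.
exact: C1M.
Qed.

(** A C1 function of the coordinates other than [i], positive exactly over an open rectangle;
    composed with [sat] it approximates the indicator of that rectangle without disturbing
    derivatives along [i]. *)
Definition cut i c d x : R :=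
  \prod_(j | j != i) (pos (crd j x - crd j c) ^+ 2 * pos (crd j d - crd j x) ^+ 2).

Lemma C1_cut i c d : C1 (cut i c d).
Proof.
apply: C1_prod => j; apply: C1M.
- exact: (C1_crd (fun t => pos (t - crd j c) ^+ 2) _ j (C1R_pos (crd j c))).
- exact: (C1_crd (fun t => pos (crd j d - t) ^+ 2) _ j (C1R_posN (crd j d))).
Qed.

Lemma cut_ge0 i c d x : 0 <= cut i c d x.
Proof. by apply: prodr_ge0 => j _; rewrite mulr_ge0 ?sqr_ge0. Qed.

Lemma pos_gt0 (t : R) : (0 < pos t) = (0 < t).
Proof. by rewrite /pos lt_max ltxx orbF. Qed.

Lemma cut_gt0 i c d x :
  0 < cut i c d x <-> forall j, j != i -> crd j c < crd j x < crd j d.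
Proof.
have F j : (0 < pos (crd j x - crd j c) ^+ 2 * pos (crd j d - crd j x) ^+ 2) =
    (crd j c < crd j x < crd j d).
  rewrite -[crd j c < _]subr_gt0 -[crd j x < _]subr_gt0.
  rewrite -[0 < crd j x - _]pos_gt0 -[0 < crd j d - _]pos_gt0.
  have := pos_ge0 (crd j x - crd j c); have := pos_ge0 (crd j d - crd j x).
  move: (pos _) (pos _) => p q; rewrite !le_eqVlt => /predU1P[<-|p0] /predU1P[<-|q0].
  - by rewrite ltxx expr0n mul0r ltxx.
  - by rewrite ltxx expr0n mulr0 ltxx andbF.
  - by rewrite ltxx expr0n mul0r ltxx.
  - by rewrite p0 q0 mulr_gt0// exprn_gt0.
split=> [h j ji|h]; last by apply: prodr_gt0 => j ji; rewrite F h.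
rewrite -F lt0r mulr_ge0 ?sqr_ge0// andbT; apply: contraTneq h => j0.
by rewrite /cut (bigD1 j)//= j0 mul0r ltxx.
Qed.

Lemma cut_indep i c d x t : cut i c d (setc i x t) = cut i c d x.
Proof. by apply: eq_bigr => j ji; rewrite !crd_setc eq_sym (negbTE ji). Qed.

End ZeroGradient.

(** * Indecomposability of boxes *)

Section ZeroOne.
Context {R : realType}.
Implicit Types (x y a b c d : space3 R) (f g : space3 R -> R) (i j : 'I_3)
  (A B E : set (space3 R)).

Definition slab_test i c d (u v : R) (n : nat) x : R :=
  trap u v n (crd i x) * sat n (cut i c d x).

Lemma oboxP c d x : obox c d x <-> forall j, crd j c < crd j x < crd j d.
Proof.
split=> [[h1 h2 h3]|h]; first by apply: ord3P => //; rewrite /crd/= inordK.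
by split; [exact: (h 0)|exact: (h 1)|have := h (inord 2); rewrite /crd/= inordK].
Qed.

Lemma slab_boxP i c d (u v : R) x : obox (setc i c u) (setc i d v) x <->
  u < crd i x < v /\ 0 < cut i c d x.
Proof.
rewrite oboxP cut_gt0; split=> [h|[hi h] j].
  split=> [|j ji]; first by have := h i; rewrite !crd_setc eqxx.
  by have := h j; rewrite !crd_setc eq_sym (negbTE ji).
by rewrite !crd_setc; case: eqP => [<-//|/eqP ij]; apply: h; rewrite eq_sym.
Qed.

Lemma slab_test_bounded i c d (u v : R) : u < v ->
  exists M, [/\ 0 <= M, forall n, bounded_supp M (slab_test i c d u v n)
    & bounded_supp M \1_(obox (setc i c u) (setc i d v))].
Proof.
move=> uv; pose p := setc i c u; pose q := setc i d v.
(* The 1 bounds the values, the sum bounds the corners of the box. *)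
pose M := 1 + \sum_j (`|crd j p| + `|crd j q|).
have S0 j : 0 <= `|crd j p| + `|crd j q| by rewrite addr_ge0.
have M1 : 1 <= M by rewrite lerDl sumr_ge0.
have MB j : `|crd j p| + `|crd j q| <= M.
  by rewrite /M (bigD1 j)//= [leRHS]addrCA lerDl addr_ge0// sumr_ge0.
have pM : obox p q `<=` cube M.
  move=> x /oboxP h; apply/oboxP => j; have := h j; have := MB j; have := normr_ge0 (crd j p).
  have := normr_ge0 (crd j q); have := ler_norm (- crd j p); have := ler_norm (crd j q).
  have -> : crd j (- M, - M, - M) = - M by case: j => -[|[|[|//]]].
  have -> : crd j (M, M, M) = M by case: j => -[|[|[|//]]].
  rewrite normrN; move: (crd j p) (crd j q) (crd j x) `|_| `|_| => *; lra.
exists M; split; first lra.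
  move=> n; split.
  - apply: continuous_measurable3 => x; apply: cvgM; last first.
      exact: (C1_continuous _ (C1_sat n _ (C1_cut i c d) (cut_ge0 i c d))).
    apply: (@continuous_comp _ _ _ (crd i) (trap u v n)); first exact: continuous_crd.
    by have [_] := C1R_ramp u v n; exact.
  - move=> x; apply: le_trans M1; rewrite normrM.
    have /andP[t0 t1] := trap_bounds u v n (crd i x) uv.
    have /andP[s0 s1] := sat_bounds n _ (cut_ge0 i c d x).
    by rewrite !ger0_norm// mulr_ile1.
  - move=> x xM; rewrite /slab_test.
    have [hi|hi] := pselect (u < crd i x < v); last by rewrite trap_off// mul0r.
    have [|h0] := ltP 0 (cut i c d x).
      by move=> h; exfalso; apply: xM; apply: pM; apply/slab_boxP.
    have -> : cut i c d x = 0 by apply/eqP; rewrite eq_le h0 cut_ge0.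
    by rewrite sat0 mulr0.
split.
- by apply: (@measurable_indic _ (B3 R)); exact: measurable_obox.
- by move=> x; apply: le_trans M1; rewrite indicE; case: (_ \in _); rewrite ?normr1 ?normr0.
- by move=> x xM; rewrite indicE memNset// => h; apply: xM; exact: pM.
Qed.

Lemma cvg_slab_test i c d (u v : R) x : u < v ->
  slab_test i c d u v n x @[n --> \oo] --> (\1_(obox (setc i c u) (setc i d v)) x : R).
Proof.
move=> uv.
have -> : \1_(obox (setc i c u) (setc i d v)) x =
    \1_`]u, v[%classic (crd i x) * (0 < cut i c d x)%R%:R :> R.
  rewrite !indicE -natrM mulnb; congr (_ %:R); congr nat_of_bool.
  apply/idP/andP => [|[]]; rewrite !inE/= in_itv/=.
    by move/slab_boxP => -[].
  by move=> h1 h2; apply/slab_boxP.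
by apply: cvgM; [exact: cvg_trap|exact: cvg_sat (cut_ge0 _ _ _ _)].
Qed.

Lemma int3_indic A (P : set (space3 R)) : lebesgue_measurable3 A -> lebesgue_measurable3 P ->
  int3 A \1_P = fine (lebesgue3 (A `&` P)).
Proof.
move=> mA mP; rewrite /Rintegral; congr (fine _); rewrite setIC.
exact: (integral_indic lebesgue3 mA mP).
Qed.

(** The measure of [A] in a box, per unit length along axis [i], is the same for the smaller and the
    larger interval. The difference of their weighted slab tests is the i-th derivative of a
    function supported in the larger box, so [splits_int0] applies; the limit replaces slab tests by
    indicators. *)
Lemma slide A B i c d (u v u' v' : R) : perimeter_splits A B ->
  u' <= u -> u < v -> v <= v' -> obox (setc i c u') (setc i d v') `<=` A `|` B ->
  fine (lebesgue3 (A `&` obox (setc i c u) (setc i d v))) * (v' - u') =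
  fine (lebesgue3 (A `&` obox (setc i c u') (setc i d v'))) * (v - u).
Proof.
move=> sp uu uv vv sub; have [mA _ _ _] := sp.
have uv' : u' < v' by lra.
have mP p q : lebesgue_measurable3 (obox p q : set (space3 R)).
  by apply: lebesgue_measurable3_borel; exact: measurable_obox.
have [M [M0 bM bMl]] := slab_test_bounded i c d _ _ uv.
have [N [N0 bN bNl]] := slab_test_bounded i c d _ _ uv'.
have c1 := int3_dominated _ mA bM bMl (fun x => cvg_slab_test i c d _ _ x uv).
have c2 := int3_dominated _ mA bN bNl (fun x => cvg_slab_test i c d _ _ x uv').
rewrite int3_indic// in c1; rewrite int3_indic// in c2.
pose m n := v - u - slope u v n; pose m' n := v' - u' - slope u' v' n.
have cm : m n @[n --> \oo] --> v - u.
  by rewrite -[X in _ --> X]subr0; apply: cvgB; [exact: cvg_cst|exact: cvg_slope].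
have cm' : m' n @[n --> \oo] --> v' - u'.
  by rewrite -[X in _ --> X]subr0; apply: cvgB; [exact: cvg_cst|exact: cvg_slope].
have E n : int3 A (slab_test i c d u v n) * m' n = int3 A (slab_test i c d u' v' n) * m n.
  (* The weights are the areas of the two trapezoids, crosswise, so that [th] returns to 0 at
     [v']. *)
  pose th t := m' n * ramp u v n t + (- m n) * ramp u' v' n t.
  pose th' t := m' n * trap u v n t + (- m n) * trap u' v' n t.
  have thC : C1R th th' by apply: C1RD; apply: C1RZ; exact: C1R_ramp.
  pose kap x := sat n (cut i c d x).
  have kC : C1 kap by apply: C1_sat; [exact: C1_cut|exact: cut_ge0].
  pose psi x := th (crd i x) * kap x.
  have tC : C1 (fun x => th (crd i x)) by exact: (C1_crd _ _ i thC).
  have pC : C1 psi by exact: C1M.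
  have th0 t : ~ (u' < t < v') -> th t = 0.
    move=> ht; rewrite /th; have [tu|ut] := leP t u'.
      rewrite (ramp_left u v n t uv (le_trans tu uu)) (ramp_left u' v' n t uv' tu).
      by rewrite !mulr0 addr0.
    have vt : v' <= t by rewrite leNgt; apply/negP => ?; apply: ht; rewrite ut.
    rewrite (ramp_right u v n t uv (le_trans vv vt)) (ramp_right u' v' n t uv' vt).
    by rewrite mulNr mulrC subrr.
  have p0 x : ~ obox (setc i c u') (setc i d v') x -> psi x = 0.
    move=> xP; rewrite /psi /kap; have [hi|hi] := pselect (u' < crd i x < v'); last by rewrite th0// mul0r.
    have [h|h0] := ltP 0 (cut i c d x); first by exfalso; apply: xP; apply/slab_boxP.
    have -> : cut i c d x = 0 by apply/eqP; rewrite eq_le h0 cut_ge0.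
    by rewrite sat0 mulr0.
  have pM : csupp N psi.
    move=> x xM; apply: p0 => xP; have [_ _ /(_ x xM)] := bNl.
    by rewrite indicE mem_set//= => /eqP; rewrite oner_eq0.
  have := splits_int0 A B psi i N sp pC pM (fun x h => p0 x (fun k => h (sub x k))).
  have -> : 'd_i psi = fun x => m' n * slab_test i c d u v n x + (- m n) * slab_test i c d u' v' n x.
    apply/funext => x; apply: etrans (derive3M _ _ i x tC kC) _.
    have -> : 'd_i kap x = 0 by apply: derive_indep => t; rewrite /kap cut_indep.
    have [_ ->] := derive_crd _ _ i i x thC.
    by rewrite eqxx mulr0 add0r /slab_test /th' -/(kap x) mul1r; ring.
  rewrite (int3D mA (bounded_suppZ _ (bM n)) (bounded_suppZ _ (bN n))).
  rewrite (int3Z _ mA (bM n)) (int3Z _ mA (bN n)) mulNr => /eqP; rewrite subr_eq0 => /eqP.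
  by rewrite mulrC [X in _ = X]mulrC.
have h1 := cvgM c1 cm'; have h2 := cvgM c2 cm.
rewrite -(cvg_lim (@Rhausdorff R) (h1 _)) -(cvg_lim (@Rhausdorff R) (h2 _)).
congr (lim (_ @ \oo)); apply/funext => n; exact: E.
Qed.

End ZeroOne.

(** * Boxes as a generating family stable under intersection *)

Section BoxGeneration.
Context {R : realType}.

Definition boxes : set (set (space3 R)) := [set X | exists a b, X = obox a b].

Definition cmax (a b : space3 R) : space3 R :=
  (Num.max a.1.1 b.1.1, Num.max a.1.2 b.1.2, Num.max a.2 b.2).

Definition cmin (a b : space3 R) : space3 R :=
  (Num.min a.1.1 b.1.1, Num.min a.1.2 b.1.2, Num.min a.2 b.2).

Lemma crd_cmax i a b : crd i (cmax a b) = Num.max (crd i a) (crd i b).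
Proof. by move: i; apply: ord3P; rewrite /crd/= ?inordK. Qed.

Lemma crd_cmin i a b : crd i (cmin a b) = Num.min (crd i a) (crd i b).
Proof. by move: i; apply: ord3P; rewrite /crd/= ?inordK. Qed.

Lemma obox_setI (a b c d : space3 R) : obox a b `&` obox c d = obox (cmax a c) (cmin b d).
Proof.
rewrite predeqE => x; split => [[/oboxP h /oboxP k]|/oboxP h].
  apply/oboxP => j; rewrite crd_cmax crd_cmin gt_max lt_min.
  by have /andP[-> ->] := h j; have /andP[-> ->] := k j.
by split; apply/oboxP => j; have := h j; rewrite crd_cmax crd_cmin gt_max lt_min
  => /andP[/andP[h1 h2] /andP[h3 h4]]; apply/andP.
Qed.

Lemma boxes_setI : setI_closed boxes.
Proof.
move=> _ _ [a [b ->]] [c [d ->]].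
by exists (cmax a c), (cmin b d); exact: obox_setI.
Qed.

Lemma measurable_boxes : @measurable _ (B3 R) = <<s boxes >>.
Proof.
rewrite eqEsubset; split; last first.
  apply: smallest_sub; first exact: sigma_algebra_measurable.
  by move=> _ [a [b ->]]; exact: measurable_obox.
pose T := g_sigma_algebraType boxes.
have mbox a b : measurable (obox a b : set T).
  by apply: sub_sigma_algebra; exists a, b.
have m1 (p : space3 R -> R) (F : R -> R -> nat -> space3 R * space3 R) :
    (forall u v, p @^-1` `]u, v[ = \bigcup_k obox (F u v k).1 (F u v k).2) ->
    measurable_fun [set: T] (p : T -> measurableTypeR R).
  move=> pF; apply: (measurability _ (RGenOpens.measurableE R)).
  move=> _ [_ [u [v ->] <-]]; rewrite setTI pF.
  exact: bigcupT_measurable.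
have ex (t s : R) : exists k : nat, (`|t| < k%:R) && (`|s| < k%:R).
  exists (maxn (Num.bound `|t|) (Num.bound `|s|)).
  apply/andP; split.
    by apply: lt_le_trans (archi_boundP (normr_ge0 _)) _; rewrite ler_nat leq_maxl.
  by apply: lt_le_trans (archi_boundP (normr_ge0 _)) _; rewrite ler_nat leq_maxr.
have mx : measurable_fun [set: T] ((fun x => x.1.1) : T -> measurableTypeR R).
  apply: (m1 _ (fun u v k => ((u, - k%:R, - k%:R), (v, k%:R, k%:R)))) => u v.
  rewrite predeqE => x; split => /= [|[k _ [/= h _ _]]]; rewrite in_itv//= => h.
  have [k /andP[]] := ex x.1.2 x.2; rewrite !ltr_norml => ? ?.
  by exists k.
have my : measurable_fun [set: T] ((fun x => x.1.2) : T -> measurableTypeR R).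
  apply: (m1 _ (fun u v k => ((- k%:R, u, - k%:R), (k%:R, v, k%:R)))) => u v.
  rewrite predeqE => x; split => /= [|[k _ [/= _ h _]]]; rewrite in_itv//= => h.
  have [k /andP[]] := ex x.1.1 x.2; rewrite !ltr_norml => ? ?.
  by exists k.
have mz : measurable_fun [set: T] ((fun x => x.2) : T -> measurableTypeR R).
  apply: (m1 _ (fun u v k => ((- k%:R, - k%:R, u), (k%:R, k%:R, v)))) => u v.
  rewrite predeqE => x; split => /= [|[k _ [/= _ _ h]]]; rewrite in_itv//= => h.
  have [k /andP[]] := ex x.1.1 x.1.2; rewrite !ltr_norml => ? ?.
  by exists k.
move=> X mX.
have := measurable_fun_pair (measurable_fun_pair mx my) mz.
move=> /(_ measurableT X mX); rewrite setTI.
suff -> : (fun x : T => (x.1.1, x.1.2, x.2)) @^-1` X = X by [].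
by rewrite predeqE => -[[? ?] ?].
Qed.

(** With the proof [mP] as an argument, the measure structure below is available for every
    measurable [P], Borel or not. *)
Definition lebesgue3_on (P : set (space3 R)) (mP : lebesgue_measurable3 P)
  (X : set (B3 R)) : \bar R := lebesgue3 (X `&` P).

Section RestrictedMeasure.
Variables (P : set (space3 R)) (mP : lebesgue_measurable3 P).

Let on0 : lebesgue3_on P mP set0 = 0%E.
Proof. by rewrite /lebesgue3_on set0I; exact: (measure0 lebesgue3). Qed.

Let on_ge0 X : (0 <= lebesgue3_on P mP X)%E.
Proof. exact: (measure_ge0 lebesgue3). Qed.

Let on_additive : semi_sigma_additive (lebesgue3_on P mP).
Proof.
move=> F mF tF mUF.
have mF' i : lebesgue_measurable3 (F i) by exact: lebesgue_measurable3_borel.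
have mUF' : lebesgue_measurable3 (\bigcup_i F i) by exact: lebesgue_measurable3_borel.
exact: (measure_semi_sigma_additive (s := mrestr lebesgue3 mP) F mF' tF mUF').
Qed.

HB.instance Definition _ :=
  isMeasure.Build _ _ _ (lebesgue3_on P mP) on0 on_ge0 on_additive.

End RestrictedMeasure.

End BoxGeneration.

Section ZeroOneLaw.
Context {R : realType}.
Implicit Types (x y a b c d : space3 R) (i j : 'I_3) (A B E : set (space3 R)).

Definition volume c d : R := (d.1.1 - c.1.1) * (d.1.2 - c.1.2) * (d.2 - c.2).

Lemma lebesgue_measurable3_obox a b : lebesgue_measurable3 (obox a b).
Proof. by apply: lebesgue_measurable3_borel; exact: measurable_obox. Qed.

Lemma space3_eta x : (x.1.1, x.1.2, x.2) = x. Proof. by case: x => -[]. Qed.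

(** Three slides, one along each axis, enlarge the box from [c], [d] through the corners [p1], [q1]
    and [p2], [q2] to [a], [b]. *)
Lemma scaled_box A B a b c d : perimeter_splits A B -> obox a b `<=` A `|` B ->
  (forall i, crd i a <= crd i c < crd i d) -> (forall i, crd i d <= crd i b) ->
  fine (lebesgue3 (A `&` obox c d)) * volume a b = fine (lebesgue3 (A `&` obox a b)) * volume c d.
Proof.
move=> sp ab hac hdb.
have [/andP[a0 c0] d0] := (hac 0, hdb 0); have [/andP[a1 c1] d1] := (hac 1, hdb 1).
have [/andP[a2 c2] d2] := (hac (inord 2), hdb (inord 2)).
rewrite /crd/= ?inordK//= in a0 c0 d0 a1 c1 d1 a2 c2 d2.
pose p1 : space3 R := (a.1.1, c.1.2, c.2); pose q1 : space3 R := (b.1.1, d.1.2, d.2).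
pose p2 : space3 R := (a.1.1, a.1.2, c.2); pose q2 : space3 R := (b.1.1, b.1.2, d.2).
have E0 : (setc 0 c a.1.1 = p1) * (setc 0 d b.1.1 = q1) * (setc 0 c c.1.1 = c) * (setc 0 d d.1.1 = d).
  by do !split; rewrite /setc/= ?space3_eta.
have E1 : (setc 1 p1 a.1.2 = p2) * (setc 1 q1 b.1.2 = q2) * (setc 1 p1 c.1.2 = p1) * (setc 1 q1 d.1.2 = q1).
  by do !split; rewrite /setc/= ?space3_eta.
have E2 : (setc (inord 2) p2 a.2 = a) * (setc (inord 2) q2 b.2 = b) * (setc (inord 2) p2 c.2 = p2) * (setc (inord 2) q2 d.2 = q2).
  by do !split; rewrite /setc/= inordK//= ?space3_eta.
have S0 := slide A B 0 c d _ _ _ _ sp a0 c0 d0.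
have S1 := slide A B 1 p1 q1 _ _ _ _ sp a1 c1 d1.
have S2 := slide A B (inord 2) p2 q2 _ _ _ _ sp a2 c2 d2.
rewrite !E0 in S0; rewrite !E1 in S1; rewrite !E2 in S2.
have sub1 : obox p1 q1 `<=` A `|` B.
  by apply: subset_trans ab => x [/= h1 h2 h3]; split => //; lra.
have sub2 : obox p2 q2 `<=` A `|` B.
  by apply: subset_trans ab => x [/= h1 h2 h3]; split => //; lra.
have {S0} := S0 sub1; have {S1} := S1 sub2; have {S2} := S2 ab.
rewrite /volume; set V2 := fine _; set V3 := fine _; set V1 := fine _; set V0 := fine _ => S2 S1 S0.
set B1 := b.1.1 - a.1.1 in S0 *; set D1 := d.1.1 - c.1.1 in S0 *.
set B2 := b.1.2 - a.1.2 in S1 *; set D2 := d.1.2 - c.1.2 in S1 *.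
transitivity (V0 * B1 * B2 * (b.2 - a.2)); first by ring.
rewrite S0; transitivity (V1 * B2 * D1 * (b.2 - a.2)); first by ring.
rewrite S1; transitivity (V2 * (b.2 - a.2) * D2 * D1); first by ring.
by rewrite S2; ring.
Qed.

(* On the box Q the measure |A n .| is proportional to Lebesgue measure, and
   outer regularity applied to A n Q itself forces the factor to be 0 or 1. *)
Lemma zero_one A B a b : perimeter_splits A B -> obox a b `<=` A `|` B ->
  (forall i, crd i a < crd i b) ->
  lebesgue3 (A `&` obox a b) = 0%E \/ lebesgue3 (B `&` obox a b) = 0%E.
Proof.
move=> sp ab altb; have [mA mB AB _] := sp.
have mQ := lebesgue_measurable3_obox a b; set Q := obox a b in ab mQ *.
have mAQ : lebesgue_measurable3 (A `&` Q) by exact: measurableI.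
have V0 : 0 < volume a b.
  have := altb (inord 2); rewrite /crd/= inordK// => ?.
  by rewrite !mulr_gt0// subr_gt0//; [exact: (altb 0)|exact: (altb 1)].
have QV : lebesgue3 Q = (volume a b)%:E.
  by rewrite lebesgue3_obox//; [exact: ltW (altb 0)|exact: ltW (altb 1)|
    have := altb (inord 2); rewrite /crd/= inordK// => /ltW].
have fin X : X `<=` Q -> lebesgue3 X \is a fin_num.
  move=> XQ; rewrite ge0_fin_numE; last exact: (measure_ge0 lebesgue3).
  by apply: le_lt_trans (le_lebesgue3 _ _ XQ) _; rewrite QV ltry.
pose k := fine (lebesgue3 (A `&` Q)) / volume a b.
have k0 : 0 <= k.
  by apply: divr_ge0; [apply: fine_ge0; exact: (measure_ge0 lebesgue3)|exact: ltW].
(* By [scaled_box] both sides agree on boxes, hence on all Borel sets by uniqueness of measures. *)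
have kE (X : set (B3 R)) : measurable X -> lebesgue3 (X `&` (A `&` Q)) = (k%:E * lebesgue3 (X `&` Q))%E.
  move=> mX; suff : lebesgue3_on _ mAQ X = mscale (NngNum k0) (lebesgue3_on _ mQ) X by [].
  apply: (@measure_unique _ R _ (@boxes R : set (set (B3 R))) (fun n => cube n%:R) measurable_boxes
    boxes_setI _ _ (lebesgue3_on _ mAQ) (mscale (NngNum k0) (lebesgue3_on _ mQ))) => //.
  - by move=> n; exists (- n%:R, - n%:R, - n%:R), (n%:R, n%:R, n%:R).
  - rewrite -subTset => x _.
    pose n := maxn (Num.bound `|x.1.1|) (maxn (Num.bound `|x.1.2|) (Num.bound `|x.2|)).
    have H (t : R) m : (Num.bound `|t| <= m)%N -> - m%:R < t < m%:R.
      move=> tm; rewrite -ltr_norml; apply: lt_le_trans (archi_boundP (normr_ge0 _)) _.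
      by rewrite ler_nat.
    by exists n => //; split; apply: H; rewrite /n !leq_max leqnn ?orbT.
  - move=> _ [c [d ->]]; suff : lebesgue3 (obox c d `&` (A `&` Q)) = (k%:E * lebesgue3 (obox c d `&` Q))%E by [].
    rewrite setIA [obox c d `&` A]setIC -setIA obox_setI.
    set p := cmax c a; set q := cmin d b.
    have pqQ : obox p q `<=` Q by rewrite -obox_setI; exact: subIsetr.
    have [lt|/existsNP[i /negP]] := pselect (forall i, crd i p < crd i q); last first.
      rewrite -leNgt => qp; have -> : obox p q = set0.
        rewrite -subset0 => x /oboxP/(_ i)/andP[h1 h2].
        by have := lt_trans h1 h2; rewrite ltNge qp.
      by rewrite setI0 (measure0 lebesgue3) mule0.
    have hap i : crd i a <= crd i p by rewrite crd_cmax le_max lexx orbT.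
    have hqb i : crd i q <= crd i b by rewrite crd_cmin ge_min lexx orbT.
    have := scaled_box _ _ _ _ p q sp ab (fun i => (introT andP (conj (hap i) (lt i)))) hqb.
    move=> H; rewrite lebesgue3_obox; [|exact: ltW (lt 0)|exact: ltW (lt 1)|
      by have := lt (inord 2); rewrite /crd/= inordK// => /ltW].
    rewrite -[LHS]fineK; last by apply: fin; apply: subset_trans pqQ; exact: subIsetr.
    rewrite -EFinM; congr (_%:E); rewrite /k mulrAC -H mulfK// gt_eqF//.
  - move=> n; apply: le_lt_trans (le_lebesgue3 _ _ (@subIsetl _ _ _)) _.
    by rewrite lebesgue3_cube// ltry.
set v := fine (lebesgue3 (A `&` Q)) in k k0 kE.
have vE : lebesgue3 (A `&` Q) = v%:E by rewrite fineK// fin//; exact: subIsetr.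
(* The set [A] need not be Borel, so [kE] is applied to a Borel cover of its part in [Q] whose
   measure is almost [v]. *)
have vk : v <= k * v.
  apply/ler_addgt0Pr => e e0.
  have e1 : 0 < e / (k + 1) by rewrite divr_gt0//; lra.
  have vf : lebesgue3 (A `&` Q) \is a fin_num by rewrite vE.
  have [_ [F [mF AF] <-] Fe] := lb_ereal_inf_adherent e1 vf.
  have mM : measurable (\bigcup_n F n : set (B3 R)) by exact: bigcupT_measurable.
  have : (lebesgue3 (A `&` Q) <= k%:E * (v + e / (k + 1))%:E)%E.
    have -> : A `&` Q = (\bigcup_n F n) `&` (A `&` Q) by rewrite [RHS]setIC (setIidl AF).
    rewrite kE//; apply: lee_wpmul2l; first by rewrite lee_fin.
    apply: (le_trans (le_lebesgue3 _ _ (@subIsetl _ _ _))).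
    rewrite lebesgue3_borel//.
    apply: (le_trans (measure_sigma_subadditive borel_lebesgue3 mF mM (@subset_refl _ _))).
    by apply: ltW; rewrite EFinD -vE.
  rewrite vE -EFinM lee_fin => /le_trans; apply; rewrite mulrDr lerD2l.
  rewrite mulrA ler_pdivrMr; last lra.
  by rewrite mulrC ler_pM2l//; lra.
have [v0|v0] := eqVneq v 0; [by left; rewrite vE v0|right].
have v1 : 0 < v by rewrite lt_neqAle eq_sym v0 fine_ge0//; exact: (measure_ge0 lebesgue3).
have k1 : 1 <= k by rewrite -(ler_pM2r v1) mul1r.
have Vv : volume a b <= v by move: k1; rewrite /k ler_pdivlMr// mul1r.
have mBQ : lebesgue_measurable3 (B `&` Q) by exact: measurableI.
have E : lebesgue3 Q = (lebesgue3 (A `&` Q) + lebesgue3 (B `&` Q))%E.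
  have dis : (A `&` Q) `&` (B `&` Q) = set0 by rewrite setIACA AB set0I.
  rewrite -(measureU lebesgue3 mAQ mBQ dis) -setIUl; congr (lebesgue3 _).
  by rewrite setIC (setIidl ab).
have B0 := measure_ge0 lebesgue3 (B `&` Q : set (L3 R)).
have Bf : lebesgue3 (B `&` Q) \is a fin_num by apply: fin; exact: subIsetr.
have w0 := fine_ge0 B0.
move: E; rewrite QV vE -[X in _ = (_ + X)%E](fineK Bf) -EFinD => -[E].
rewrite -[LHS](fineK Bf); congr (_%:E); move: w0 E; set w := fine _ => w0 E.
by apply/eqP; rewrite eq_le; apply/andP; split=> //; rewrite -(lerD2l v) addr0 -E.
Qed.

End ZeroOneLaw.

(** * The comb *)

Section Construction.
Context {R : realType}.
Implicit Types (x y p : space3 R) (r : R) (t : space3 R * R) (s : seq (space3 R * R)).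

Definition in_csquare t (u v : R) := (`|u - t.1.1.1| <= t.2) && (`|v - t.1.1.2| <= t.2).

Definition chamber : set (space3 R) := obox (-1, -1, 0) (1, 1, 1).

(** A hair [t] consists of the centre of the top face and half the side of the square. The whole
    face must lie in the m-th box, so that one box around a point captures an entire face. The
    factor 1/4 gives a square of doubled side at most 2^-m. *)
Definition admissible (m : nat) s t : Prop :=
  [/\ 0 < t.2, t.2 <= 4^-1 * 2^-1 ^+ m,
    forall u v, in_csquare t u v -> (base_box m `&` chamber) (u, v, t.1.2)
  & forall t', t' \in s -> forall u v, in_csquare t u v -> ~~ in_csquare t' u v].

(* If no admissible hair exists, the radius -1 makes the square empty. *)
Definition pick_hair (m : nat) s : space3 R * R :=
  match pselect (exists t, admissible m s t) with
  | left e => projT1 (cid e)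
  | right _ => (0, -1)
  end.

Fixpoint hairs (m : nat) : seq (space3 R * R) :=
  if m is k.+1 then pick_hair k (hairs k) :: hairs k else [::].

Definition hair m := pick_hair m (hairs m).
Definition tip m : space3 R := (hair m).1.
Definition radius m : R := (hair m).2.
Definition csquare m (u v : R) := in_csquare (hair m) u v.

Lemma hair_cases m : admissible m (hairs m) (hair m) \/ hair m = (0, -1).
Proof.
rewrite /hair /pick_hair; case: pselect => [e|e]; [left|by right].
exact: projT2 (cid e).
Qed.

Lemma mem_hairs n m : (n < m)%N -> hair n \in hairs m.
Proof.
elim: m => // m ih; rewrite ltnS leq_eqVlt => /predU1P[->|nm].
  by rewrite inE eqxx.
by rewrite inE ih// orbT.
Qed.

Lemma csquare_radius m u v : csquare m u v -> 0 <= radius m.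
Proof. by move=> /andP[+ _]; apply: le_trans. Qed.

Lemma csquare_admissible m u v : csquare m u v -> admissible m (hairs m) (hair m).
Proof.
move=> h; have [//|E] := hair_cases m; have := csquare_radius _ _ _ h.
by rewrite /radius E/= ler0N1.
Qed.

Lemma csquare_disjoint n m u v : csquare n u v -> csquare m u v -> n = m.
Proof.
wlog nm : n m / (n < m)%N => [H|] hn hm.
  by have [/H|/H|//] := ltngtP n m; [exact|move=> /(_ hm hn)].
have [_ _ _ /(_ _ (mem_hairs _ _ nm) _ _ hm)] := csquare_admissible _ _ _ hm.
by rewrite [in_csquare _ _ _]hn.
Qed.

Lemma radius_cases m : [/\ 0 < radius m, radius m <= 4^-1 * 2^-1 ^+ m, chamber (tip m),
    forall u v, csquare m u v -> -1 < u < 1 /\ -1 < v < 1 &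
    forall u v, csquare m u v -> base_box m (u, v, (tip m).2)] \/ radius m = -1.
Proof.
have [h|E] := hair_cases m; [left|right]; last by rewrite /radius E.
case: (h) => h1 h2 h3 _; split => //.
- have := h3 (tip m).1.1 (tip m).1.2.
  rewrite /in_csquare !subrr normr0 (ltW h1) => /(_ isT)[_].
  by rewrite /tip; case: (hair m).1 => -[].
- by move=> u v huv; have [_ []] := h3 u v huv.
- by move=> u v huv; have [] := h3 u v huv.
Qed.

Definition free : set (R * R) :=
  [set q | [/\ -1 < q.1 < 1, -1 < q.2 < 1 & forall m, ~~ csquare m q.1 q.2]].

Lemma avoid_csquare t (u v : R) : ~~ in_csquare t u v ->
  exists2 d : R, 0 < d & forall u' v', `|u' - u| <= d -> `|v' - v| <= d ->
    ~~ in_csquare t u' v'.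
Proof.
rewrite /in_csquare; case: t => -[[a b] c] r /=; rewrite negb_and -!ltNge => /orP[h|h].
  exists ((`|u - a| - r) / 2); first lra.
  move=> u' v' hu _; rewrite negb_and -!ltNge; apply/orP; left.
  by have := ler_distD u' u a; rewrite (distrC u u'); lra.
exists ((`|v - b| - r) / 2); first lra.
move=> u' v' _ hv; rewrite negb_and -!ltNge; apply/orP; right.
by have := ler_distD v' v b; rewrite (distrC v v'); lra.
Qed.

Lemma avoid_csquares s (u v : R) : (forall t, t \in s -> ~~ in_csquare t u v) ->
  exists2 d : R, 0 < d & forall t, t \in s -> forall u' v', `|u' - u| <= d -> `|v' - v| <= d ->
    ~~ in_csquare t u' v'.
Proof.
elim: s => [|t s ih] h; first by exists 1.
have [|d d0 hd] := ih; first by move=> t' t's; apply: h; rewrite inE t's orbT.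
have [e e0 he] := avoid_csquare t _ _ (h t (mem_head _ _)).
exists (Num.min d e); first by rewrite lt_min d0.
move=> t'; rewrite inE => /predU1P[->|t's] u' v'; rewrite !le_min => /andP[h1 h2] /andP[h3 h4].
  exact: he.
exact: hd t's _ _ _ _.
Qed.

Lemma hairs_hair m t : t \in hairs m -> exists n, t = hair n.
Proof. by elim: m => // m ih; rewrite inE => /predU1P[->|/ih//]; exists m. Qed.

(** Some rational box, with index [m] say, surrounds [p] inside [U]. Before stage [m] only finitely
    many closed squares are placed and none contains the projection of [p], so a small square around
    it is admissible and the choice at stage [m] succeeds. *)
Lemma hair_dense p (U : set (space3 R)) : free p.1 -> 0 < p.2 < 1 -> nbhs p U ->
  exists m, 0 < radius m /\ forall u v, csquare m u v -> U (u, v, (tip m).2).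
Proof.
move=> [h1 h2 hc] h3 pU.
have /base_box_nbhs[m mp mU] : nbhs p (U `&` chamber).
  by apply: filterI => //; apply: open_nbhs_nbhs; split; [exact: open_obox|].
have : exists t, admissible m (hairs m) t.
  have [|d d0 hd] := @avoid_csquares (hairs m) p.1.1 p.1.2.
    by move=> t /hairs_hair[n ->]; exact: hc.
  have : nbhs p (base_box m `&` chamber).
    by apply: open_nbhs_nbhs; split; [apply: openI; exact: open_obox|split].
  move=> /nbhs_obox[e e0 he].
  (* The three bounds avoid the earlier squares, keep the face in the box, and meet the size
     condition. *)
  pose r := Num.min (Num.min d (e / 2)) (4^-1 * 2^-1 ^+ m).
  have r0 : 0 < r by rewrite !lt_min d0 divr_gt0// mulr_gt0// exprn_gt0.
  have [rd re rm] : [/\ r <= d, r <= e / 2 & r <= 4^-1 * 2^-1 ^+ m].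
    by split; rewrite /r !ge_min lexx ?orbT.
  exists (p, r); split => //=.
  - move=> u v /andP[/=]; rewrite !ler_distl => hu hv.
    by apply: he; split => /=; lra.
  - move=> t ts u v /andP[/= hu hv]; apply: hd => //; exact: le_trans rd.
(* The hair chosen at stage [m] may differ from the one just exhibited, but its face lies in the
   same box; the default is excluded by existence. *)
move=> ex; exists m; have [[a1 _ a3 _]|E] := hair_cases m.
  split => // u v huv; apply: (mU _ _).1.
  by have [] := a3 u v huv.
exfalso; move: E; rewrite /hair /pick_hair; case: pselect => // e.
have [h0 _ _ _] := projT2 (cid e); move: h0; case: (cid e) => t /= _ + E.
by rewrite E/= ltr0N1.
Qed.

End Construction.

(** * The comb and its decomposition into disjoint boxes *)

Section Comb.
Context {R : realType}.
Implicit Types (x y : space3 R) (f : space3 R -> R) (A : set (space3 R)).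

Lemma int3_mulindic A f : int3 A f = int3 setT (fun x => f x * \1_A x).
Proof.
rewrite Rintegral_mkcond; congr (Rintegral _ _ _); apply/funext => x.
rewrite patchE indicE; case: ifP => _; first by rewrite mulr1.
by rewrite mulr0.
Qed.

Lemma bounded_supp_mulindic M f (A : set (B3 R)) : measurable A -> bounded_supp M f ->
  bounded_supp M (fun x => f x * \1_A x).
Proof.
move=> mA bf; have M0 := bounded_supp_ge0 bf; case: bf => mf fM fS; split.
- by apply: measurable_funM => //; exact: measurable_indic.
- move=> x; rewrite normrM indicE; case: (_ \in _); first by rewrite normr1 mulr1.
  by rewrite normr0 mulr0.
- by move=> x xM; rewrite fS// mul0r.
Qed.

(** Countable additivity of the integral, by dominated convergence of the indicators of finite
    unions. *)
Lemma cvg_int3_bigcup M f (F : nat -> set (B3 R)) : bounded_supp M f ->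
  (forall k, measurable (F k)) -> trivIset setT F ->
  \sum_(k < n) int3 (F k) f @[n --> \oo] --> int3 (\bigcup_k F k) f.
Proof.
move=> bf mF tF; pose G n : set (B3 R) := \big[setU/set0]_(k < n) F k.
have mG n : measurable (G n) by exact: bigsetU_measurable.
have mU : measurable (\bigcup_k F k) by exact: bigcupT_measurable.
have -> : (fun n => \sum_(k < n) int3 (F k) f) = fun n => int3 setT (fun x => f x * \1_(G n) x).
  apply/funext => n; rewrite -int3_mulindic; elim: n => [|n ih].
    by rewrite /G !big_ord0 /Rintegral integral_set0.
  rewrite big_ord_recr/= ih /G big_ord_recr/= (int3U _ _ _ bf)//.
  - exact: lebesgue_measurable3_borel (mG n).
  - exact: lebesgue_measurable3_borel (mF n).
  - rewrite -bigcup_mkord -subset0 => x [[k /= kn xk] xn].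
    by move: kn; rewrite (tF k n I I) ?ltnn//; exists x.
rewrite int3_mulindic; apply: (int3_dominated _ _ (fun n => bounded_supp_mulindic _ _ _ (mG n) bf) (bounded_supp_mulindic _ _ _ mU bf)).
  exact: lebesgue_measurable3_borel measurableT.
move=> x; apply: cvgM; first exact: cvg_cst.
have [[k _ kx]|nx] := pselect ((\bigcup_k F k) x).
  apply: cvg_near_cst; exists k.+1 => // n /= kn; rewrite !indicE !mem_set//; first by exists k.
  by rewrite /G -bigcup_mkord; exists k.
apply: cvg_near_cst; apply: nearW => n; rewrite !indicE !memNset// => h; apply: nx.
by move: h; rewrite /G -bigcup_mkord => -[k _ kx]; exists k.
Qed.

Lemma int3_bigcup_le M f (F : nat -> set (B3 R)) (L : R) : bounded_supp M f ->
  (forall k, measurable (F k)) -> trivIset setT F ->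
  (forall n, \sum_(k < n) `|int3 (F k) f| <= L) -> `|int3 (\bigcup_k F k) f| <= L.
Proof.
move=> bf mF tF h; have c := cvg_norm (cvg_int3_bigcup _ _ _ bf mF tF).
rewrite -(cvg_lim (@Rhausdorff R) (c _)); apply: limr_le; first by apply/cvg_ex; eexists; exact: (c _).
by apply: nearW => n; apply: le_trans (h n); exact: ler_norm_sum.
Qed.

Definition slab : set (space3 R) := obox (-1, -1, -1) (1, 1, 0).

(** Starting at -1, posts overlap the slab, which keeps the comb open and connected; starting at 0,
    they are disjoint from the slab, and fluxes can be summed. *)
Definition post_from (z : R) m : set (space3 R) :=
  obox ((tip m).1.1 - radius m, (tip m).1.2 - radius m, z)
       ((tip m).1.1 + radius m, (tip m).1.2 + radius m, (tip m).2).

Definition comb : set (space3 R) := slab `|` \bigcup_m post_from (-1) m.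

(** Disjoint boxes that fill the comb up to the null plane [ground]. *)
Definition piece n : set (space3 R) := if n is m.+1 then post_from 0 m else slab.

Lemma post_csquare z m x : post_from z m x -> csquare m x.1.1 x.1.2.
Proof.
move=> [/= h1 h2 _]; rewrite /csquare /in_csquare !ler_distl -/(tip m) -/(radius m).
by apply/andP; split; lra.
Qed.

Lemma post_radius z m x : post_from z m x -> 0 < (radius m : R).
Proof. by move=> [/= h1 _ _]; lra. Qed.

Lemma post_tip z m x : post_from z m x -> chamber (tip m : space3 R).
Proof.
by move=> h; have [[_ _ H _ _]//|E] := @radius_cases R m; have := post_radius _ _ _ h; rewrite E ltr0N1.
Qed.

Lemma post_square z m x : post_from z m x -> -1 < x.1.1 < 1 /\ -1 < x.1.2 < 1.
Proof.
move=> h; have [[_ _ _ H _]|E] := @radius_cases R m; first exact: H (post_csquare _ _ _ h).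
by have := post_radius _ _ _ h; rewrite E ltr0N1.
Qed.

Lemma measurable_piece n : measurable (piece n : set (B3 R)).
Proof. by case: n => [|n]; exact: measurable_obox. Qed.

Lemma trivIset_piece : trivIset setT piece.
Proof.
move=> [|n] [|m] _ _ //= [x [h1 h2]].
- by case: h1 => _ _ /= /andP[_ z]; case: h2 => _ _ /= /andP[z' _]; have := lt_trans z z'; rewrite ltxx.
- by case: h2 => _ _ /= /andP[_ z]; case: h1 => _ _ /= /andP[z' _]; have := lt_trans z z'; rewrite ltxx.
- by congr S; exact: csquare_disjoint (post_csquare _ _ _ h1) (post_csquare _ _ _ h2).
Qed.

Definition ground : set (space3 R) := [set x | crd (inord 2) x = 0].

Lemma comb_piece : comb `\` ground = (\bigcup_n piece n) `\` ground.
Proof.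
rewrite predeqE => x; rewrite /ground /crd/= inordK//=; split => -[h z]; split => //.
  case: h => [h|[m _ h]]; first by exists 0%N.
  have [z0|z0] := ltP x.2 0.
    exists 0%N => //; have [k1 k2] := post_square _ _ _ h.
    by case: h => /= _ _ /andP[h3 _]; split => //=; rewrite h3.
  exists m.+1 => //; case: h => /= h1 h2 /andP[_ h3]; split => //=; rewrite h3 andbT.
  by rewrite lt_neqAle z0 andbT eq_sym; apply/eqP.
case: h => -[|m] _; first by left.
move=> h; right; exists m => //; have [/= _ _ /andP[t0 _]] := post_tip _ _ _ h.
by case: h => /= h1 h2 h3; split => //=; lra.
Qed.

Lemma measurable_comb : measurable (comb : set (B3 R)).
Proof.
apply: measurableU; first exact: measurable_obox.
by apply: bigcupT_measurable => m; exact: measurable_obox.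
Qed.

Lemma int3_comb M f : bounded_supp M f -> int3 comb f = int3 (\bigcup_n piece n) f.
Proof.
move=> bf; have [g0 mg] := @hyperplane_null R (inord 2) 0.
have mg' := lebesgue_measurable3_borel _ mg.
have mc := lebesgue_measurable3_borel _ measurable_comb.
have mp : lebesgue_measurable3 (\bigcup_n piece n).
  by apply: lebesgue_measurable3_borel; apply: bigcupT_measurable; exact: measurable_piece.
by rewrite (int3_null mc mg' g0 bf) (int3_null mp mg' g0 bf) -/ground comb_piece.
Qed.

Lemma open_comb : open comb.
Proof.
apply: openU; first exact: open_obox.
by apply: bigcup_open => m _; exact: open_obox.
Qed.

End Comb.

(** * Finite perimeter and propagation of null sets through boxes *)

Section CombPerimeter.
Context {R : realType}.
Implicit Types (x y : space3 R) (f : space3 R -> R) (A B : set (space3 R)) (i : 'I_3).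

(** The first [N] terms are 0 to match a cut-off that kills the flux of the first [N] posts; [N = 0]
    gives the full series. *)
Lemma geometric_tail (N n : nat) :
  \sum_(k < n) (if (k < N)%N then 0 else 2^-1 ^+ k) <= 2 * 2^-1 ^+ N :> R.
Proof.
suff : \sum_(k < n) (if (k < N)%N then 0 else 2^-1 ^+ k) <= 2 * 2^-1 ^+ N - 2 * 2^-1 ^+ maxn n N :> R.
  by move=> /le_trans; apply; rewrite gerBl mulr_ge0// exprn_ge0.
elim: n => [|n ih]; first by rewrite big_ord0 max0n subrr.
rewrite big_ord_recr/=; case: ltnP => nN.
  by rewrite addr0 (maxn_idPr nN) (le_trans ih)// (maxn_idPr (ltnW nN)).
apply: le_trans (lerD ih (lexx _)) _.
rewrite (maxn_idPl nN) (maxn_idPl (leqW nN)) exprS; lra.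
Qed.

(** Values at opposite faces differ by at most 2, and each face has area at most twice the radius,
    that is 2^-m / 2. *)
Lemma piece_flux f i m (M : R) : C1 f -> csupp M f -> (forall x, `|f x| <= 1) ->
  `|int3 (post_from 0 m) ('d_i f)| <= 2^-1 ^+ m.
Proof.
move=> fC fM f1; have [[r0 rm [/= c1 c2 c3] _ _]|E] := @radius_cases R m; last first.
  rewrite (_ : post_from 0 m = set0); first by rewrite /Rintegral integral_set0/= normr0 exprn_ge0.
  by rewrite -subset0 => x /post_radius; rewrite E ltr0N1.
have q1 : 2^-1 ^+ m <= 1 :> R by rewrite exprn_ile1//; lra.
apply: (le_trans (box_flux _ i _ _ M 2 fC fM _ _)).
- by move=> x; apply: (le_trans (ler_normB _ _)); have := f1 (setc i x (crd i ((tip m).1.1 + radius m, (tip m).1.2 + radius m, (tip m).2)));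
    have := f1 (setc i x (crd i ((tip m).1.1 - radius m, (tip m).1.2 - radius m, 0))); lra.
- by apply: ord3P; rewrite /crd/= ?inordK//=; lra.
move: r0 rm c3 q1; move: (radius m) (tip m).2 (2^-1 ^+ m) (tip m).1.1 (tip m).1.2 => r h q a b r0 rq /andP[h0 h1] q1.
by case: i => -[|[|[|//]]] p; rewrite /face_area/=; nra.
Qed.

(** The slab contributes 8, a difference of 2 times a face of area at most 4; the posts contribute
    at most the geometric sum 2. *)
Lemma comb_flux f i (M : R) : C1 f -> csupp M f -> (forall x, `|f x| <= 1) ->
  `|int3 comb ('d_i f)| <= 10.
Proof.
move=> fC fM f1; have [N [_ /(_ i) bd]] := C1_bounded _ _ fC fM.
rewrite (int3_comb _ _ bd); apply: (int3_bigcup_le _ _ _ _ bd measurable_piece trivIset_piece).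
case=> [|n]; first by rewrite big_ord0.
rewrite big_ord_recl/=; have -> : 10 = 8 + 2 * 2^-1 ^+ 0 :> R by rewrite expr0; lra.
apply: lerD.
  apply: (le_trans (box_flux _ i _ _ M 2 fC fM _ _)).
  - by move=> x; apply: (le_trans (ler_normB _ _)); have := f1 (setc i x (crd i (1, 1, 0)));
    have := f1 (setc i x (crd i (-1, -1, -1))); lra.
  - by apply: ord3P; rewrite /crd/= ?inordK//=; lra.
  - by case: i {bd} => -[|[|[|//]]] p; rewrite /face_area/=; lra.
apply: le_trans (geometric_tail 0 n); apply: ler_sum => k _.
exact: piece_flux fC fM f1.
Qed.

Lemma int3_setC M f A : lebesgue_measurable3 A -> bounded_supp M f ->
  int3 setT f = int3 A f + int3 (~` A) f.
Proof.
move=> mA bf; have mC : lebesgue_measurable3 (~` A) by exact: measurableC.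
by rewrite -(int3U mA mC (setICr A) bf) setUCr.
Qed.

Lemma comb_flux_setC f i (M : R) : C1 f -> csupp M f ->
  int3 (~` comb) ('d_i f) = - int3 comb ('d_i f).
Proof.
move=> fC fM; have [N [_ /(_ i) bd]] := C1_bounded _ _ fC fM.
have := int3_setC _ _ _ (lebesgue_measurable3_borel _ (@measurable_comb R)) bd.
rewrite (int3_derive0 _ _ M setT fC fM)//; last by move=> x /(_ I).
by move=> /esym/eqP; rewrite addrC addr_eq0 => /eqP.
Qed.

Lemma test_field_le1 (X : space3 R -> space3 R) i x : test_field X -> `|crd i (X x)| <= 1.
Proof.
move=> /test_fieldP[_ _ /(_ x)]; rewrite (bigD1 i)//= => h.
have : crd i (X x) ^+ 2 <= 1 by apply: le_trans h; rewrite lerDl sumr_ge0// => j _; exact: sqr_ge0.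
by rewrite -[leLHS]real_normK ?num_real// expr_le1.
Qed.

Lemma perimeter_flux A (c : R) : lebesgue_measurable3 A ->
  (forall f i (M : R), C1 f -> csupp M f -> (forall x, `|f x| <= 1) ->
    `|int3 A ('d_i f)| <= c) -> (perimeter A < +oo)%E.
Proof.
move=> mA h; apply: (@le_lt_trans _ _ (3 * c)%:E); last by rewrite ltry.
apply: perimeter_le => // X tX; have [-> _] := int3_divergence _ _ mA tX.
have [XC [M XM] _] := (test_fieldP X).1 tX.
have H i : int3 A ('d_i (crd i \o X)) <= c.
  apply: (le_trans (ler_norm _)); apply: (h _ _ M (XC i) (XM i)) => x.
  exact: test_field_le1.
have -> : 3 * c = c + c + c by ring.
by rewrite sum3E; apply: lerD; [apply: lerD|]; exact: H.
Qed.

Lemma finite_perimeter_comb : finite_perimeter (@comb R).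
Proof.
have mc := lebesgue_measurable3_borel _ (@measurable_comb R).
by split => //; apply: (perimeter_flux _ 10 mc) => f i M; exact: comb_flux.
Qed.

Lemma finite_perimeter_setC_comb : finite_perimeter (~` @comb R).
Proof.
have mc : lebesgue_measurable3 (~` @comb R).
  by apply: lebesgue_measurable3_borel; apply: measurableC; exact: measurable_comb.
split => //; apply: (perimeter_flux _ 10 mc) => f i M fC fM f1.
by rewrite (comb_flux_setC _ _ _ fC fM) normrN; exact: comb_flux fC fM f1.
Qed.

Lemma adde_ge0_lty (p q : \bar R) : (0 <= p)%E -> (0 <= q)%E -> (p + q < +oo)%E ->
  exists a b : R, p = a%:E /\ q = b%:E.
Proof. by case: p => [a| |] //; case: q => [b| |] // *; exists a, b. Qed.

Lemma splits_of_perimeter A B : finite_perimeter (A `|` B) -> lebesgue_measurable3 A ->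
  lebesgue_measurable3 B -> A `&` B = set0 ->
  perimeter (A `|` B) = (perimeter A + perimeter B)%E -> perimeter_splits A B.
Proof.
move=> [_ fE] mA mB AB E; split => //.
have A0 := perimeter_ge0 _ mA; have B0 := perimeter_ge0 _ mB.
rewrite E in fE; have [a [b [Ea Eb]]] := adde_ge0_lty _ _ A0 B0 fE.
by exists a, b; split => //; rewrite E Ea Eb.
Qed.

Lemma null_sub A B : A `<=` B -> lebesgue3 B = 0%E -> lebesgue3 A = 0%E.
Proof.
move=> AB B0; apply/eqP; rewrite eq_le -[X in (_ <= X)%E && _]B0 le_lebesgue3//=.
Qed.

Lemma null_bigcup (F : nat -> set (space3 R)) :
  (forall n, lebesgue3 (F n) = 0%E) -> lebesgue3 (\bigcup_n F n) = 0%E.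
Proof.
move=> F0; apply/eqP; rewrite eq_le; apply/andP; split; last exact: (measure_ge0 lebesgue3).
have := mu_ext_sigma_subadditive (measure_ge0 (@borel_lebesgue3 R)) F.
move=> /le_trans; apply.
rewrite eseries0// => n _ _; exact: F0.
Qed.

Lemma null_setU A B : lebesgue3 A = 0%E -> lebesgue3 B = 0%E -> lebesgue3 (A `|` B) = 0%E.
Proof.
by move=> A0 B0; rewrite -bigcup2E; apply: null_bigcup => -[|[|n]] //=.
Qed.

(** On the large box either [A] or [B] is null. If [B] were, the small box would be null too,
    although its sides are positive. Overlapping boxes thus pass nullness on. *)
Lemma chain_box A B a b p q : perimeter_splits A B -> obox a b `<=` A `|` B ->
  (forall i, crd i a < crd i b) -> (forall i, crd i p < crd i q) ->
  obox p q `<=` obox a b -> lebesgue3 (A `&` obox p q) = 0%E ->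
  lebesgue3 (A `&` obox a b) = 0%E.
Proof.
move=> sp ab altb pltq pqab A0; have [//|B0] := zero_one A B a b sp ab altb.
have : lebesgue3 (obox p q) = 0%E.
  apply: (null_sub _ ((A `&` obox p q) `|` (B `&` obox a b))); last exact: null_setU.
  by move=> x xpq; have [xA|xB] := ab x (pqab x xpq); [left|right; split=> //; exact: pqab].
rewrite lebesgue3_obox; [|exact: ltW (pltq 0)|exact: ltW (pltq 1)|
  by have := pltq (inord 2); rewrite /crd/= inordK// => /ltW].
move=> [] /eqP; rewrite !mulf_eq0 !subr_eq0.
have := pltq 0; have := pltq 1; have := pltq (inord 2); rewrite /crd/= inordK//= => h2 h1 h0.
by rewrite !gt_eqF.
Qed.

End CombPerimeter.

(** * Indecomposability of the comb and of its complement *)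

Section CombIndecomposable.
Context {R : realType}.
Implicit Types (x y a b : space3 R) (A B E : set (space3 R)) (i : 'I_3).

Lemma box_sides a b : a.1.1 < b.1.1 -> a.1.2 < b.1.2 -> a.2 < b.2 ->
  forall i, crd i a < crd i b.
Proof. by move=> h1 h2 h3; apply: ord3P; rewrite /crd/= ?inordK. Qed.

(** The zero-one law on a single reference box decides which part should vanish; by symmetry it
    remains to spread nullness from that box to all of [E]. *)
Lemma indecomposable_spread E a b : finite_perimeter E -> obox a b `<=` E ->
  (forall i, crd i a < crd i b) ->
  (forall A B, perimeter_splits A B -> A `|` B = E ->
    lebesgue3 (A `&` obox a b) = 0%E -> lebesgue3 A = 0%E) ->
  indecomposable E.
Proof.
move=> fE abE altb h; split => // A B mA mB EAB AB pE.
rewrite EAB in fE pE; have sp := splits_of_perimeter _ _ fE mA mB AB pE.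
have abU : obox a b `<=` A `|` B by rewrite -EAB.
have [A0|B0] := zero_one A B a b sp abU altb; [left|right].
  exact: h sp _ A0.
by apply: h (perimeter_splitsC _ _ sp) _ B0; rewrite setUC.
Qed.

Lemma indecomposable_comb : indecomposable (@comb R).
Proof.
apply: (indecomposable_spread _ (-1, -1, -1) (1, 1, 0)).
- exact: finite_perimeter_comb.
- by move=> x h; left.
- by apply: box_sides => /=; lra.
move=> A B sp EAB A0.
(* The portion of the post below height 0 lies in the slab and starts the chain. *)
have post0 m : lebesgue3 (A `&` post_from (-1) m) = 0%E.
  have [[r0 rm [/= c1 c2 c3] _ _]|E] := @radius_cases R m; last first.
    rewrite (_ : post_from (-1) m = set0); last first.
      by rewrite -subset0 => x /post_radius; rewrite E ltr0N1.
    by rewrite setI0; exact: (measure0 lebesgue3).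
  apply: (chain_box A B _ _ ((tip m).1.1 - radius m, (tip m).1.2 - radius m, -1)
      ((tip m).1.1 + radius m, (tip m).1.2 + radius m, 0) sp).
  - by rewrite EAB => x h; right; exists m.
  - by apply: box_sides => /=; lra.
  - by apply: box_sides => /=; lra.
  - by move=> x [/= h1 h2 h3]; split => //=; lra.
  - apply: null_sub A0; apply: setIS => x h.
    have h' : post_from (-1) m x by case: h => /= h1 h2 h3; split => //=; lra.
    have [h1 h2] := post_square _ _ _ h'; case: h => /= _ _ h3.
    by split => //=; lra.
apply: (null_sub _ ((A `&` slab) `|` \bigcup_m (A `&` post_from (-1) m))).
  move=> x xA; have : comb x by rewrite -EAB; left.
  by case=> [h|[m _ h]]; [left|right; exists m].
by apply: null_setU; [exact: A0|exact: null_bigcup].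
Qed.

Lemma comb_open_cube : @comb R `<=` open_cube.
Proof.
move=> x [[/= h1 h2 h3]|[m _ h]]; first by split; lra.
have [h1 h2] := post_square _ _ _ h; split => //.
have [/= _ _ h3] := post_tip _ _ _ h; case: h => /= _ _ h4; lra.
Qed.

Lemma outside_box a b : (1 <= a.1.1) || (b.1.1 <= -1) || (1 <= a.1.2) || (b.1.2 <= -1)
  || (1 <= a.2) || (b.2 <= -1) -> obox a b `<=` ~` @comb R.
Proof.
move=> h x [/= h1 h2 h3] /comb_open_cube[h4 h5 h6].
by move: h => /orP[/orP[/orP[/orP[/orP[]|]|]|]|]; lra.
Qed.

Lemma above_post m x : csquare m x.1.1 x.1.2 -> (tip m).2 <= x.2 -> 0 <= x.2 ->
  ~ comb x.
Proof.
move=> sx tx x0 [[/= _ _ h]|[n _ h]]; first lra.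
have E := csquare_disjoint _ _ _ _ (post_csquare _ _ _ h) sx.
by rewrite E in h; case: h => /= _ _; lra.
Qed.

Lemma free_setC_comb x : free x.1 -> 0 <= x.2 -> ~ @comb R x.
Proof.
move=> [_ _ xf] x0 [[/= _ _ h]|[n _ h]]; first lra.
by have := xf n; rewrite (post_csquare _ _ _ h).
Qed.

Section Exterior.
Variables (A B : set (space3 R)).
Hypotheses (sp : perimeter_splits A B) (EAB : A `|` B = ~` comb)
  (A0 : lebesgue3 (A `&` obox (-2, -2, 1) (2, 2, 2)) = 0%E).

Let null_box a b p q : obox a b `<=` ~` comb -> obox p q `<=` obox a b ->
  a.1.1 < b.1.1 -> a.1.2 < b.1.2 -> a.2 < b.2 ->
  p.1.1 < q.1.1 -> p.1.2 < q.1.2 -> p.2 < q.2 ->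
  lebesgue3 (A `&` obox p q) = 0%E -> lebesgue3 (A `&` obox a b) = 0%E.
Proof.
move=> ab pqab a1 a2 a3 p1 p2 p3; apply: (chain_box A B a b p q sp) => //.
- by rewrite EAB.
- exact: box_sides.
- exact: box_sides.
Qed.

Let k2 k : 2 <= k.+2%:R :> R. Proof. by rewrite (ler_nat _ 2). Qed.

Lemma exterior_up k : lebesgue3 (A `&` obox (- k.+2%:R, - k.+2%:R, 1) (k.+2%:R, k.+2%:R, k.+2%:R)) = 0%E.
Proof.
have := k2 k; move: k.+2%:R => K K2.
apply: null_box A0 => /=; try lra; first by apply: outside_box; rewrite /= lexx !orbT.
by move=> x [/= h1 h2 h3]; split => /=; lra.
Qed.

Let right_null K : 2 <= K -> lebesgue3 (A `&` obox (1, - K, - K) (K, K, K)) = 0%E.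
Proof.
move=> K2; apply: (null_box _ _ (1, -2, 1) (2, 2, 2)) => /=;
  [| |lra|lra|lra|lra|lra|lra|].
- by apply: outside_box; rewrite /= lexx.
- by move=> x [/= h1 h2 h3]; split => /=; lra.
- by apply: null_sub A0; apply: setIS => x [/= h1 h2 h3]; split => /=; lra.
Qed.

Lemma exterior_sides k (K := k.+2%:R) :
  [/\ lebesgue3 (A `&` obox (1, - K, - K) (K, K, K)) = 0%E,
      lebesgue3 (A `&` obox (- K, - K, - K) (-1, K, K)) = 0%E,
      lebesgue3 (A `&` obox (- K, 1, - K) (K, K, K)) = 0%E,
      lebesgue3 (A `&` obox (- K, - K, - K) (K, -1, K)) = 0%E
    & lebesgue3 (A `&` obox (- K, - K, - K) (K, K, -1)) = 0%E].
Proof.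
have : 2 <= K by exact: k2.
move: K => K K2; split.
- exact: right_null.
- apply: (null_box _ _ (-2, -2, 1) (-1, 2, 2)) => /=;
  [| |lra|lra|lra|lra|lra|lra|].
  + by apply: outside_box; rewrite /= lexx !orbT.
  + by move=> x [/= h1 h2 h3]; split => /=; lra.
  + by apply: null_sub A0; apply: setIS => x [/= h1 h2 h3]; split => /=; lra.
- apply: (null_box _ _ (-2, 1, 1) (2, 2, 2)) => /=;
  [| |lra|lra|lra|lra|lra|lra|].
  + by apply: outside_box; rewrite /= lexx !orbT.
  + by move=> x [/= h1 h2 h3]; split => /=; lra.
  + by apply: null_sub A0; apply: setIS => x [/= h1 h2 h3]; split => /=; lra.
- apply: (null_box _ _ (-2, -2, 1) (2, -1, 2)) => /=;
  [| |lra|lra|lra|lra|lra|lra|].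
  + by apply: outside_box; rewrite /= lexx !orbT.
  + by move=> x [/= h1 h2 h3]; split => /=; lra.
  + by apply: null_sub A0; apply: setIS => x [/= h1 h2 h3]; split => /=; lra.
(* The region below the cube misses the reference box above it and is reached through the region on
   the right. *)
- apply: (null_box _ _ (1, -2, -2) (2, 2, -1)) => /=;
  [| |lra|lra|lra|lra|lra|lra|].
  + by apply: outside_box; rewrite /= lexx !orbT.
  + by move=> x [/= h1 h2 h3]; split => /=; lra.
  + apply: null_sub (right_null 2 (lexx 2)); apply: setIS => x [/= h1 h2 h3].
    by split => /=; lra.
Qed.

Definition over m : set (space3 R) :=
  obox ((tip m).1.1 - radius m, (tip m).1.2 - radius m, (tip m).2)
       ((tip m).1.1 + radius m, (tip m).1.2 + radius m, 2).

Lemma over_csquare m x : over m x -> csquare m x.1.1 x.1.2.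
Proof.
move=> [/= h1 h2 _]; rewrite /csquare /in_csquare !ler_distl -/(tip m) -/(radius m).
by apply/andP; split; lra.
Qed.

(** No other post stands over this square, so the column over the top face is one box outside the
    comb, and its portion above height 1 lies in the reference box. *)
Lemma over_null m : lebesgue3 (A `&` over m) = 0%E.
Proof.
have [[r0 rm [/= c1 c2 c3] cs _]|E] := @radius_cases R m; last first.
  rewrite (_ : over m = set0); last first.
    by rewrite -subset0 => x [/= h _ _]; rewrite E in h; lra.
  by rewrite setI0; exact: (measure0 lebesgue3).
apply: (null_box _ _ ((tip m).1.1 - radius m, (tip m).1.2 - radius m, 1)
    ((tip m).1.1 + radius m, (tip m).1.2 + radius m, 2)) => /=;
  [| |lra|lra|lra|lra|lra|lra|].
- move=> x h; have sx := over_csquare _ _ h; case: h => /= _ _ h3.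
  by apply: (above_post m) => //; lra.
- by move=> x [/= h1 h2 h3]; split => //=; lra.
- apply: null_sub A0; apply: setIS => x h.
  have : over m x by case: h => /= h1 h2 h3; split => //=; lra.
  by move=> /over_csquare/cs[h1 h2]; case: h => /= _ _ h3; split => /=; lra.
Qed.

End Exterior.
End CombIndecomposable.

(** * Columns over no square *)

Section FreeColumns.
Context {R : realType}.
Implicit Types (x y a b : space3 R) (A B E : set (space3 R)) (i : 'I_3).

Notation i2 := (inord 2 : 'I_3).

(** The squared horizontal distance to the n-th closed square. For the default radius -1 it is
    positive everywhere, in accordance with an empty square. *)
Definition rho n x : R :=
  (pos ((tip n).1.1 - radius n - crd 0 x) ^+ 2 + pos (crd 0 x - ((tip n).1.1 + radius n)) ^+ 2) +
  (pos ((tip n).1.2 - radius n - crd 1 x) ^+ 2 + pos (crd 1 x - ((tip n).1.2 + radius n)) ^+ 2).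

Lemma rho_ge0 n x : 0 <= rho n x.
Proof. by rewrite !addr_ge0 ?sqr_ge0. Qed.

Lemma C1_rho n : C1 (rho n).
Proof.
apply: C1D; apply: C1D.
- exact: (C1_crd (fun t => pos ((tip n).1.1 - radius n - t) ^+ 2) _ 0 (C1R_posN _)).
- exact: (C1_crd (fun t => pos (t - ((tip n).1.1 + radius n)) ^+ 2) _ 0 (C1R_pos _)).
- exact: (C1_crd (fun t => pos ((tip n).1.2 - radius n - t) ^+ 2) _ 1 (C1R_posN _)).
- exact: (C1_crd (fun t => pos (t - ((tip n).1.2 + radius n)) ^+ 2) _ 1 (C1R_pos _)).
Qed.

Lemma rho_eq0 n x : rho n x = 0 <-> csquare n x.1.1 x.1.2.
Proof.
have P (t : R) : (pos t ^+ 2 == 0) = (t <= 0) by rewrite sqrf_eq0 /pos eq_maxr.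
rewrite /csquare /in_csquare -/(tip n) -/(radius n) !ler_distl; split => [/eqP|].
  rewrite /rho !paddr_eq0 ?addr_ge0 ?sqr_ge0// !P !subr_le0 => /andP[/andP[-> ->] /andP[-> ->]].
  by [].
move=> /andP[/andP[h1 h2] /andP[h3 h4]]; apply/eqP.
by rewrite /rho !paddr_eq0 ?addr_ge0 ?sqr_ge0// !P !subr_le0 h1 h2 h3 h4.
Qed.

Definition square_cut : space3 R -> R := cut i2 (-1, -1, 0) (1, 1, 0).

Lemma square_cut_gt0 x : 0 < square_cut x <-> -1 < x.1.1 < 1 /\ -1 < x.1.2 < 1.
Proof.
rewrite cut_gt0; split => [h|[h1 h2]].
  by split; [apply: (h 0)|apply: (h 1)]; rewrite -val_eqE/= inordK.
by apply: ord3P => //; rewrite eqxx.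
Qed.

(** A C1 function of the horizontal coordinates. As [K] grows it tends to the indicator of the open
    square minus the first [N] closed squares, and then, as [N] grows, to that of [free_cyl]. The
    flux bound depends on [N] alone, hence this order of limits. *)
Definition mask (N K : nat) x : R := sat K (square_cut x) * \prod_(n < N) sat K (rho n x).
Definition mask_lim (N : nat) x : R :=
  (0 < square_cut x)%R%:R * \prod_(n < N) (0 < rho n x)%R%:R.
Definition free_cyl : set (space3 R) := [set x | free x.1].

Lemma mask_bounds N K x : 0 <= mask N K x <= 1.
Proof.
have /andP[s0 s1] := sat_bounds K _ (cut_ge0 i2 (-1, -1, 0) (1, 1, 0) x).
have p0 : 0 <= \prod_(n < N) sat K (rho n x).
  by apply: prodr_ge0 => n _; have /andP[] := sat_bounds K _ (rho_ge0 n x).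
apply/andP; split; first exact: mulr_ge0.
apply: mulr_ile1 => //; apply: prodr_ile1 => n _; exact: sat_bounds (rho_ge0 n x).
Qed.

Lemma C1_mask N K : C1 (mask N K).
Proof.
apply: C1M; first by apply: C1_sat; [exact: C1_cut|exact: cut_ge0].
elim: N => [|N ih].
  by under eq_fun do rewrite big_ord0; exact: C1_cst.
under eq_fun do rewrite big_ord_recr/=.
by apply: C1M => //; apply: C1_sat; [exact: C1_rho|exact: rho_ge0].
Qed.

Lemma mask_indep N K x t : mask N K (setc i2 x t) = mask N K x.
Proof.
rewrite /mask /square_cut cut_indep; congr (_ * _); apply: eq_bigr => n _.
by rewrite /rho !crd_setc -!val_eqE/= inordK.
Qed.

Lemma mask_off N K x : square_cut x = 0 -> mask N K x = 0.
Proof. by move=> h; rewrite /mask h sat0 mul0r. Qed.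

Lemma mask_csquare N K n x : (n < N)%N -> csquare n x.1.1 x.1.2 -> mask N K x = 0.
Proof.
move=> nN /rho_eq0 h; rewrite /mask (bigD1 (Ordinal nN))//= h sat0 mul0r mulr0 //.
Qed.

Lemma cvg_mask N x : mask N K x @[K --> \oo] --> mask_lim N x.
Proof.
apply: cvgM; first exact: cvg_sat (cut_ge0 _ _ _ _).
elim: N => [|N ih]; first by rewrite big_ord0; under eq_fun do rewrite big_ord0; exact: cvg_cst.
rewrite big_ord_recr/=; under eq_fun do rewrite big_ord_recr/=.
by apply: cvgM => //; exact: cvg_sat (rho_ge0 _ _).
Qed.

Lemma cvg_mask_lim x : mask_lim N x @[N --> \oo] --> (\1_free_cyl x : R).
Proof.
rewrite indicE; have [xf|xf] := pselect (free x.1).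
  rewrite mem_set//; under eq_fun => N.
    rewrite /mask_lim.
    have -> : 0 < square_cut x by case: xf => *; apply/square_cut_gt0.
    rewrite big1 ?mulr1; last first.
      move=> n _; rewrite lt_neqAle eq_sym rho_ge0 andbT.
      by have [_ _ /(_ n)] := xf; case: eqP => // /rho_eq0 ->.
    over.
  exact: cvg_cst.
rewrite memNset//.
have [c0|c0] := pselect (0 < square_cut x); last first.
  under eq_fun do rewrite /mask_lim (negbTE (introN idP c0)) mul0r.
  exact: cvg_cst.
have [n hn] : exists n, csquare n x.1.1 x.1.2.
  apply: contrapT => /forallNP h; apply: xf; have /square_cut_gt0[h1 h2] := c0.
  by split => // n; apply/negP; exact: h.
apply: cvg_near_cst; exists n.+1 => // N /= nN.
by rewrite /mask_lim (bigD1 (Ordinal nN))//= (rho_eq0 n x).2// ltxx mul0r mulr0.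
Qed.

Section Profile.
Variable M : nat.

Let m02 : R := 2 - 0 - slope 0 2 M.
Let m23 : R := 3 - 2 - slope 2 3 M.

(** It climbs over ]0, 2[, the range under study, and returns to 0 over ]2, 3[, where [A] is null;
    the weights are the areas of the two trapezoids. *)
Definition profile (t : R) : R := m23 * ramp 0 2 M t + (- m02) * ramp 2 3 M t.
Definition profile' (t : R) : R := m23 * trap 0 2 M t + (- m02) * trap 2 3 M t.

Lemma C1R_profile : C1R profile profile'.
Proof. by apply: C1RD; apply: C1RZ; exact: C1R_ramp. Qed.

Let l02 : (0 : R) < 2. Proof. lra. Qed.
Let l23 : (2 : R) < 3. Proof. lra. Qed.

Let m02_bounds : 0 <= m02 <= 2.
Proof.
have := slope_gt0 0 2 M l02; have := slope_le 0 2 M l02.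
by rewrite /m02; move: (slope _ _ _) => s; lra.
Qed.

Lemma m23_bounds : 0 < m23 <= 1.
Proof.
have := slope_gt0 2 3 M l23; have := slope_le 2 3 M l23.
by rewrite /m23; move: (slope _ _ _) => s; lra.
Qed.

Lemma profile'_bound t : `|profile' t| <= 3.
Proof.
have := trap_bounds 0 2 M t l02; have := trap_bounds 2 3 M t l23.
have := m02_bounds; have := m23_bounds; rewrite /profile'.
move: m02 m23 (trap _ _ _ _) (trap _ _ _ _) => a b p q ? ? ? ?.
by rewrite ler_norml; nra.
Qed.

Lemma profile_off t : ~ (0 < t < 3) -> profile t = 0.
Proof.
move=> ht; rewrite /profile; have [tu|ut] := leP t 0.
  rewrite (ramp_left 0 2 M t l02 tu) (ramp_left 2 3 M t l23) ?mulr0 ?addr0//.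
  exact: le_trans tu (ltW l02).
have vt : 3 <= t by rewrite leNgt; apply/negP => ?; apply: ht; rewrite ut.
rewrite (ramp_right 2 3 M t l23 vt) (ramp_right 0 2 M t l02); last exact: le_trans (ltW l23) vt.
by rewrite -/m02 -/m23 mulNr mulrC subrr.
Qed.

Lemma profile'_off t : ~ (0 < t < 3) -> profile' t = 0.
Proof.
move=> ht; rewrite /profile' !trap_off ?mulr0 ?addr0//.
  by move=> h; apply: ht; lra.
by move=> h; apply: ht; lra.
Qed.

(** A derivative of size at most 3 over a length of at most 3, starting from 0. *)
Lemma profile_bound t : `|profile t| <= 9.
Proof.
have [t03|/profile_off ->] := pselect (0 < t < 3); last by rewrite normr0.
have := lipschitz_line profile profile' 3 0 t (C1R_profile.1) (fun s _ => profile'_bound s).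
rewrite (profile_off 0); last by rewrite ltxx.
rewrite !subr0 => /le_trans; apply; rewrite gtr0_norm; lra.
Qed.

End Profile.

End FreeColumns.

Section FreeColumnsNull.
Context {R : realType}.
Implicit Types (x y a b : space3 R) (f g : space3 R -> R) (i : 'I_3).

Notation i2 := (inord 2 : 'I_3).

Lemma int3_zero (A : set (space3 R)) f : (forall x, A x -> f x = 0) -> int3 A f = 0.
Proof.
by move=> f0; rewrite -(@int3_sub _ set0)// ?Rintegral_set0// => x xA _; exact: f0.
Qed.

Lemma bounded_supp_cvg (M : R) (f_ : nat -> space3 R -> R) f :
  (forall n, bounded_supp M (f_ n)) -> (forall x, f_ n x @[n --> \oo] --> f x) ->
  bounded_supp M f.
Proof.
move=> bf cf; split.
- apply: (@measurable_fun_cvg _ (B3 R) R setT f_ f); first by move=> n; have [] := bf n.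
  by move=> x _; exact: cf.
- move=> x; apply: (cvgr_to_le (cvg_norm (cf x))).
  by apply: nearW => n; have [_ h _] := bf n; exact: h.
- move=> x xM; rewrite -(cvg_lim (@Rhausdorff R) (cf x)).
  apply: lim_near_cst => //; apply: nearW => n; have [_ _ h] := bf n; exact: h.
Qed.

Lemma open_gt0 f : continuous f -> open [set x | 0 < f x].
Proof. by move=> cf; apply: (@open_comp _ _ f [set t | 0 < t]) => // x _; exact: cf. Qed.

Lemma measurable_free_cyl : measurable (@free_cyl R : set (B3 R)).
Proof.
have -> : @free_cyl R = [set x | 0 < square_cut x] `&` \bigcap_n [set x | 0 < rho n x].
  rewrite predeqE => x; split => [[h1 h2 h3]|[/square_cut_gt0[h1 h2] h3]].
    split; first exact/square_cut_gt0.
    move=> n _; rewrite /= lt_neqAle eq_sym rho_ge0 andbT; apply/eqP => /rho_eq0.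
    exact/negP/h3.
  split => // n; apply/negP => /rho_eq0 h; have := h3 n I.
  by rewrite /= h ltxx.
apply: measurableI.
  by apply: measurable_open3; apply: open_gt0; exact: C1_continuous (C1_cut _ _ _).
apply: bigcapT_measurable => n; apply: measurable_open3; apply: open_gt0.
exact: C1_continuous (C1_rho n).
Qed.

Lemma square_cut_off x : ~ (-1 < x.1.1 < 1 /\ -1 < x.1.2 < 1) -> square_cut x = 0.
Proof.
move=> h; apply/eqP; rewrite eq_le cut_ge0 andbT leNgt; apply/negP => /square_cut_gt0.
exact: h.
Qed.

Lemma bounded_supp_column (g : space3 R -> R) (q : R -> R) : (forall x, 0 <= g x <= 1) ->
  (forall x, square_cut x = 0 -> g x = 0) -> measurable_fun setT (g : B3 R -> R) ->
  continuous q -> (forall t, `|q t| <= 3) -> (forall t, ~ (0 < t < 3) -> q t = 0) ->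
  bounded_supp 3 (fun x => g x * q (crd i2 x)).
Proof.
move=> g01 g0 mg cq q3 q0; split.
- apply: measurable_funM => //; apply: continuous_measurable3 => x.
  by apply: (@continuous_comp _ _ _ (crd i2) q); [exact: continuous_crd|exact: cq].
- move=> x; rewrite normrM; have /andP[h0 h1] := g01 x; rewrite ger0_norm//.
  by rewrite -[leRHS]mul1r ler_pM.
- move=> x xM; have [h|h] := pselect (0 < crd i2 x < 3); last by rewrite q0// mulr0.
  rewrite g0 ?mul0r//; apply: square_cut_off => -[h1 h2]; apply: xM.
  by move: h; rewrite /crd/= inordK//= => h; split => /=; lra.
Qed.

Section Null.
Variables (A B : set (space3 R)).
Hypotheses (sp : perimeter_splits A B) (EAB : A `|` B = ~` comb)
  (A0 : lebesgue3 (A `&` obox (-2, -2, 1) (2, 2, 2)) = 0%E).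

Section Psi.
Variable M : nat.

Definition psi N K x : R := mask N K x * profile M (crd i2 x).

Let pC N K : C1 (psi N K).
Proof. by apply: C1M; [exact: C1_mask|exact: C1_crd (C1R_profile M)]. Qed.

Let p3 N K : csupp 3 (psi N K).
Proof.
move=> x xM; rewrite /psi; have [h|h] := pselect (0 < crd i2 x < 3); last by rewrite profile_off// mulr0.
rewrite mask_off ?mul0r//; apply: square_cut_off => -[h1 h2]; apply: xM.
by move: h; rewrite /crd/= inordK//= => h; split => /=; lra.
Qed.

Let p9 N K x : `|psi N K x| <= 9.
Proof.
have /andP[h0 h1] := mask_bounds N K x.
by rewrite normrM ger0_norm// -[leRHS]mul1r ler_pM// profile_bound.
Qed.

Let d_psi N K : 'd_i2 (psi N K) = fun x => mask N K x * profile' M (crd i2 x).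
Proof.
apply/funext => x.
apply: etrans (derive3M _ _ i2 x (C1_mask N K) (C1_crd _ _ i2 (C1R_profile M))) _.
have -> : 'd_i2 (mask N K) x = 0 by apply: derive_indep => t; exact: mask_indep.
have [_ ->] := derive_crd _ _ i2 i2 x (C1R_profile M).
by rewrite eqxx mul1r mulr0 addr0.
Qed.

(* psi vanishes on the slab and on the first N posts, which leaves a geometric tail *)
Let psi_flux N K X : test_field X ->
  int3 (A `|` B) ('d_i2 (fun x => (9^-1 * psi N K x) ^+ 2 * crd i2 (X x))) <= 2 * 2^-1 ^+ N.
Proof.
move=> tX; have [XC _ _] := (test_fieldP X).1 tX.
pose q x := 9^-1 * psi N K x.
have qC : C1 q by exact: C1Z.
have q2C : C1 (fun x => q x ^+ 2) by exact: C1M.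
pose f x := q x ^+ 2 * crd i2 (X x).
have fC : C1 f by exact: C1M q2C (XC i2).
have f3 : csupp 3 f by move=> x xM; rewrite /f /q p3// mulr0 expr0n mul0r.
have q1 x : `|q x| <= 1.
  by rewrite normrM gtr0_norm ?invr_gt0// ler_pdivrMl// mulr1; exact: p9.
have f1 x : `|f x| <= 1.
  rewrite normrM normrX -[leRHS]mul1r; apply: ler_pM => //.
    by rewrite expr_le1//; exact: q1.
  exact: test_field_le1.
have df0 x : psi N K x = 0 -> 'd_i2 f x = 0.
  move=> h; have qx : q x = 0 by rewrite /q h mulr0.
  apply: etrans (derive3M _ _ i2 x q2C (XC i2)) _.
  have -> : 'd_i2 (fun x => q x ^+ 2) x = 0.
    by apply: etrans (derive3M _ _ i2 x qC qC) _; rewrite qx !mul0r addr0.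
  by rewrite qx expr0n mul0r mulr0 addr0.
rewrite EAB (comb_flux_setC _ _ _ fC f3).
apply: (le_trans (ler_norm _)); rewrite normrN.
have [n [_ /(_ i2) bd]] := C1_bounded _ _ fC f3.
rewrite (int3_comb _ _ bd); apply: (int3_bigcup_le _ _ _ _ bd measurable_piece trivIset_piece).
case=> [|k]; first by rewrite big_ord0 mulr_ge0// exprn_ge0.
rewrite big_ord_recl/= (_ : int3 slab _ = 0).
  rewrite normr0 add0r; apply: le_trans (geometric_tail N k); apply: ler_sum => j _.
  case: ltnP => jN; last exact: piece_flux fC f3 f1.
  rewrite [int3 _ _]int3_zero ?normr0// => x /post_csquare xj; apply: df0.
  by rewrite /psi (mask_csquare N K j)// mul0r.
apply: int3_zero => x [_ _ /= h]; apply: df0; rewrite /psi profile_off ?mulr0//.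
by rewrite /crd/= inordK//=; lra.
Qed.

(** For fixed [t] the calibration has error [2 * 2^-1 ^+ N] uniformly in [K]. Letting [K] and then
    [N] tend to infinity removes it, and the remaining inequality between a linear and a quadratic
    term in [t] forces the integral to be 0. *)
Let int3_free_profile : int3 A (fun x => \1_(@free_cyl R) x * profile' M (crd i2 x)) = 0.
Proof.
have [mA _ _ [p [_ [hA _ _]]]] := sp.
have h N K t : t * int3 A (fun x => mask N K x * profile' M (crd i2 x)) <= 9 * (2 * 2^-1 ^+ N + t ^+ 2 * p).
  rewrite -d_psi; apply: (calibration_scaled A B (psi N K) i2 3 9 t _ p sp hA (pC N K) (p3 N K)) => //.
  - by rewrite ler1n.
  - exact: psi_flux.
have cp' : continuous (profile' M : R -> R) by exact: (C1R_profile M).2.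
have bNK N K : bounded_supp 3 (fun x => mask N K x * profile' M (crd i2 x)).
  apply: bounded_supp_column => //.
  - exact: mask_bounds.
  - exact: mask_off.
  - by apply: continuous_measurable3; exact: C1_continuous (C1_mask N K).
  - exact: profile'_bound.
  - exact: profile'_off.
have cNK N x : mask N K x * profile' M (crd i2 x) @[K --> \oo] --> mask_lim N x * profile' M (crd i2 x).
  by apply: cvgM; [exact: cvg_mask|exact: cvg_cst].
have bN N := bounded_supp_cvg _ _ _ (bNK N) (cNK N).
have cN x : mask_lim N x * profile' M (crd i2 x) @[N --> \oo] --> \1_(@free_cyl R) x * profile' M (crd i2 x).
  by apply: cvgM; [exact: cvg_mask_lim|exact: cvg_cst].
have bl := bounded_supp_cvg _ _ _ bN cN.
have h2 N t : t * int3 A (fun x => mask_lim N x * profile' M (crd i2 x)) <= 9 * (2 * 2^-1 ^+ N + t ^+ 2 * p).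
  have c : t * int3 A (fun x => mask N K x * profile' M (crd i2 x)) @[K --> \oo] -->
      t * int3 A (fun x => mask_lim N x * profile' M (crd i2 x)).
    by apply: cvgM; [exact: cvg_cst|exact: int3_dominated (bNK N) (bN N) (cNK N)].
  by apply: (cvgr_to_le c); apply: nearW => K; exact: h.
apply: (@quad_eq0 _ _ (9 * p)) => t.
have c : t * int3 A (fun x => mask_lim N x * profile' M (crd i2 x)) @[N --> \oo] -->
    t * int3 A (fun x => \1_(@free_cyl R) x * profile' M (crd i2 x)).
  by apply: cvgM; [exact: cvg_cst|exact: int3_dominated bN bl cN].
have c' : 9 * (2 * 2^-1 ^+ N + t ^+ 2 * p) @[N --> \oo] --> t ^+ 2 * (9 * p).
  rewrite (_ : t ^+ 2 * (9 * p) = 9 * (2 * 0 + t ^+ 2 * p)); last by ring.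
  apply: cvgM; first exact: cvg_cst.
  apply: cvgD; last exact: cvg_cst.
  apply: cvgM; first exact: cvg_cst.
  by apply: cvg_expr; rewrite ger0_norm; lra.
by apply: (ler_cvg_to c c'); apply: nearW => N; exact: h2.
Qed.

Lemma int3_free_trap : int3 A (fun x => \1_(@free_cyl R) x * trap 0 2 M (crd i2 x)) = 0.
Proof.
have [mA _ _ _] := sp; have l02 : (0 : R) < 2 by lra. have l23 : (2 : R) < 3 by lra.
(* Between heights 2 and 3 the free columns meet [A] only in this null set, so the returning half of
   [profile'] drops out. The index 1 below stands for half side 3. *)
pose N0 : set (space3 R) := A `&` obox (-3, -3, 1) (3, 3, 3).
have N00 : lebesgue3 N0 = 0%E by have := exterior_up A B sp EAB A0 1.
have mN0 : lebesgue_measurable3 N0.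
  by apply: (@measurableI _ (L3 R)) => //; exact: lebesgue_measurable3_obox.
have ct : continuous (trap 0 2 M : R -> R) by exact: (C1R_ramp 0 2 M).2.
have cp' : continuous (profile' M : R -> R) by exact: (C1R_profile M).2.
have f01 x : 0 <= (\1_(@free_cyl R) x : R) <= 1 by rewrite indicE; case: (_ \in _); rewrite ?lexx ?ler01.
have f0 x : square_cut x = 0 -> \1_(@free_cyl R) x = 0 :> R.
  move=> h; rewrite indicE memNset// => -[h1 h2 _].
  by move/square_cut_gt0 : (conj h1 h2); rewrite h ltxx.
have mf : measurable_fun setT (\1_(@free_cyl R) : B3 R -> R).
  by apply: measurable_indic; exact: measurable_free_cyl.
have bt : bounded_supp 3 (fun x => \1_(@free_cyl R) x * trap 0 2 M (crd i2 x)).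
  apply: bounded_supp_column => //.
  - move=> t; have /andP[h0 h1] := trap_bounds 0 2 M t l02.
    by rewrite ger0_norm//; lra.
  - by move=> t h; apply: trap_off => // ?; apply: h; lra.
have bp : bounded_supp 3 (fun x => \1_(@free_cyl R) x * profile' M (crd i2 x)).
  apply: bounded_supp_column => //.
  - exact: profile'_bound.
  - exact: profile'_off.
have /andP[s0 s1] := @m23_bounds R M.
have := int3_free_profile; rewrite (int3_null mA mN0 N00 bp) (int3_null mA mN0 N00 bt).
rewrite (_ : int3 _ _ = int3 (A `\` N0) (fun x => (3 - 2 - slope 2 3 M) *
    (\1_(@free_cyl R) x * trap 0 2 M (crd i2 x)))).
  rewrite (int3Z _ _ bt); last by apply: (@measurableD _ (L3 R)).
  by move=> /eqP; rewrite mulf_eq0 gt_eqF//= => /eqP.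
apply: eq_Rintegral => x; rewrite inE => -[xA xN].
have [xf|xf] := pselect (free_cyl x); last by rewrite indicE memNset// !mul0r mulr0.
rewrite /profile' (trap_off 2 3) ?mulr0 ?addr0 1?mulrCA// => h; apply: xN; split => //.
case: xf => h1 h2 _; move: h; rewrite /crd/= inordK//= => h; split => /=; lra.
Qed.

End Psi.

(** As [M] grows, the trapezoids increase to the indicator of ]0, 2[ and the integrals, all 0,
    converge to the measure of the set. *)
Lemma free_columns_null : lebesgue3 (A `&` [set x | free x.1 /\ 0 < x.2 < 2]) = 0%E.
Proof.
have [mA _ _ _] := sp; have l02 : (0 : R) < 2 by lra.
set P := [set x | _].
have PE : P = @free_cyl R `&` [set x | 0 < crd i2 x < 2].
  by rewrite predeqE => x; rewrite /P /free_cyl /crd/= inordK.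
have mP : measurable (P : set (B3 R)).
  rewrite PE; apply: measurableI; first exact: measurable_free_cyl.
  have -> : [set x : space3 R | 0 < crd i2 x < 2] = [set x | 0 < crd i2 x] `&` [set x | 0 < 2 - crd i2 x].
    rewrite predeqE => x; split => /= [/andP[h1 h2]|[h1]].
      by rewrite subr_gt0.
    by rewrite subr_gt0 h1 => ->.
  apply: measurableI; apply: measurable_open3; apply: open_gt0; first exact: continuous_crd.
  by move=> x; apply: cvgB; [exact: cvg_cst|exact: continuous_crd].
have mP' := lebesgue_measurable3_borel _ mP.
have P3 : P `<=` cube 3 by move=> x [[h1 h2 _] h3]; split => /=; lra.
have f01 x : 0 <= (\1_(@free_cyl R) x : R) <= 1 by rewrite indicE; case: (_ \in _); rewrite ?lexx ?ler01.
have f0 x : square_cut x = 0 -> \1_(@free_cyl R) x = 0 :> R.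
  move=> h; rewrite indicE memNset// => -[h1 h2 _].
  by move/square_cut_gt0 : (conj h1 h2); rewrite h ltxx.
have mf : measurable_fun setT (\1_(@free_cyl R) : B3 R -> R).
  by apply: measurable_indic; exact: measurable_free_cyl.
have bt M : bounded_supp 3 (fun x => \1_(@free_cyl R) x * trap 0 2 M (crd i2 x)).
  have ct : continuous (trap 0 2 M : R -> R) by exact: (C1R_ramp 0 2 M).2.
  apply: bounded_supp_column => //.
  - move=> t; have /andP[h0 h1] := trap_bounds 0 2 M t l02.
    by rewrite ger0_norm//; lra.
  - by move=> t h; apply: trap_off => // ?; apply: h; lra.
have c x : \1_(@free_cyl R) x * trap 0 2 M (crd i2 x) @[M --> \oo] --> (\1_P x : R).
  rewrite (_ : \1_P x = \1_(@free_cyl R) x * \1_`]0, 2[%classic (crd i2 x)).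
    by apply: cvgM; [exact: cvg_cst|exact: cvg_trap].
  rewrite !indicE -natrM mulnb PE; congr (_ %:R); congr nat_of_bool.
  by rewrite in_setI; congr (_ && _); apply/idP/idP; rewrite !inE/= in_itv.
have bl := bounded_supp_cvg _ _ _ bt c.
have := int3_dominated _ mA bt bl c.
under eq_fun do rewrite int3_free_trap.
move=> H; have := cvg_unique (@Rhausdorff R) H (cvg_cst _).
rewrite int3_indic// => f00.
rewrite -[LHS]fineK ?f00// ge0_fin_numE; last exact: (measure_ge0 lebesgue3).
apply: (@le_lt_trans _ _ (lebesgue3 (cube 3 : set (space3 R)))).
  by apply: le_lebesgue3 => x [_ /P3].
by rewrite lebesgue3_cube// ltry.
Qed.

End Null.
End FreeColumnsNull.

(** * The complement of the comb, and saturation *)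

Section ComplementIndecomposable.
Context {R : realType}.
Implicit Types (x y a b p q : space3 R) (A B E C : set (space3 R)) (i : 'I_3).

Let plane i (c : R) : set (space3 R) := [set x | crd i x = c].

Let plane_null i c : lebesgue3 (plane i c) = 0%E.
Proof. by have [] := @hyperplane_null R i c. Qed.

Let cube_planes : set (space3 R) :=
  plane 0 1 `|` plane 0 (-1) `|` (plane 1 1 `|` plane 1 (-1)) `|`
  (plane (inord 2) 1 `|` plane (inord 2) (-1) `|` plane (inord 2) 0).

Let post_planes m : set (space3 R) :=
  plane 0 ((tip m).1.1 - radius m) `|` plane 0 ((tip m).1.1 + radius m) `|`
  (plane 1 ((tip m).1.2 - radius m) `|` plane 1 ((tip m).1.2 + radius m)) `|`
  plane (inord 2) (tip m).2.

Let exterior k : set (space3 R) := let K := k.+2%:R in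
  obox (- K, - K, 1) (K, K, K) `|` obox (- K, - K, - K) (K, K, -1) `|`
  (obox (1, - K, - K) (K, K, K) `|` obox (- K, - K, - K) (-1, K, K)) `|`
  (obox (- K, 1, - K) (K, K, K) `|` obox (- K, - K, - K) (K, -1, K)).

Let exterior_cover x : (1 < x.2) || (x.2 < -1) || (1 < x.1.1) || (x.1.1 < -1) ||
  (1 < x.1.2) || (x.1.2 < -1) -> exists k, exterior k x.
Proof.
move=> h.
pose k := maxn (Num.bound `|x.1.1|) (maxn (Num.bound `|x.1.2|) (Num.bound `|x.2|)).
have H (t : R) : (Num.bound `|t| <= k)%N -> - k.+2%:R < t < k.+2%:R.
  move=> tm; rewrite -ltr_norml; apply: lt_le_trans (archi_boundP (normr_ge0 _)) _.
  by rewrite ler_nat (leq_trans tm)// ltnW.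
have h1 : - k.+2%:R < x.1.1 < k.+2%:R by apply: H; rewrite !leq_max leqnn.
have h2 : - k.+2%:R < x.1.2 < k.+2%:R by apply: H; rewrite !leq_max leqnn orbT.
have h3 : - k.+2%:R < x.2 < k.+2%:R by apply: H; rewrite !leq_max leqnn !orbT.
exists k; rewrite /exterior /=; move: k.+2%:R h1 h2 h3 => K /andP[a1 b1] /andP[a2 b2] /andP[a3 b3].
move: h => /orP[/orP[/orP[/orP[/orP[]|]|]|]|] h.
- by left; left; left; split => /=; lra.
- by left; left; right; split => /=; lra.
- by left; right; left; split => /=; lra.
- by left; right; right; split => /=; lra.
- by right; left; split => /=; lra.
- by right; right; split => /=; lra.
Qed.

(** Up to the null planes that carry the faces of the cube, the slab and the posts, a point of the
    complement is outside the cube, over the top of a post, or in a free column. *)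
Lemma indecomposable_setC_comb : indecomposable (~` @comb R).
Proof.
apply: (indecomposable_spread _ (-2, -2, 1) (2, 2, 2)).
- exact: finite_perimeter_setC_comb.
- by apply: outside_box; rewrite /= lexx !orbT.
- by apply: box_sides => /=; lra.
move=> A B sp EAB A0.
apply: (null_sub _ ((\bigcup_k (A `&` exterior k)) `|` (\bigcup_m (A `&` over m)) `|`
  ((A `&` [set x | free x.1 /\ 0 < x.2 < 2]) `|` (cube_planes `|` \bigcup_m post_planes m)))); last first.
  apply: null_setU; apply: null_setU.
  - apply: null_bigcup => k; have U := exterior_up A B sp EAB A0 k.
    have [r1 r2 r3 r4 r5] := exterior_sides A B sp EAB A0 k.
    by rewrite /exterior !setIUr; do 3?apply: null_setU.
  - by apply: null_bigcup => m; exact: over_null sp EAB A0 m.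
  - exact: free_columns_null sp EAB A0.
  - apply: null_setU; first by do 4?apply: null_setU.
    by apply: null_bigcup => m; do 4?apply: null_setU.
move=> x xA; have xc : ~ comb x.
  by move=> xc; have : (~` comb) x by [rewrite -EAB; left]; exact.
have [xP|xP] := pselect (cube_planes x); first by right; right; left.
have [[m xm]|xpp] := pselect (exists m, post_planes m x); first by right; right; right; exists m.
have [xe|xe] := boolP ((1 < x.2) || (x.2 < -1) || (1 < x.1.1) || (x.1.1 < -1) ||
  (1 < x.1.2) || (x.1.2 < -1)).
  by left; left; have [k xk] := exterior_cover x xe; exists k.
move: xe; rewrite !negb_or -!leNgt => /andP[/andP[/andP[/andP[/andP[a1 a2] a3] a4] a5] a6].
(* Points on the exceptional planes are gone, so every weak inequality becomes strict. *)
have ne (u v : R) : u <= v -> u <> v -> u < v by rewrite lt_neqAle => -> /eqP ->.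
have b1 : x.2 < 1 by apply: ne => // h; apply: xP; right; left; left; rewrite /plane/= /crd/= inordK.
have b2 : -1 < x.2 by apply: ne => // h; apply: xP; right; left; right; rewrite /plane/= /crd/= inordK.
have b3 : x.1.1 < 1 by apply: ne => // h; apply: xP; left; left; left.
have b4 : -1 < x.1.1 by apply: ne => // h; apply: xP; left; left; right.
have b5 : x.1.2 < 1 by apply: ne => // h; apply: xP; left; right; left.
have b6 : -1 < x.1.2 by apply: ne => // h; apply: xP; left; right; right.
have b7 : 0 < x.2.
  apply: ne; last by move=> h; apply: xP; right; right; rewrite /plane/= /crd/= inordK.
  rewrite leNgt; apply/negP => h; apply: xc; left; split => /=; apply/andP; split=> //.
have [[m sm]|nsq] := pselect (exists m, csquare m x.1.1 x.1.2); last first.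
  right; left; split => //; split; last by apply/andP; split => //; lra.
  split; [by apply/andP|by apply/andP|move=> m; apply/negP => h; apply: nsq; by exists m].
left; right; exists m => //; split => //.
move: (sm); rewrite /csquare /in_csquare -/(tip m) -/(radius m) !ler_distl.
move=> /andP[/andP[s1 s2] /andP[s3 s4]].
have t1 : (tip m).1.1 - radius m < x.1.1.
  by apply: ne => // h; apply: xpp; exists m; left; left; left; rewrite /plane/= /crd/=.
have t2 : x.1.1 < (tip m).1.1 + radius m.
  by apply: ne => // h; apply: xpp; exists m; left; left; right.
have t3 : (tip m).1.2 - radius m < x.1.2.
  by apply: ne => // h; apply: xpp; exists m; left; right; left; rewrite /plane/= /crd/=.
have t4 : x.1.2 < (tip m).1.2 + radius m.
  by apply: ne => // h; apply: xpp; exists m; left; right; right.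
split => /=; try (by apply/andP); apply/andP; split; last by lra.
apply: ne; last by move=> h; apply: xpp; exists m; right; rewrite /plane/= /crd/= inordK.
rewrite leNgt; apply/negP => h; apply: xc; right; exists m => //.
by split => /=; lra.
Qed.

Lemma lebesgue3_setC_comb : lebesgue3 (~` @comb R) = +oo%E.
Proof.
apply/eqyP => M M0.
apply: (@le_trans _ _ (lebesgue3 (obox (0, 0, 1) (1, 1, M + 1) : set (space3 R)))).
  rewrite lebesgue3_obox/= ?ler01 ?lerDr ?(ltW M0)//.
  by rewrite lee_fin !subr0 !mul1r addrK.
by apply: le_lebesgue3; apply: outside_box; rewrite /= lexx !orbT.
Qed.

(** The complement is indecomposable, hence its own only component; its measure is infinite, so
    there are no holes to add. *)
Lemma saturated_comb : saturated (@comb R).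
Proof.
split; first exact: finite_perimeter_comb.
exists [set 0%N], (fun=> ~` comb); split; last first.
  rewrite (_ : [set i | _] = set0) ?bigcup_set0 ?setU0.
    by rewrite setYK; exact: (measure0 lebesgue3).
  rewrite -subset0 => i [_]; rewrite lebesgue3_setC_comb.
  by rewrite ltxx.
split.
- move=> i _; split; first exact: indecomposable_setC_comb.
  by rewrite lebesgue3_setC_comb ltry.
- by move=> i j -> ->.
- by rewrite bigcup_set1 setYK; exact: (measure0 lebesgue3).
- rewrite esum_set1//; apply: perimeter_ge0.
  by have [] := @finite_perimeter_setC_comb R.
- move=> A _ AE _; exists 0%N => //; rewrite (_ : A `\` _ = set0).
    exact: (measure0 lebesgue3).
  by rewrite -subset0 => x [/AE].
Qed.

End ComplementIndecomposable.

(** * Connectedness *)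

Section Connectedness.
Context {R : realType}.
Implicit Types (x y p q : space3 R) (A C : set (space3 R)).

Definition between p q (t : R) : space3 R :=
  (p.1.1 + t * (q.1.1 - p.1.1), p.1.2 + t * (q.1.2 - p.1.2), p.2 + t * (q.2 - p.2)).

Lemma component_segment A p q : (forall t, 0 <= t <= 1 -> A (between p q t)) ->
  connected_component A p q.
Proof.
move=> h; exists (between p q @` `[0, 1]); last first.
  exists 1; first by rewrite /= in_itv/= lexx ler01.
  by rewrite /between !mul1r !subrKC -!surjective_pairing.
split.
- exists 0; first by rewrite /= in_itv/= lexx ler01.
  by rewrite /between !mul0r !addr0 -!surjective_pairing.
- by move=> _ [t /= t01 <-]; apply: h; rewrite in_itv in t01.
- apply: connected_continuous_connected; first exact: segment_connected.
  apply: continuous_subspaceT => t.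
  have c (a b : R) : (a + s * b) @[s --> t] --> a + t * b.
    by apply: cvgD; [exact: cvg_cst|apply: cvgMr_tmp; exact: cvg_id].
  exact: (cvg_pair (cvg_pair (c _ _) (c _ _)) (c _ _)).
Qed.

Lemma connected_star A p : (forall x, A x -> connected_component A p x) -> A p -> connected A.
Proof.
move=> h Ap; suff -> : A = connected_component A p by exact: component_connected.
by rewrite eqEsubset; split => // x; exact: connected_component_sub.
Qed.

Lemma between_obox a b p q t : obox a b p -> obox a b q -> 0 <= t <= 1 ->
  obox a b (between p q t).
Proof.
have c (u v s w : R) : u < s < v -> u < w < v -> 0 <= t <= 1 -> u < s + t * (w - s) < v.
  move=> /andP[h1 h2] /andP[h3 h4] /andP[].
  rewrite le_eqVlt => /predU1P[<-|t0 t1]; first by rewrite mul0r addr0 h1.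
  by apply/andP; split; nra.
by move=> [p1 p2 p3] [q1 q2 q3] t01; split; exact: c.
Qed.

Lemma connected_comb : connected (@comb R).
Proof.
have s (q : space3 R) : slab q -> connected_component comb (0, 0, - 2^-1) q.
  move=> sq; apply: component_segment => t t01; left; apply: between_obox => //.
  by split => /=; lra.
apply: (connected_star _ (0, 0, - 2^-1)); last by left; split => /=; lra.
move=> x [/s//|[m _ xm]].
(* The point below [x] at height -1/2 lies both in the post and in the slab. *)
have h : post_from (-1) m (x.1, - 2^-1).
  have [_ _ /= tm] := post_tip _ _ _ xm.
  by case: xm => h1 h2 h3; split => //=; move: (tip m).2 tm => u; lra.
apply: (@connected_component_trans _ _ ((x.1, - 2^-1) : space3 R)).
  by apply: s; have [h1 h2] := post_square _ _ _ h; split => //=; lra.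
by apply: component_segment => t t01; right; exists m => //; exact: between_obox.
Qed.

(** Points outside the open cube are joined to [c] by at most two segments that stay outside it. A
    point of the complement inside the cube has height at least 0 and can rise to height 1: if the
    comb met that segment, the post there would also contain the starting point. *)
Lemma connected_setC_comb : connected (~` @comb R).
Proof.
have out (x : space3 R) : (1 <= `|x.1.1|) || (1 <= `|x.1.2|) || (1 <= `|x.2|) -> ~ comb x.
  by move=> h /comb_open_cube[]; rewrite -!ltr_norml; move: h => /orP[/orP[]|]; lra.
pose c : space3 R := (2, 2, 2).
have up (a b z : R) : 1 <= z -> connected_component (~` comb) c (a, b, z).
  move=> z1; apply: component_segment => t /andP[t0 t1]; apply: out.
  by rewrite /between/=; apply/orP; right; rewrite ler_normr; apply/orP; left; nra.
have left1 (a b z : R) : 1 <= a -> connected_component (~` comb) c (a, b, z).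
  move=> z1; apply: component_segment => t /andP[t0 t1]; apply: out.
  by rewrite /between/=; apply/orP; left; apply/orP; left; rewrite ler_normr; apply/orP; left; nra.
have left2 (a b z : R) : a <= -1 -> connected_component (~` comb) c (a, b, z).
  move=> z1; apply: (@connected_component_trans _ _ ((a, 2, 2) : space3 R)); first by apply: up; lra.
  apply: component_segment => t /andP[t0 t1]; apply: out.
  by rewrite /between/=; apply/orP; left; apply/orP; left; rewrite ler_normr; apply/orP; right; nra.
have mid1 (a b z : R) : 1 <= b -> connected_component (~` comb) c (a, b, z).
  move=> z1; apply: component_segment => t /andP[t0 t1]; apply: out.
  by rewrite /between/=; apply/orP; left; apply/orP; right; rewrite ler_normr; apply/orP; left; nra.
have mid2 (a b z : R) : b <= -1 -> connected_component (~` comb) c (a, b, z).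
  move=> z1; apply: (@connected_component_trans _ _ ((2, b, 2) : space3 R)); first by apply: up; lra.
  apply: component_segment => t /andP[t0 t1]; apply: out.
  by rewrite /between/=; apply/orP; left; apply/orP; right; rewrite ler_normr; apply/orP; right; nra.
have down (a b z : R) : z <= -1 -> connected_component (~` comb) c (a, b, z).
  move=> z1; apply: (@connected_component_trans _ _ ((2, 2, z) : space3 R)); first by apply: left1; lra.
  apply: component_segment => t /andP[t0 t1]; apply: out.
  by rewrite /between/=; apply/orP; right; rewrite ler_normr; apply/orP; right; nra.
apply: (connected_star _ c); last by apply: out; rewrite /= ger0_norm; lra.
move=> [[a b] z] xc.
have [?|a1] := leP 1 a; first exact: left1.
have [?|a2] := leP a (-1); first exact: left2.
have [?|b1] := leP 1 b; first exact: mid1.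
have [?|b2] := leP b (-1); first exact: mid2.
have [?|z1] := leP 1 z; first exact: up.
have [?|z2] := leP z (-1); first exact: down.
have z0 : 0 <= z.
  by rewrite leNgt; apply/negP => z0; apply: xc; left; split => /=; apply/andP.
apply: (@connected_component_trans _ _ ((a, b, 1) : space3 R)); first exact: up.
apply: component_segment => t t01 k; apply: xc.
case: k => [[/= _ _ h]|[m _ h]]; first by nra.
right; exists m => //; case: h => /= h1 h2 h3; split => /=.
- by move: h1; rewrite subrr mulr0 addr0.
- by move: h2; rewrite subrr mulr0 addr0.
- by nra.
Qed.

End Connectedness.

(** * Closure and boundary *)

Section Balls.
Context {R : realType}.
Implicit Types (x y p q : space3 R) (A E : set (space3 R)).

Definition around x (e : R) : set (space3 R) :=
  obox (x.1.1 - e, x.1.2 - e, x.2 - e) (x.1.1 + e, x.1.2 + e, x.2 + e).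

Lemma lebesgue3_around x e : 0 <= e -> lebesgue3 (around x e) = ((e + e) ^+ 3)%:E.
Proof. by move=> e0; rewrite lebesgue3_obox/=; [congr (_%:E); ring|lra..]. Qed.

Lemma enorm_lt x (r : R) : 0 < r -> (enorm x < r) = (x.1.1 ^+ 2 + x.1.2 ^+ 2 + x.2 ^+ 2 < r ^+ 2).
Proof.
move=> r0; rewrite /enorm -[in LHS](gtr0_norm r0) -sqrtr_sqr ltr_sqrt//.
by rewrite exprn_gt0.
Qed.

(** The half diagonal of the cube is sqrt 3 / 2 times [r]. *)
Lemma around_eball x r : 0 < r -> around x (r / 2) `<=` eball x r.
Proof.
move=> r0 y [/= h1 h2 h3]; rewrite /eball /= enorm_lt//=.
have sq (a b : R) : a - r / 2 < b < a + r / 2 -> (b - a) ^+ 2 < r ^+ 2 / 4.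
  by move=> /andP[k1 k2]; nra.
have := sq _ _ h1; have := sq _ _ h2; have := sq _ _ h3.
have : 0 < r ^+ 2 by rewrite exprn_gt0.
rewrite /=; move: (_ ^+ 2) (_ ^+ 2) (_ ^+ 2) (_ ^+ 2) => a b c d; lra.
Qed.

Lemma eball_around x r : 0 < r -> eball x r `<=` around x r.
Proof.
move=> r0 y; rewrite /eball /= enorm_lt//= => h.
have sq (a b : R) : (b - a) ^+ 2 < r ^+ 2 -> a - r < b < a + r.
  by move=> k; rewrite -ltr_distl -(@ltr_pXn2r _ 2) ?nnegrE ?normr_ge0 ?(ltW r0)// real_normK ?num_real.
split => /=; apply: sq; apply: le_lt_trans h; rewrite -?addrA.
- by rewrite lerDl addr_ge0// sqr_ge0.
- by rewrite addrCA lerDl addr_ge0// sqr_ge0.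
- by rewrite addrA lerDr addr_ge0// sqr_ge0.
Qed.

Lemma shaved_open E : open E -> shaved E.
Proof.
move=> oE [x [Ex [r [r0]]]]; apply/eqP; rewrite gt_eqF//.
have /nbhs_obox[e e0 eE] : nbhs x E by exact: open_nbhs_nbhs.
have m0 : 0 < Num.min e (r / 2) by rewrite lt_min e0 divr_gt0.
apply: (@lt_le_trans _ _ (lebesgue3 (around x (Num.min e (r / 2))))).
  by rewrite lebesgue3_around ?ltW// lte_fin exprn_gt0// addr_gt0.
apply: le_lebesgue3.
have sub (a b : R) : a <= b -> around x a `<=` around x b.
  by move=> ab y [/= h1 h2 h3]; split => /=; lra.
move=> y h; split.
  by apply: around_eball => //; apply: sub h; rewrite ge_min lexx orbT.
by apply: eE; apply: (sub _ e) h; rewrite ge_min lexx.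
Qed.

Lemma upper_density_gt0 E x (c e : R) : 0 < c -> 0 < e ->
  (forall r, 0 < r < e -> ((c * r ^+ 3)%:E <= lebesgue3 (E `&` eball x r))%E) ->
  (0 < upper_density E x)%E.
Proof.
move=> c0 e0 h; apply: (@lt_le_trans _ _ (c / 8)%:E).
  by rewrite lte_fin divr_gt0.
apply/ereal_infP => _ [V V0 <-].
have /filter_ex[r [rV /andP[r0 re]]] : (0 : R)^'+ (V `&` [set r | 0 < r < e]).
  apply: filterI => //; near=> r; apply/andP; split; first by near: r; exact: nbhs_right_gt.
  by near: r; exact: nbhs_right_lt.
apply: (@le_trans _ _ (lebesgue3 (E `&` eball x r) / lebesgue3 (eball x r))%E); last first.
  by apply: ereal_sup_ubound; exists r.
have l1 : (lebesgue3 (eball x r) <= ((r + r) ^+ 3)%:E)%E.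
  by rewrite -(lebesgue3_around x r (ltW r0)); apply: le_lebesgue3; exact: eball_around.
have l2 : ((r ^+ 3)%:E <= lebesgue3 (eball x r))%E.
  apply: le_trans (le_lebesgue3 _ _ (around_eball x r r0)).
  by rewrite lebesgue3_around ?divr_ge0 ?(ltW r0)// -splitr.
have := h r; rewrite r0 re => /(_ isT).
have r3 : 0 < r ^+ 3 by rewrite exprn_gt0.
have : (lebesgue3 (E `&` eball x r) <= ((r + r) ^+ 3)%:E)%E.
  by apply: le_trans l1; apply: le_lebesgue3.
move: l1 l2; case: (lebesgue3 (eball x r)) => [s| |]//; case: (lebesgue3 _) => [t| |]//.
rewrite !lee_fin => s1 s2 _ t1; have s0 : 0 < s by exact: lt_le_trans s2.
rewrite inver gt_eqF// -EFinM lee_fin ler_pdivlMr// mulrAC ler_pdivrMr//.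
have -> : (t * 8 = 8 * t)%R by rewrite mulrC.
have : s <= 8 * r ^+ 3 by apply: le_trans s1 _; rewrite le_eqVlt; apply/orP; left; apply/eqP; ring.
move: (r ^+ 3) r3 s2 t1 {s1} => q q0 s2 t1 s1; nra.
Unshelve. all: by end_near.
Qed.

(** At an interior point of a top face, a box of sides r, r, r / 2 just below lies in the post and
    one just above lies in the complement; each has the fraction 1/2 of r^3. *)
Lemma tip_boundary m (u v : R) : `|u - (tip m).1.1| < radius m -> `|v - (tip m).1.2| < radius m ->
  measure_theoretic_boundary comb (u, v, (tip m).2 : R).
Proof.
move=> hu hv; have r0 : 0 < (radius m : R) by exact: le_lt_trans hu.
have [[_ _ [/= _ _ t01] _ _]|E] := @radius_cases R m; last by move: r0; rewrite E ltr0N1.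
(* The first two distances keep the boxes over the square, the third keeps the lower one inside the
   post. *)
pose e := Num.min (Num.min (radius m - `|u - (tip m).1.1|) (radius m - `|v - (tip m).1.2|))
   (tip m).2.
have e0 : 0 < e by rewrite !lt_min !subr_gt0 hu hv; case/andP: t01.
have [e1 e2 e3] : [/\ `|u - (tip m).1.1| <= radius m - e,
    `|v - (tip m).1.2| <= radius m - e & e <= (tip m).2].
  split; last by rewrite /e !ge_min lexx orbT.
    by rewrite lerBrDl -lerBrDr /e !ge_min lexx.
  by rewrite lerBrDl -lerBrDr /e !ge_min lexx orbT.
have vol (a b : R) r : 0 < r -> b - a = r / 2 ->
    lebesgue3 (obox (u - r / 2, v - r / 2, a) (u + r / 2, v + r / 2, b)) = (2^-1 * r ^+ 3)%:E.
  by move=> r1 ab; rewrite lebesgue3_obox/=; [rewrite ab; congr (_%:E); field|lra..].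
have sub (a b r : R) : 0 < r -> (tip m).2 - r / 2 <= a -> b <= (tip m).2 + r / 2 ->
    obox (u - r / 2, v - r / 2, a) (u + r / 2, v + r / 2, b) `<=` eball (u, v, (tip m).2) r.
  move=> r1 ra rb; apply: subset_trans (around_eball _ _ r1) => y [/= h1 h2 h3].
  by split => //=; lra.
have sq r y z : r < e -> y.1.1 = y.1.1 -> obox (u - r / 2, v - r / 2, z.1) (u + r / 2, v + r / 2, z.2) y ->
    (tip m).1.1 - radius m < y.1.1 < (tip m).1.1 + radius m /\
    (tip m).1.2 - radius m < y.1.2 < (tip m).1.2 + radius m.
  move: e1 e2; rewrite !ler_distl => e1 e2 re _ [/= h1 h2 _]; split; lra.
split; apply: (upper_density_gt0 _ _ 2^-1 e) => // r /andP[r1 re].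
- rewrite -(vol ((tip m).2 - r / 2) (tip m).2 r r1); last by lra.
  apply: le_lebesgue3 => y h; split; last by apply: (sub _ _ _ _ _ _ _ h) => //; lra.
  have [q1 q2] := sq r y ((tip m).2 - r / 2, (tip m).2) re erefl h.
  right; exists m => //; split => //=; case: h => /= _ _ h.
  by move: e3 h t01; move: (tip m).2 => t; lra.
- rewrite -(vol (tip m).2 ((tip m).2 + r / 2) r r1); last by lra.
  apply: le_lebesgue3 => y h; split; last by apply: (sub _ _ _ _ _ _ _ h) => //; lra.
  have [q1 q2] := sq r y ((tip m).2, (tip m).2 + r / 2) re erefl h.
  case: h => /= _ _ h.
  apply: (above_post m).
  - rewrite /csquare /in_csquare !ler_distl -/(tip m) -/(radius m); apply/andP; split; lra.
  - by case/andP: h => /ltW.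
  - by move: t01 h; move: (tip m).2 => t; lra.
Qed.

End Balls.

Section ClosureMeasure.
Context {R : realType}.
Implicit Types (x y p q : space3 R) (A E : set (space3 R)).

Lemma nneseries_le (u : nat -> \bar R) (c : \bar R) : (forall n, 0 <= u n)%E ->
  (forall n, (\sum_(0 <= k < n) u k <= c)%E) -> (\sum_(k <oo) u k <= c)%E.
Proof.
move=> u0 h; apply: lime_le; first by apply: is_cvg_nneseries => k _ _; exact: u0.
by apply: nearW => n; exact: h.
Qed.

Lemma lebesgue3_cover A (F : nat -> set (space3 R)) : A `<=` \bigcup_n F n ->
  (lebesgue3 A <= \sum_(n <oo) lebesgue3 (F n))%E.
Proof.
move=> AF; apply: le_trans (le_lebesgue3 _ _ AF) _.
exact: mu_ext_sigma_subadditive (measure_ge0 (@borel_lebesgue3 R)) F.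
Qed.

(** A top face enters the interior of the neighbourhood, and a point slightly below its centre
    belongs to the comb and still to the neighbourhood. *)
Lemma closure_comb x : free x.1 -> 0 < x.2 < 1 -> closure comb x.
Proof.
move=> fx x01 U xU.
have xV : nbhs x (interior U) by exact: nbhs_interior.
have [m [r0 mU]] := hair_dense x _ fx x01 xV.
have [[_ _ [/= _ _ /andP[t0 t1]] _ _]|E] := @radius_cases R m; last by move: r0; rewrite E ltr0N1.
have /nbhs_obox[e e0 eU] : nbhs ((tip m).1.1, (tip m).1.2, (tip m).2) U.
  have := mU (tip m).1.1 (tip m).1.2; apply.
  by rewrite /csquare /in_csquare !subrr normr0 andbb ltW.
pose d := Num.min e (tip m).2.
have d0 : 0 < d by rewrite lt_min e0.
have [de dt] : d <= e /\ d <= (tip m).2 by rewrite /d !ge_min !lexx orbT.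
exists ((tip m).1.1, (tip m).1.2, (tip m).2 - d / 2); split.
  by right; exists m => //; split => /=; lra.
by apply: eU; split => /=; lra.
Qed.

(** The chamber has volume 4, and the columns over the squares take at most 2 of it. *)
Lemma free_measure : (2%:E <= lebesgue3 (@chamber R `&` @free_cyl R))%E.
Proof.
have cE : (lebesgue3 (@chamber R) = 4%:E)%E.
  by rewrite lebesgue3_obox/=; [congr (_%:E); ring|lra..].
pose F := @chamber R `&` @free_cyl R.
have mF : lebesgue_measurable3 F.
  apply: lebesgue_measurable3_borel; apply: measurableI; first exact: measurable_obox.
  exact: measurable_free_cyl.
have mC : lebesgue_measurable3 (@chamber R `\` @free_cyl R).
  apply: lebesgue_measurable3_borel; apply: measurableD; first exact: measurable_obox.
  exact: measurable_free_cyl.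
have : (lebesgue3 (@chamber R) = lebesgue3 F + lebesgue3 (@chamber R `\` @free_cyl R))%E.
  rewrite -[X in lebesgue3 X = _](setUIDK _ (@free_cyl R)).
  by apply: (measureU lebesgue3 mF mC); rewrite /F setDE setIACA setICr setI0.
have : (lebesgue3 (@chamber R `\` @free_cyl R) <= 2%:E)%E.
  (* Doubling the half side places the closed square inside an open box; its area is at most 4^-m,
     estimated by 2^-m. *)
  pose s m : R := radius m + radius m.
  pose B m : set (space3 R) := if 0 < (radius m : R) then
    obox ((tip m).1.1 - s m, (tip m).1.2 - s m, 0) ((tip m).1.1 + s m, (tip m).1.2 + s m, 1)
    else set0.
  have cov : @chamber R `\` @free_cyl R `<=` \bigcup_m B m.
    move=> x [[/= h1 h2 h3] xf].
    have [[m sm]|nsq] := pselect (exists m, csquare m x.1.1 x.1.2); last first.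
      by exfalso; apply: xf; split => // m; apply/negP => h; apply: nsq; exists m.
    exists m => //; rewrite /B.
    have [[r0 _ _ _ _]|E] := @radius_cases R m; last first.
      by have := csquare_radius _ _ _ sm; rewrite E ler0N1.
    rewrite r0; move: sm; rewrite /csquare /in_csquare !ler_distl -/(tip m) -/(radius m).
    by move=> /andP[k1 k2]; split => //=; rewrite /s; lra.
  apply: le_trans (lebesgue3_cover _ _ cov) _.
  apply: nneseries_le => [n|n]; first exact: (measure_ge0 lebesgue3).
  rewrite big_mkord; apply: (@le_trans _ _ (\sum_(k < n) (2^-1 ^+ k)%:E)%E); last first.
    by rewrite sumEFin lee_fin; have := @geometric_tail R 0 n; rewrite expr0 mulr1.
  apply: lee_sum => m _; rewrite /B; case: ifPn => r0; last first.
    by rewrite (measure0 lebesgue3) lee_fin exprn_ge0.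
  have [[_ r1 _ _ _]|E] := @radius_cases R m; last by move: r0; rewrite E ltr0N1.
  rewrite lebesgue3_obox/= /s; [|lra..].
  have : 2^-1 ^+ m <= 1 :> R by apply: exprn_ile1; lra.
  have : 0 <= 2^-1 ^+ m :> R by exact: exprn_ge0.
  rewrite lee_fin; move: (2^-1 ^+ m) r1 => q r1 q0 q1.
  by move: (radius m) r0 r1 => r r0 r1; nra.
rewrite cE; case: (lebesgue3 (_ `\` _)) => [a| |]; case: (lebesgue3 F) => [b| |]//= h1 h2;
  rewrite ?leey//.
by move: h1 h2; rewrite !lee_fin -EFinD => h1 -[]; lra.
Qed.

Lemma closure_comb_measure : ((3999 / 4000)%:E < lebesgue3 (closure (@comb R) `\` comb))%E.
Proof.
apply: (@lt_le_trans _ _ 2%:E); first by rewrite lte_fin; lra.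
apply: le_trans free_measure _.
apply: le_lebesgue3 => x [[/= _ _ h] xf]; split; first exact: closure_comb.
by apply: free_setC_comb => //; case/andP: h => /ltW.
Qed.

End ClosureMeasure.

(** * Lipschitz images of the sphere *)

Section LipschitzImage.
Context {R : realType}.
Implicit Types (x y p q : space3 R) (A E : set (space3 R)) (f : space3 R -> space3 R).

Lemma compact_sphere2 : compact (@sphere2 R).
Proof.
have sE : @sphere2 R = (fun x => crd 0 x ^+ 2 + crd 1 x ^+ 2 + crd (inord 2) x ^+ 2) @^-1` [set 1].
  rewrite predeqE => x; rewrite /sphere2 /enorm /crd /= inordK//=; split=> [h|->]; last exact: sqrtr1.
  by rewrite -[LHS]sqr_sqrtr ?h ?expr1n// !addr_ge0// sqr_ge0.
apply: (subclosed_compact _ (compact_ccube 1)).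
  rewrite sE; apply: preimage_closed; last exact: closed_eq.
  have c2 i : continuous (fun x : space3 R => crd i x ^+ 2).
    by move=> x; apply: cvgM; exact: continuous_crd.
  by move=> x _; apply: cvgD; [apply: cvgD|]; exact: c2.
rewrite sE => x /= h.
have sq (a b c : R) : 0 <= b -> 0 <= c -> a ^+ 2 + b + c = 1 -> -1 <= a <= 1.
  by move=> b0 c0 e; apply/andP; split; nra.
move: h; rewrite /crd/= inordK//= => h.
have s0 (t : R) : 0 <= t ^+ 2 by exact: sqr_ge0.
split; [split|]; rewrite /= in_itv/=.
- exact: (sq _ _ _ (s0 _) (s0 _) h).
- by rewrite addrAC addrC addrA in h; exact: (sq _ _ _ (s0 _) (s0 _) h).
- by rewrite addrC addrA in h; exact: (sq _ _ _ (s0 _) (s0 _) h).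
Qed.

Lemma elipschitz_continuous A f : elipschitz_on A f -> {within A, continuous f}.
Proof.
move=> [L fL]; apply/subspace_continuousP => x Ax U /nbhs_obox[e e0 eU].
pose r := e / (`|L| + 1); have L0 : 0 < `|L| + 1 by rewrite ltr_wpDl.
have r0 : 0 < r by exact: divr_gt0.
have : nbhs x (around x (r / 2)).
  apply: open_nbhs_nbhs; split; first exact: open_obox.
  by split => /=; lra.
apply: filterS => y /(around_eball _ _ r0) yr Ay; apply: eU.
apply: (eball_around (f x) e e0); rewrite /eball /=.
apply: le_lt_trans (fL y x Ay Ax) _.
apply: (@le_lt_trans _ _ (`|L| * enorm (y - x))).
  by rewrite ler_wpM2r ?sqrtr_ge0// ler_norm.
have : (`|L| + 1) * enorm (y - x) < e by rewrite mulrC -ltr_pdivlMr.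
have : 0 <= enorm (y - x) by exact: sqrtr_ge0.
by rewrite mulrDl mul1r; lra.
Qed.

Lemma closed_elipschitz_sphere2 f : elipschitz_on sphere2 f -> closed (f @` @sphere2 R).
Proof.
move=> fL; apply: compact_closed; first exact: norm_hausdorff.
by apply: continuous_compact compact_sphere2; exact: elipschitz_continuous.
Qed.

Lemma lebesgue3_finite_cover A (F : nat -> set (space3 R)) M (c : R) : 0 <= c ->
  (forall x, A x -> exists2 k, (k < M)%N & F k x) ->
  (forall k, (lebesgue3 (F k) <= c%:E)%E) -> (lebesgue3 A <= (M%:R * c)%:E)%E.
Proof.
move=> c0 AF Fc; pose G k := if (k < M)%N then F k else set0.
apply: (@le_trans _ _ (\sum_(k <oo) lebesgue3 (G k))%E).
  by apply: lebesgue3_cover => x /AF[k kM xk]; exists k => //; rewrite /G kM.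
apply: nneseries_le => [n|n]; first exact: (measure_ge0 lebesgue3).
rewrite big_mkord; apply: (@le_trans _ _ ((minn n M)%:R * c)%:E); last first.
  by rewrite lee_fin ler_wpM2r// ler_nat geq_minr.
elim: n => [|n ih]; first by rewrite big_ord0 min0n mul0r.
rewrite big_ord_recr/= {2}/G; case: ltnP => nM.
  rewrite (minn_idPl nM) -addn1 natrD mulrDl mul1r EFinD leeD//.
  by move: ih; rewrite (minn_idPl (ltnW nM)).
rewrite (measure0 lebesgue3) adde0; apply: le_trans ih _.
by rewrite (minn_idPr nM) (minn_idPr (leqW nM)).
Qed.

(* The image is covered by O(n^2) boxes of side O(1/n). *)
Lemma null_lipschitz_chart A f (u v : space3 R -> R) (C : R) :
  (forall x, A x -> -1 <= u x <= 1 /\ -1 <= v x <= 1) ->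
  (forall x y, A x -> A y -> enorm (f x - f y) <= C * (`|u x - u y| + `|v x - v y|)) ->
  lebesgue3 (f @` A) = 0%E.
Proof.
move=> uv fC; pose D := `|C| + 1; have D0 : 0 < D by rewrite ltr_wpDl.
(* There are at most 3 N classes for each of [u] and [v], where N = n + 1, and each cell is mapped
   into a cube of side 4 D / N; thus 576 is 9 times 64. *)
have bd n : (lebesgue3 (f @` A) <= (576 * D ^+ 3 / n.+1%:R)%:E)%E.
  pose N : R := n.+1%:R; have N0 : 0 < N by exact: ltr0Sn.
  have N1 : 1 <= N by rewrite ler1n.
  pose r := 2 * D / N; have r0 : 0 < r by rewrite divr_gt0// mulr_gt0.
  pose c := (r + r) ^+ 3; have c0 : 0 <= c by rewrite exprn_ge0// addr_ge0// ltW.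
  pose Z w a x := w x + 1 = w x + 1 /\ a%:R <= (w x + 1) * N < a.+1%:R.
  (* The extra class takes the endpoint where [w] equals 1. *)
  pose M := (2 * n.+1).+1.
  have cell (w : space3 R -> R) x : -1 <= w x <= 1 -> exists2 a, (a < M)%N & Z w a x.
    move=> /andP[w1 w2]; have t0 : 0 <= (w x + 1) * N by apply: mulr_ge0; [lra|exact: ltW].
    exists (Num.truncn ((w x + 1) * N)); last by split => //; exact: truncn_itv.
    rewrite ltnS -(ler_nat R); apply: le_trans (_ : (w x + 1) * N <= _).
      by have /andP[] := truncn_itv t0.
    by rewrite natrM; apply: ler_wpM2r; [exact: ltW|lra].
  have diff w a x y : Z w a x -> Z w a y -> `|w x - w y| <= N^-1.
    move=> [_ /andP[h1 h2]] [_ /andP[h3 h4]].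
    rewrite -addn1 natrD in h2 h4.
    rewrite -(ler_pM2r N0) mulVf ?gt_eqF// -{1}(gtr0_norm N0) -normrM ler_norml mulrBl.
    by apply/andP; split; lra.
  have cells a b : (lebesgue3 (f @` (A `&` [set x | Z u a x /\ Z v b x])) <= c%:E)%E.
    have [[x [Ax [xa xb]]]|none] := pselect (exists x, A x /\ Z u a x /\ Z v b x); last first.
      rewrite (_ : _ @` _ = set0) ?(measure0 lebesgue3) ?lee_fin//.
      by rewrite -subset0 => ? [x [Ax xab] _]; apply: none; exists x.
    rewrite /c -(lebesgue3_around (f x) r (ltW r0)); apply: le_lebesgue3 => _ [y [Ay [ya yb]] <-].
    apply: (eball_around _ _ r0); rewrite /eball /=; apply: le_lt_trans (fC y x Ay Ax) _.
    have d1 := diff _ _ _ _ ya xa; have d2 := diff _ _ _ _ yb xb.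
    have i0 : 0 < N^-1 by rewrite invr_gt0.
    have CD : C < D by rewrite /D; have := ler_norm C; lra.
    apply: (@le_lt_trans _ _ (`|C| * (N^-1 + N^-1))).
      apply: le_trans (_ : `|C| * (`|u y - u x| + `|v y - v x|) <= _).
        by rewrite ler_wpM2r ?addr_ge0 ?ler_norm.
      by rewrite ler_wpM2l// lerD.
    have -> : r = `|C| * (N^-1 + N^-1) + 2 * N^-1 by rewrite /r /D; ring.
    by rewrite ltrDl mulr_gt0.
  have cols a : (lebesgue3 (f @` (A `&` [set x | Z u a x])) <= (M%:R * c)%:E)%E.
    apply: (lebesgue3_finite_cover _ (fun b => f @` (A `&` [set x | Z u a x /\ Z v b x]))) => //.
    move=> _ [x [Ax xa] <-]; have [b bM xb] := cell v x (uv x Ax).2.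
    by exists b => //; exists x.
  apply: (@le_trans _ _ (M%:R * (M%:R * c))%:E).
    apply: (lebesgue3_finite_cover _ (fun a => f @` (A `&` [set x | Z u a x]))) => //.
      by rewrite mulr_ge0.
    move=> _ [x Ax <-]; have [a aM xa] := cell u x (uv x Ax).1.
    by exists a => //; exists x.
  rewrite lee_fin /M -addn1 natrD natrM -/N /c /r.
  have -> : (2 * D / N + 2 * D / N) ^+ 3 = 64 * D ^+ 3 / N ^+ 3 by field; rewrite gt_eqF.
  have D3 : 0 < D ^+ 3 by rewrite exprn_gt0.
  move: (D ^+ 3) D3 => q q0.
  apply: (@le_trans _ _ (3 * N * (3 * N * (64 * q / N ^+ 3)))); last first.
    by rewrite le_eqVlt; apply/orP; left; apply/eqP; field; rewrite gt_eqF.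
  have z0 : 0 <= 64 * q / N ^+ 3 by rewrite divr_ge0 ?mulr_ge0 ?exprn_ge0 ?ltW.
  have M3 : 2 * N + 1 <= 3 * N by lra.
  have M0 : 0 <= 2 * N + 1 by lra.
  by rewrite ler_pM ?(mulr_ge0 M0)// ler_wpM2r.
apply/eqP; rewrite eq_le measure_ge0 andbT.
apply/lee_addgt0Pr => e e0; rewrite add0e.
have q0 : 0 < 576 * D ^+ 3 by apply: mulr_gt0; [lra|exact: exprn_gt0].
move: (576 * D ^+ 3) q0 bd => q q0 bd; pose n := Num.bound (q / e).
apply: le_trans (bd n) _; rewrite lee_fin ler_pdivrMr ?ltr0Sn// [e * _]mulrC -ler_pdivrMr//.
have : q / e < n%:R by apply: archi_boundP; rewrite ltW// divr_gt0.
by move=> /ltW/le_trans; apply; rewrite ler_nat.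
Qed.

End LipschitzImage.

Section BoundaryNotCovered.
Context {R : realType}.
Implicit Types (x y p q : space3 R) (A E : set (space3 R)) (f : space3 R -> space3 R).

(** Here [w], [u], [v] stand for the coordinates in some order and [s] for a sign, which covers six
    caps. On a cap two values of [w] have a sum of modulus at least 1, so the equation of the sphere
    bounds the change of [w] by twice the changes of [u] and [v] together. These two form a chart
    with constant 3. *)
Lemma null_cap f (w u v : space3 R -> R) (s : R) : elipschitz_on sphere2 f -> s ^+ 2 = 1 ->
  (forall x, enorm x = Num.sqrt (w x ^+ 2 + u x ^+ 2 + v x ^+ 2)) ->
  (forall x y, [/\ w (x - y) = w x - w y, u (x - y) = u x - u y & v (x - y) = v x - v y]) ->
  lebesgue3 (f @` (sphere2 `&` [set x | 2^-1 <= s * w x])) = 0%E.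
Proof.
move=> [L fL] s2 en add.
have on x : sphere2 x -> w x ^+ 2 + u x ^+ 2 + v x ^+ 2 = 1.
  rewrite /sphere2 /= en => h; rewrite -[LHS]sqr_sqrtr ?h ?expr1n//.
  by rewrite !addr_ge0// sqr_ge0.
have bd (a b c : R) : a ^+ 2 + b ^+ 2 + c ^+ 2 = 1 -> -1 <= b <= 1 /\ -1 <= c <= 1.
  have := sqr_ge0 a; have := sqr_ge0 b; have := sqr_ge0 c => c0 b0 a0 h.
  by split; apply/andP; split; nra.
apply: (null_lipschitz_chart _ _ u v (`|L| * 3)) => [x [/on xS _]|x y [xS xw] [yS yw]].
  exact: bd xS.
apply: le_trans (fL x y xS yS) _.
apply: (@le_trans _ _ (`|L| * enorm (x - y))).
  by rewrite ler_wpM2r ?sqrtr_ge0// ler_norm.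
rewrite -mulrA ler_wpM2l//.
have [ew eu ev] := add x y.
have := on x xS; have := on y yS; rewrite en ew eu ev; move: xw yw => /=.
move: (w x) (w y) (u x) (u y) (v x) (v y) => a a' b b' c c' h h' E' E.
have [eb ec] := bd _ _ _ E; have [eb' ec'] := bd _ _ _ E'.
have b1 : `|b + b'| <= 2 by rewrite ler_norml; lra.
have c1 : `|c + c'| <= 2 by rewrite ler_norml; lra.
have a1 : 1 <= `|a + a'|.
  apply: (@le_trans _ _ (s * (a + a'))); first by rewrite mulrDr; lra.
  apply: le_trans (ler_norm _) _; rewrite normrM.
  suff -> : `|s| = 1 by rewrite mul1r.
  by move/eqP: s2; rewrite sqrf_eq1 => /orP[] /eqP ->; rewrite ?normrN normr1.
have aa : `|a - a'| <= 2 * (`|b - b'| + `|c - c'|).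
  have e : (a - a') * (a + a') = - ((b - b') * (b + b') + (c - c') * (c + c')).
    by rewrite -!subr_sqr; lra.
  apply: (@le_trans _ _ (`|a - a'| * `|a + a'|)); first by rewrite ler_peMr.
  rewrite -normrM e normrN; apply: le_trans (ler_normD _ _) _.
  by rewrite !normrM mulrDr lerD// mulrC ler_wpM2r.
have n1 := normr_ge0 (a - a'); have n2 := normr_ge0 (b - b'); have n3 := normr_ge0 (c - c').
apply: (@le_trans _ _ (`|a - a'| + `|b - b'| + `|c - c'|)); last by lra.
have n0 : 0 <= `|a - a'| + `|b - b'| + `|c - c'| by rewrite !addr_ge0.
rewrite -[leRHS](ger0_norm n0) -sqrtr_sqr ler_sqrt ?sqr_ge0//.
rewrite -(real_normK (num_real (a - a'))) -(real_normK (num_real (b - b'))) -(real_normK (num_real (c - c'))).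
move: `|_| `|_| `|_| n1 n2 n3 => k l m k0 l0 m0.
have := mulr_ge0 k0 l0; have := mulr_ge0 k0 m0; have := mulr_ge0 l0 m0; nra.
Qed.

Lemma null_elipschitz_sphere2 f : elipschitz_on sphere2 f -> lebesgue3 (f @` @sphere2 R) = 0%E.
Proof.
move=> fL; have one : 1 ^+ 2 = 1 :> R by rewrite expr1n.
have mone : (-1) ^+ 2 = 1 :> R by rewrite sqrrN expr1n.
pose cap (w : space3 R -> R) (s : R) := f @` (sphere2 `&` [set x | 2^-1 <= s * w x]).
pose w0 (x : space3 R) := x.1.1; pose w1 (x : space3 R) := x.1.2; pose w2 (x : space3 R) := x.2.
apply: (null_sub _ ((cap w0 1 `|` cap w0 (-1)) `|` (cap w1 1 `|` cap w1 (-1)) `|`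
  (cap w2 1 `|` cap w2 (-1)))); last first.
  apply: null_setU; first (apply: null_setU; apply: null_setU); last apply: null_setU.
  - by apply: (null_cap _ w0 w1 w2).
  - by apply: (null_cap _ w0 w1 w2).
  - by apply: (null_cap _ w1 w0 w2) => // x; rewrite /enorm /w0 /w1 /w2 [in RHS](addrC (x.1.2 ^+ 2)).
  - by apply: (null_cap _ w1 w0 w2) => // x; rewrite /enorm /w0 /w1 /w2 [in RHS](addrC (x.1.2 ^+ 2)).
  - by apply: (null_cap _ w2 w0 w1) => // x; rewrite /enorm /w0 /w1 /w2 -[in RHS]addrA [in RHS]addrC.
  - by apply: (null_cap _ w2 w0 w1) => // x; rewrite /enorm /w0 /w1 /w2 -[in RHS]addrA [in RHS]addrC.
move=> _ [x xS <-].
have E : x.1.1 ^+ 2 + x.1.2 ^+ 2 + x.2 ^+ 2 = 1.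
  move: (xS); rewrite /sphere2 /enorm /= => h; rewrite -[LHS]sqr_sqrtr ?h ?expr1n//.
  by rewrite !addr_ge0// sqr_ge0.
have [h0|h0] := leP 2^-1 (1 * x.1.1); first by left; left; left; exists x.
have [h0'|h0'] := leP 2^-1 (-1 * x.1.1); first by left; left; right; exists x.
have [h1|h1] := leP 2^-1 (1 * x.1.2); first by left; right; left; exists x.
have [h1'|h1'] := leP 2^-1 (-1 * x.1.2); first by left; right; right; exists x.
have [h2|h2] := leP 2^-1 (1 * x.2); first by right; left; exists x.
have [h2'|h2'] := leP 2^-1 (-1 * x.2); first by right; right; exists x.
(* Outside all six caps the squares of the coordinates add up to at most 3/4. *)
exfalso; have sq (a : R) : 1 * a < 2^-1 -> -1 * a < 2^-1 -> a ^+ 2 <= 4^-1 by move=> k k'; nra.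
have := sq _ h0 h0'; have := sq _ h1 h1'; have := sq _ h2 h2'; lra.
Qed.

(** Area is read off from volume: the slices of the covering sets at height [h], thickened by the
    unit interval, cover a box of volume 4 r^2, and a set of diameter d contributes at most (2 d)^2.
    With the weight pi / 4 this bounds the sum below by pi r^2 / 4. *)
Lemma hausdorff2_square (a b h r : R) E : 0 < r ->
  (forall u v, `|u - a| < r -> `|v - b| < r -> E (u, v, h)) -> (0 < hausdorff2 E)%E.
Proof.
move=> r0 sqE; apply: (@lt_le_trans _ _ (pi / 16 * (4 * r ^+ 2))%:E).
  by rewrite lte_fin !mulr_gt0 ?exprn_gt0 ?pi_gt0.
apply: (@le_trans _ _ (hausdorff2_delta 1 E)); last first.
  (* Any positive scale would bound the supremum below; 1 makes all diameters finite. *)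
  by apply: ereal_sup_ubound; exists 1 => //=; exact: ltr01.
apply/ereal_infP => _ [C [EC dC] <-].
pose B k : set (space3 R) := obox (a - r, b - r, 0) (a + r, b + r, 1) `&`
  [set x | C k (x.1.1, x.1.2, h)].
have d0 k : (0 <= ediam (C k))%E by apply: ereal_sup_ubound; left.
have dE k : ediam (C k) = (fine (ediam (C k)))%:E.
  by rewrite fineK// ge0_fin_numE//; apply: le_lt_trans (dC k) _; exact: ltry.
have Bd k : (lebesgue3 (B k) <= (4 * fine (ediam (C k)) ^+ 2)%:E)%E.
  set d := fine (ediam (C k)); have dd : 0 <= d by apply: fine_ge0.
  have [[y [yB]]|none] := pselect (exists y, B k y); last first.
    rewrite (_ : B k = set0); last by rewrite -subset0 => y yB; apply: none; exists y.
    by rewrite (measure0 lebesgue3) lee_fin mulr_ge0 ?sqr_ge0.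
  move=> yC.
  pose X (z : R) : set R := `[z - d, z + d]%classic.
  have mX z : measurable (X z : set (measurableTypeR R)) by exact: measurable_itv.
  have lX z : leb R (X z) = (2 * d)%:E.
    rewrite /X lebesgue_measure_itv/= lte_fin.
    case: ltP => h1; first by rewrite -EFinB; congr (_%:E); ring.
    by congr (_%:E); lra.
  pose I : set R := `]0, 1[%classic.
  have mI : measurable (I : set (measurableTypeR R)) by exact: measurable_itv.
  apply: (@le_trans _ _ (lebesgue3 ((X y.1.1 `*` X y.1.2) `*` I))); last first.
    rewrite lebesgue3_borel; last by apply: measurableX => //; apply: measurableX.
    rewrite borel_lebesgue3_box// !lX lebesgue_measure_oo// subr0 mule1 -EFinM lee_fin.
    by rewrite le_eqVlt; apply/orP; left; apply/eqP; ring.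
  apply: le_lebesgue3 => x [[_ _ /= x3] xC].
  have key : enorm ((x.1.1, x.1.2, h) - (y.1.1, y.1.2, h)) <= d.
    rewrite -lee_fin -dE; apply: ereal_sup_ubound; right.
    by exists (x.1.1, x.1.2, h) => //; exists (y.1.1, y.1.2, h).
  move: key; rewrite /enorm /= subrr expr0n addr0 => key.
  have s0 : 0 <= (x.1.1 - y.1.1) ^+ 2 + (x.1.2 - y.1.2) ^+ 2 by rewrite addr_ge0 ?sqr_ge0.
  split; last by rewrite /I /= in_itv.
  by split; rewrite /X /= in_itv/= -ler_distl; apply: le_trans key;
    rewrite -sqrtr_sqr ler_sqrt// ?lerDl ?lerDr sqr_ge0.
have cov : obox (a - r, b - r, 0) (a + r, b + r, 1) `<=` \bigcup_k B k.
  move=> x xb; have [/= h1 h2 h3] := xb.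
  have /EC[k _ xk] : E (x.1.1, x.1.2, h) by apply: sqE; rewrite ltr_distl.
  by exists k.
have := lebesgue3_cover _ _ cov.
rewrite lebesgue3_obox/=; [|lra..].
move=> le4.
apply: (@le_trans _ _ ((pi / 16)%:E * \sum_(k <oo) lebesgue3 (B k))%E).
  rewrite EFinM; apply: lee_wpmul2l; first by rewrite lee_fin divr_ge0// pi_ge0.
  apply: le_trans le4; rewrite lee_fin le_eqVlt; apply/orP; left; apply/eqP; ring.
rewrite -nneseriesZl//.
apply: lee_nneseries => [k _ _|k _].
  by apply: mule_ge0; [rewrite lee_fin divr_ge0// pi_ge0|exact: (measure_ge0 lebesgue3)].
apply: (@le_trans _ _ ((pi / 16)%:E * (4 * fine (ediam (C k)) ^+ 2)%:E)%E).
  by apply: lee_wpmul2l => //; rewrite lee_fin divr_ge0// pi_ge0.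
rewrite [in leRHS]dE -!EFinM lee_fin le_eqVlt; apply/orP; left; apply/eqP; by field.
Qed.

Lemma boundary_not_covered f : elipschitz_on sphere2 f ->
  (0 < hausdorff2 (measure_theoretic_boundary (@comb R) `\` (f @` sphere2)))%E.
Proof.
move=> fL; set K := f @` sphere2.
have [[p [[[_ _ p2] pf] pK]]|none] := pselect (exists p, (chamber `&` @free_cyl R) p /\ ~ K p); last first.
  have FK : chamber `&` @free_cyl R `<=` K.
    by move=> p pF; apply: contrapT => pK; apply: none; exists p.
  have := @free_measure R; rewrite (null_sub _ _ FK (null_elipschitz_sphere2 f fL)).
  by rewrite lee_fin => h; exfalso; lra.
have [m [r0 mK]] : exists m, 0 < (radius m : R) /\ forall u v, csquare m u v -> (~` K) (u, v, (tip m).2).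
  apply: (hair_dense p) => //; apply: open_nbhs_nbhs; split => //.
  by rewrite openC; exact: closed_elipschitz_sphere2.
apply: (hausdorff2_square (tip m).1.1 (tip m).1.2 (tip m).2 (radius m)) => // u v hu hv; split.
  exact: tip_boundary.
by apply: mK; rewrite /csquare /in_csquare !ltW.
Qed.

End BoundaryNotCovered.

Theorem theorem3 (R : realType) :
  exists S : set (space3 R),
    [/\ S `<=` open_cube, shaved S & finite_perimeter S] /\
    [/\ connected S, connected (~` S), indecomposable S & saturated S] /\
    ((3999 / 4000)%:E < lebesgue3 (closure S `\` S))%E /\
    (forall phi : space3 R -> space3 R, elipschitz_on sphere2 phi ->
       (0 < hausdorff2 (measure_theoretic_boundary S `\` (phi @` sphere2)))%E).
Proof.
exists comb; split; first split.
- exact: comb_open_cube.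
- exact: shaved_open open_comb.
- exact: finite_perimeter_comb.
split; first split.
- exact: connected_comb.
- exact: connected_setC_comb.
- exact: indecomposable_comb.
- exact: saturated_comb.
split; [exact: closure_comb_measure|exact: boundary_not_covered].
Qed.
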